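(* Let $n\ge3$ and let $\Gamma<SL(n,\mathbb R)$ be a lattice. Then for every $d\in\mathbb N$, $\lim_{\delta\to0^+}F^{(d)}_\Gamma(\delta)=0$; that is, for every $\varepsilon>0$ there is $\delta>0$ such that every map $\mu:\Gamma\to U(d)$ with $\mu(e)=\mathrm{Id}$ and $\mathrm{def}(\mu)\le\delta$ is within uniform distance $\varepsilon$ of a unitary representation $\Gamma\to U(d)$.
   Context: For maps $\mu,\nu:\Gamma\to U(d)$ put $\|\mu-\nu\|=\sup_\gamma\|\mu(\gamma)-\nu(\gamma)\|$ (operator norm), $D(\mu)=\inf\{\|\mu-\nu\|:\nu\in\mathrm{Hom}(\Gamma,U(d))\}$, $\mathrm{def}(\mu)=\sup_{x,y}\|\mu(xy)-\mu(x)\mu(y)\|$, and $F^{(d)}_\Gamma(\delta)=\sup\{D(\mu):\mathrm{def}(\mu)\le\delta,\ \mu(e)=\mathrm{Id}\}$, supremum over maps $\mu:\Gamma\to U(d)$ ($d$-dimensional Hilbert spaces). *)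

(* Defs.v *)
(* MathComp + MathComp-Analysis (reals: realType, sup) + real-closed complex. *)
From mathcomp Require Import all_boot all_algebra.
From mathcomp Require Import classical_sets reals.
From mathcomp Require Export complex.
Import GRing.Theory Num.Theory.
Local Open Scope ring_scope.

Set Implicit Arguments.
Unset Strict Implicit.
Unset Printing Implicit Defensive.

Section Defs.
Variable R : realType.

(** * The group SL(n,R) and lattices in it *)

Definition in_SL (n : nat) (A : 'M[R]_n) : Prop := \det A = 1.

(* max-entry norm on real matrices (any norm gives the same topology) *)
Definition mxmax (n : nat) (A : 'M[R]_n) : R :=
  \big[Num.max/0]_(ij : 'I_n * 'I_n) `|A ij.1 ij.2|.

Definition is_subgroup_SL (n : nat) (G : 'M[R]_n -> Prop) : Prop :=
  [/\ (forall g, G g -> in_SL g),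
      G 1%:M,
      (forall g h, G g -> G h -> G (g *m h)) &
      (forall g, G g -> G (invmx g))].

(* discrete: every point of G is isolated in G *)
Definition discrete_set (n : nat) (G : 'M[R]_n -> Prop) : Prop :=
  forall g, G g -> exists2 r : R, 0 < r &
    forall h, G h -> mxmax (h - g) < r -> h = g.

(* The Haar measure of SL(n,R) is realised as the cone measure:
   mu(F) = Lebesgue measure (on M_n(R) = R^(n*n)) of {t A | 0 < t <= 1, A in F}.
   It is left and right invariant since left/right multiplication by an element
   of SL(n,R) is a linear map of M_n(R) of determinant 1 commuting with scalars. *)
Definition cone (n : nat) (F : 'M[R]_n -> Prop) : 'M[R]_n -> Prop :=
  fun X => exists t : R, exists A : 'M[R]_n, [/\ 0 < t, t <= 1, F A & X = t *: A].

Definition box_vol (n : nat) (lo hi : 'M[R]_n) : R :=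
  \prod_(ij : 'I_n * 'I_n) (hi ij.1 ij.2 - lo ij.1 ij.2).

Definition in_box (n : nat) (lo hi X : 'M[R]_n) : Prop :=
  forall i j, lo i j <= X i j <= hi i j.

(* finite Lebesgue outer measure on M_n(R) ~ R^(n*n): covered by countably
   many closed boxes with bounded total volume *)
Definition finite_outer_leb (n : nat) (S : 'M[R]_n -> Prop) : Prop :=
  exists (lo hi : nat -> 'M[R]_n) (M : R),
    [/\ (forall k i j, lo k i j <= hi k i j),
        (forall X, S X -> exists k, in_box (lo k) (hi k) X) &
        (forall N, \sum_(k < N) box_vol (lo k) (hi k) <= M)].

(* finite covolume: some subset of SL(n,R) of finite (outer) Haar measure
   surjects onto SL(n,R)/Gamma, i.e. Gamma F = SL(n,R) *)
Definition finite_covolume (n : nat) (G : 'M[R]_n -> Prop) : Prop :=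
  exists F : 'M[R]_n -> Prop,
    [/\ (forall A, F A -> in_SL A),
        (forall g, in_SL g -> exists gam A, [/\ G gam, F A & g = gam *m A]) &
        finite_outer_leb (cone F)].

Definition lattice_SL (n : nat) (G : 'M[R]_n -> Prop) : Prop :=
  [/\ is_subgroup_SL G, discrete_set G & finite_covolume G].

(** * Unitary matrices, operator norm *)

Definition C := R[i].

Definition cnormsq (z : C) : R := (complex.Re z) ^+ 2 + (complex.Im z) ^+ 2.

(* Euclidean norm on C^d *)
Definition vnorm (d : nat) (v : 'cV[C]_d) : R := Num.sqrt (\sum_i cnormsq (v i 0)).

(* operator norm on M_d(C) *)
Definition opnorm (d : nat) (A : 'M[C]_d) : R :=
  sup [set vnorm (A *m v) | v in [set v : 'cV[C]_d | vnorm v = 1]].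

Definition unitary (d : nat) (U : 'M[C]_d) : Prop :=
  (map_mx (fun z : C => z^*) U)^T *m U = 1%:M.

(** * Defect, distance to representations *)
(* def(mu) = sup_{x,y in Gamma} || mu(xy) - mu(x) mu(y) || *)
Definition defect (n d : nat) (G : 'M[R]_n -> Prop) (mu : 'M[R]_n -> 'M[C]_d) : R :=
  sup [set opnorm (mu (xy.1 *m xy.2) - mu xy.1 *m mu xy.2)
      | xy in [set xy : 'M[R]_n * 'M[R]_n | G xy.1 /\ G xy.2]].

(* ||mu - nu|| = sup_{g in Gamma} || mu(g) - nu(g) || *)
Definition udist (n d : nat) (G : 'M[R]_n -> Prop) (mu nu : 'M[R]_n -> 'M[C]_d) : R :=
  sup [set opnorm (mu g - nu g) | g in G].

(* maps Gamma -> U(d) *)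
Definition unitary_valued (n d : nat) (G : 'M[R]_n -> Prop) (mu : 'M[R]_n -> 'M[C]_d) : Prop :=
  forall g, G g -> unitary (mu g).

(* homomorphisms Gamma -> U(d) *)
Definition unitary_rep (n d : nat) (G : 'M[R]_n -> Prop) (rho : 'M[R]_n -> 'M[C]_d) : Prop :=
  unitary_valued G rho /\ (forall x y, G x -> G y -> rho (x *m y) = rho x *m rho y).
End Defs.

(* Main.v *)
(** Let [mu] be a quasi-representation of defect [delta] and [nu] a genuine representation close to
    [mu] on a large finite set. Then [A g X = mu g X nu(g)^T] is a quasi-representation on matrices
    that almost fixes the identity [e] on this finite set, and it suffices to show that it almost
    fixes [e] on all of Gam: if the theorem failed, an ultralimit of counterexamples with defects
    tending to 0 would be a representation [nu] close to one of them on any given finite set.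

    Inducing [A] to SL_n through a fundamental domain gives isometries [U_h] on square integrable
    functions that compose up to [delta]. For an elementary subgroup R^2 normalised by an SL_2 the
    usual proof of relative property (T) survives: averaging matrix coefficients over Z^2 with an
    invariant mean produces a measure on the torus which is almost invariant under shears and a
    rotation, hence concentrated near the origin. Errors are controlled in total variation, uniformly
    in the number of points involved, because Toeplitz forms are bounded by the sup norm of their
    symbol. So the constant function [e] is almost fixed by all elementary matrices and, by bounded
    elementary generation, by all of SL_n.

    Near-invariance is then improved: in the convex hull of the translates of [e], a near-minimiser
    of an exactly invariant functional is moved by each [h] by at most about [delta], outside sets
    of arbitrarily small measure. By Fubini such a function is almost constant along Gam-orbits near
    a point where it is close to [e], which yields that [A g e] is close to [e] for every [g]. *)

Require Import Defs.
From HB Require Import structures.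
From mathcomp Require Import all_boot all_order all_algebra.
From mathcomp Require Import all_classical all_reals all_analysis.
From mathcomp Require Import measurable_realfun lra ring zify.
Import Order.TTheory GRing.Theory Num.Theory.
Import numFieldNormedType.Exports.
Set Implicit Arguments.
Unset Strict Implicit.
Unset Printing Implicit Defensive.
Local Open Scope classical_set_scope.
Local Open Scope ring_scope.

(** * Lebesgue measure on square matrices *)

(** The order of quantifiers shapes the proof: the finite set and the defect must be fixed before
    the element [ga] of Gam at which [A ga e] is estimated. Small displacement of [e] in mean square
    is not sufficient, since exceptional sets have to be small compared with volumes that depend on
    [ga]. Convex minimisation removes this obstacle: [tau] and [del] stay fixed, while the accuracy
    [eps] of the near-minimiser is chosen after [ga].

    As the U_h do not compose exactly, no spectral theorem is available for R^2. Only Gram matrices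
    are used: translated families of vectors are close to exactly isometric copies of one family,
    and averaging over base points yields an exactly positive definite function on Z^2. The lattice
    t Z^2 is taken so fine that its generators almost fix [e] by continuity, and the final bound
    does not depend on t.

    The measure lives on the matrices with 0 < det <= 1, with all functions built from a section
    [sfun] that is invariant under scaling; this replaces Haar measure on SL_n by Lebesgue
    measure. *)

Section TupleMeasure.
Context (R : realType) (d : measure_display) (T : measurableType d).
Variable m0 : {sigma_finite_measure set T -> \bar R}.
Local Open Scope ereal_scope.

Definition tcons N (p : T * N.-tuple T) : N.+1.-tuple T := [tuple of p.1 :: p.2].
Definition tuncons N (t : N.+1.-tuple T) : T * N.-tuple T :=
  (thead t, [tuple of behead t]).

Lemma tunconsK N : cancel (@tuncons N) (@tcons N).
Proof. by move=> t; rewrite /tcons/= -tuple_eta. Qed.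

Lemma tconsK N : cancel (@tcons N) (@tuncons N).
Proof. by case=> x t; congr pair; apply: val_inj. Qed.

Lemma measurable_tcons N : measurable_fun [set: T * N.-tuple T] (@tcons N).
Proof. exact: measurable_cons. Qed.

Lemma measurable_tuncons N : measurable_fun [set: N.+1.-tuple T] (@tuncons N).
Proof.
apply: measurable_fun_pair; last exact: measurable_behead.
exact: (measurable_tnth ord0).
Qed.

Section Step.
Variables (N : nat) (lam : {sigma_finite_measure set (N.-tuple T) -> \bar R}).

Definition tmeasS : set (N.+1.-tuple T) -> \bar R :=
  pushforward (m0 \x lam) (@tcons N).

Let tmeasS0 : tmeasS set0 = 0.
Proof. by rewrite /tmeasS /pushforward preimage_set0 measure0. Qed.
Let tmeasS_ge0 A : 0 <= tmeasS A.
Proof. by rewrite /tmeasS /pushforward; apply: integral_ge0 => *; exact: measure_ge0. Qed.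
Let tmeasS_sigma : semi_sigma_additive tmeasS.
Proof.
have mm := @measurable_tcons N.
move=> F mF tF mUF; rewrite /tmeasS /pushforward preimage_bigcup.
apply: measure_semi_sigma_additive.
- by move=> n; rewrite -[X in measurable X]setTI; exact: mm.
- apply/trivIsetP => /= i j _ _ ij; rewrite -preimage_setI.
  by move/trivIsetP : tF => /(_ _ _ _ _ ij) ->//; rewrite preimage_set0.
- by rewrite -preimage_bigcup -[X in measurable X]setTI; exact: mm.
Qed.

HB.instance Definition _ :=
  isMeasure.Build _ _ _ tmeasS tmeasS0 tmeasS_ge0 tmeasS_sigma.

Let tmeasS_sfin : sigma_finite setT tmeasS.
Proof.
have /sigma_finiteP[F [TF ndF Foo]] := sigma_finiteT m0.
have /sigma_finiteP[G [TG ndG Goo]] := sigma_finiteT lam.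
exists (fun k => @tuncons N @^-1` (F k `*` G k)).
  apply/esym; rewrite -subTset => t _.
  have [k1 _ Fk] : (\bigcup_k F k) (thead t) by rewrite -TF.
  have [k2 _ Gk] : (\bigcup_k G k) [tuple of behead t] by rewrite -TG.
  exists (maxn k1 k2) => //; split => /=.
  - by move: Fk; apply/subsetPset/ndF/leq_maxl.
  - by move: Gk; apply/subsetPset/ndG/leq_maxr.
move=> k; have [? ?] := Foo k; have [? ?] := Goo k; split.
  rewrite -[X in measurable X]setTI; apply: measurable_tuncons => //.
  exact: measurableX.
rewrite /tmeasS /pushforward -comp_preimage (_ : _ \o _ = id).
  by rewrite preimage_id product_measure1E// lte_mul_pinfty// ge0_fin_numE.
by apply/funext => x; exact: tconsK.
Qed.

HB.instance Definition _ := Measure_isSigmaFinite.Build _ _ _ tmeasS tmeasS_sfin.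
End Step.

(** The product measure is peeled off one coordinate at a time, so that its properties follow by
    induction from Fubini with two factors; the point mass at the empty tuple starts the
    recursion. *)
Fixpoint tmeas N : {sigma_finite_measure set (N.-tuple T) -> \bar R} :=
  match N with
  | 0%N => [the {sigma_finite_measure set (0.-tuple T) -> \bar R} of
           dirac ([tuple] : 0.-tuple T)]
  | N'.+1 => [the {sigma_finite_measure set (N'.+1.-tuple T) -> \bar R} of
           tmeasS (tmeas N')]
  end.

Lemma tmeasSE N A : tmeas N.+1 A = (m0 \x tmeas N) (@tcons N @^-1` A).
Proof. by []. Qed.

Lemma measurable_tcons_preimage N (A : set (N.+1.-tuple T)) :
  measurable A -> measurable (@tcons N @^-1` A).
Proof.
by move=> mA; rewrite -[X in measurable X]setTI; exact: measurable_tcons.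
Qed.

Lemma tmeasS_le_tail N (A B : set (N.+1.-tuple T)) (c : R) : (0 <= c)%R ->
  measurable A -> measurable B ->
  (forall x, tmeas N [set t | A (tcons (x, t))]
     <= c%:E * tmeas N [set t | B (tcons (x, t))]) ->
  tmeas N.+1 A <= c%:E * tmeas N.+1 B.
Proof.
move=> c0 mA mB AB; rewrite !tmeasSE /product_measure1.
have mA' := measurable_tcons_preimage mA.
have mB' := measurable_tcons_preimage mB.
have mfB := measurable_fun_xsection (tmeas N) mB'.
have xE (S : set (N.+1.-tuple T)) x :
    xsection (@tcons N @^-1` S) x = [set t | S (tcons (x, t))].
  by apply/seteqP; split => t /=; rewrite /xsection /= inE.
rewrite -ge0_integralZl//.
apply: ge0_le_integral => //=.
- exact: measurable_fun_xsection.
- exact: measurable_funeM.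
- by move=> x _; rewrite !xE.
Qed.

(** The head is now the inner variable, so the order of integration is exchanged through uniqueness
    of the product measure. *)
Lemma tmeasS_le_head N (A B : set (N.+1.-tuple T)) (c : R) : (0 <= c)%R ->
  measurable A -> measurable B ->
  (forall t, m0 [set x | A (tcons (x, t))] <= c%:E * m0 [set x | B (tcons (x, t))]) ->
  tmeas N.+1 A <= c%:E * tmeas N.+1 B.
Proof.
move=> c0 mA mB AB; rewrite !tmeasSE.
have mA' := measurable_tcons_preimage mA.
have mB' := measurable_tcons_preimage mB.
have E S : measurable S -> (m0 \x tmeas N) S = (m0 \x^ tmeas N) S.
  by apply: product_measure_unique => *; exact: product_measure2E.
rewrite !E// /product_measure2.
have mfB := measurable_fun_ysection m0 mB'.
have yE (S : set (N.+1.-tuple T)) t :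
    ysection (@tcons N @^-1` S) t = [set x | S (tcons (x, t))].
  by apply/seteqP; split => x /=; rewrite /ysection /= inE.
rewrite -ge0_integralZl//.
apply: ge0_le_integral => //=.
- exact: measurable_fun_ysection.
- exact: measurable_funeM.
- by move=> x _; rewrite !yE.
Qed.

End TupleMeasure.

Section LebesgueTuple.
Variable R : realType.
Local Open Scope ereal_scope.

(** Lebesgue measure retyped from [measurableTypeR R] to [R] itself, the carrier over which tuples
    are formed. *)
Definition leb (A : set R) : \bar R := lebesgue_measure (A : set (measurableTypeR R)).

Let leb0 : leb set0 = 0. Proof. exact: measure0. Qed.
Let leb_ge0 A : 0 <= leb A. Proof. exact: measure_ge0. Qed.
Let leb_sigma : semi_sigma_additive leb.
Proof. exact: (@measure_semi_sigma_additive _ _ _ (@lebesgue_measure R)). Qed.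
HB.instance Definition _ := isMeasure.Build _ R R leb leb0 leb_ge0 leb_sigma.
Let leb_sfin : sigma_finite setT leb.
Proof. exact: (sigma_finiteT (@lebesgue_measure R)). Qed.
HB.instance Definition _ := Measure_isSigmaFinite.Build _ R R leb leb_sfin.

(** [a] times the image of Lebesgue measure under x -> a x + c gives each interval ]u, v] its
    length, so it is Lebesgue measure by uniqueness. *)
Lemma leb_affine (a c : R) (A : set R) : (0 < a)%R -> measurable A ->
  leb [set x : R | A (a * x + c)%R] = (a^-1)%:E * leb A.
Proof.
move=> a0 mA.
have mf : measurable_fun [set: R] (fun x : R => (a * x + c)%R : R).
  by apply: measurable_funD => //; exact: mulrl_measurable.
have mf' : measurable_fun [set: measurableTypeR R]
    (fun x : measurableTypeR R => (a * x + c)%R : measurableTypeR R) by exact: mf.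
have a1 : (0 <= a)%R by exact: ltW.
pose m0 := measure_function_pushforward__canonical__measure_function_Measure
  (@lebesgue_measure R) mf'.
pose m := [the {measure set (measurableTypeR R) -> \bar R} of mscale (NngNum a1) m0].
rewrite [in RHS]/leb.
rewrite (@lebesgue_measure_unique _ m _ A mA).
  by rewrite /m /= /mscale /m0 /= /pushforward /leb muleA -EFinM mulVf ?mul1e// gt_eqF.
move=> _ [[u v]] _ <-; rewrite /m /= /mscale /m0 /= /pushforward /leb.
rewrite (_ : _ @^-1` _ = [set` `](u - c) / a, (v - c) / a]%R]); last first.
  apply/seteqP; split => x /=; rewrite !in_itv/= ltr_pdivrMr// ler_pdivlMr//;
  by rewrite ltrBlDr lerBrDr mulrC.
rewrite !lebesgue_measure_itv/= !lte_fin ltr_pM2r ?invr_gt0// ltrD2r.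
case: ifP => _; last by rewrite mule0.
by rewrite -!EFinD -EFinM; congr EFin; field; rewrite gt_eqF.
Qed.

(** An inequality is the convenient form: for an invertible map it becomes an equality once it holds
    for the inverse too, and dilations by a factor at least 1 satisfy it as well. It is stable under
    composition, so maps can be built from shears. *)
Definition ncr d (T : measurableType d) (m : set T -> \bar R) (f : T -> T) :=
  measurable_fun setT f /\ forall A, measurable A -> m (f @^-1` A) <= m A.

Lemma ncr_comp d (T : measurableType d) (m : set T -> \bar R) f g :
  ncr m f -> ncr m g -> ncr m (f \o g).
Proof.
move=> [mf hf] [mg hg]; split; first exact: measurableT_comp.
move=> A mA; rewrite comp_preimage (le_trans (hg _ _)) ?hf//.
by rewrite -[X in measurable X]setTI; exact: mf.
Qed.

Notation lebn := (tmeas [the {sigma_finite_measure set R -> \bar R} of leb]).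

Lemma ncr_head N (f : N.+1.-tuple R -> N.+1.-tuple R) (h : N.-tuple R -> R -> R) :
  measurable_fun setT f -> (forall x t, f (tcons (x, t)) = tcons (h t x, t)) ->
  (forall t A, measurable A -> leb (h t @^-1` A) <= leb A) ->
  ncr (lebn N.+1) f.
Proof.
move=> mf fE hh; split => // A mA; rewrite -[leRHS]mul1e.
have mfA : measurable (f @^-1` A) by rewrite -[X in measurable X]setTI; exact: mf.
apply: tmeasS_le_head => // t; rewrite mul1e.
rewrite (_ : [set x | _] = h t @^-1` [set x | A (tcons (x, t))]).
  apply: hh; rewrite (_ : [set x | _] = ysection (@tcons _ _ N @^-1` A) t).
    by apply: measurable_ysection; apply: measurable_tcons_preimage.
  by apply/seteqP; split => x /=; rewrite /ysection /= inE.
by apply/seteqP; split => x /=; rewrite fE.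
Qed.

Lemma ncr_tail N (f : N.+1.-tuple R -> N.+1.-tuple R)
    (g : R -> N.-tuple R -> N.-tuple R) :
  measurable_fun setT f -> (forall x t, f (tcons (x, t)) = tcons (x, g x t)) ->
  (forall x, ncr (lebn N) (g x)) ->
  ncr (lebn N.+1) f.
Proof.
move=> mf fE hh; split => // A mA; rewrite -[leRHS]mul1e.
have mfA : measurable (f @^-1` A) by rewrite -[X in measurable X]setTI; exact: mf.
apply: tmeasS_le_tail => // x; rewrite mul1e.
rewrite (_ : [set t | _] = g x @^-1` [set t | A (tcons (x, t))]).
  apply: (hh x).2; rewrite (_ : [set t | _] = xsection (@tcons _ _ N @^-1` A) x).
    by apply: measurable_xsection; apply: measurable_tcons_preimage.
  by apply/seteqP; split => t /=; rewrite /xsection /= inE.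
by apply/seteqP; split => t /=; rewrite fE.
Qed.

Definition tadd N (i : 'I_N) (a : N.-tuple R -> R) (t : N.-tuple R) : N.-tuple R :=
  [tuple (tnth t j + (if j == i then a t else 0))%R | j < N].

Lemma measurable_tadd N (i : 'I_N) a : measurable_fun setT a ->
  measurable_fun setT (tadd i a).
Proof.
move=> ma; apply/measurable_fun_tnthP => j.
rewrite (_ : _ \o _ = (fun t => tnth t j + (if j == i then a t else 0))%R).
  apply: measurable_funD; first exact: measurable_tnth.
  by case: (j == i).
by apply/funext => t /=; rewrite tnth_mktuple.
Qed.

Lemma tcons0 N (x : R) (t : N.-tuple R) : tnth (tcons (x, t)) ord0 = x.
Proof. by []. Qed.
Lemma tconsS N (x : R) (t : N.-tuple R) j : tnth (tcons (x, t)) (lift ord0 j) = tnth t j.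
Proof. by rewrite /tcons tnthS. Qed.

Lemma tadd_head N (a : N.+1.-tuple R -> R) x t :
  tadd ord0 a (tcons (x, t)) = tcons (x + a (tcons (x, t)), t)%R.
Proof.
apply: eq_from_tnth => j; rewrite tnth_mktuple.
case: (unliftP ord0 j) => [j'|] ->; first by rewrite !tconsS addr0.
by rewrite eqxx.
Qed.

Lemma tadd_tail N i (a : N.+1.-tuple R -> R) x t :
  tadd (lift ord0 i) a (tcons (x, t)) = tcons (x, tadd i (fun t => a (tcons (x, t))) t).
Proof.
apply: eq_from_tnth => j; rewrite tnth_mktuple.
case: (unliftP ord0 j) => [j'|] ->; last by rewrite addr0.
by rewrite !tconsS tnth_mktuple (inj_eq lift_inj).
Qed.

Lemma ncr_shift N (i : 'I_N) (c : R) : ncr (lebn N) (tadd i (cst c)).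
Proof.
elim: N i c => [[]//|N IH] i c.
case: (unliftP ord0 i) => [i'|] ->; last first.
  apply: (@ncr_head _ _ (fun _ x => x + c)%R).
  - exact: measurable_tadd.
  - by move=> x t; rewrite tadd_head.
  - move=> t A mA; have := @leb_affine 1 c A ltr01 mA.
    by rewrite invr1 mul1e => <-; under eq_set do rewrite mul1r.
apply: (@ncr_tail _ _ (fun _ => tadd i' (cst c))) => //.
  exact: measurable_tadd.
by move=> x t; rewrite tadd_tail.
Qed.

(** Induction on the number of coordinates. If [i] is the head, each slice in the head direction is
    translated; if [j] is the head, the tail is translated by a constant; otherwise the shear takes
    place in the tail. *)
Lemma ncr_shear N (i j : 'I_N) (c : R) : i != j ->
  ncr (lebn N) (tadd i (fun t => c * tnth t j)%R).
Proof.
elim: N i j c => [[]//|N IH] i j c ij.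
have mm : measurable_fun setT (tadd i (fun t => c * tnth t j)%R).
  by apply: measurable_tadd; apply: measurable_funM => //; exact: measurable_tnth.
case: (unliftP ord0 i) => [i'|] iE; case: (unliftP ord0 j) => [j'|] jE; subst i j.
- apply: (@ncr_tail _ _ (fun _ => tadd i' (fun t => c * tnth t j')%R)) => //.
    move=> x t; rewrite tadd_tail; congr (tcons (_, tadd _ _ _)).
    by apply/funext => t'; rewrite tconsS.
  by move=> _; apply: IH; rewrite (inj_eq lift_inj) in ij.
- apply: (@ncr_tail _ _ (fun x => tadd i' (cst (c * x)%R))) => //.
    by move=> x t; rewrite tadd_tail.
  by move=> x; exact: ncr_shift.
- apply: (@ncr_head _ _ (fun t x => x + c * tnth t j')%R) => //.
    by move=> x t; rewrite tadd_head tconsS.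
  move=> t A mA; have := @leb_affine 1 (c * tnth t j')%R A ltr01 mA.
  by rewrite invr1 mul1e => <-; under eq_set do rewrite mul1r.
- by rewrite eqxx in ij.
Qed.

Definition tscale N (c : R) (t : N.-tuple R) : N.-tuple R :=
  [tuple (c * tnth t j)%R | j < N].

Lemma measurable_tscale N c : measurable_fun setT (@tscale N c).
Proof.
apply/measurable_fun_tnthP => j.
rewrite (_ : _ \o _ = (fun t => c * tnth t j)%R).
  by apply: measurable_funM => //; exact: measurable_tnth.
by apply/funext => t /=; rewrite tnth_mktuple.
Qed.

Lemma ncr_scale N (c : R) : (1 <= c)%R -> ncr (lebn N) (@tscale N c).
Proof.
move=> c1; have c0 : (0 < c)%R by exact: lt_le_trans c1.
elim: N => [|N IH].
  split; first exact: measurable_tscale.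
  by move=> A mA; rewrite (_ : _ @^-1` _ = A)//; apply/seteqP; split => t /=;
    rewrite (tuple0 t) (tuple0 (tscale _ _)).
pose f1 (t : N.+1.-tuple R) := tcons (c * thead t, [tuple of behead t])%R : N.+1.-tuple R.
pose f2 (t : N.+1.-tuple R) := tcons (thead t, tscale c [tuple of behead t])%R : N.+1.-tuple R.
have f1E x t : f1 (tcons (x, t)) = tcons (c * x, t)%R.
  by rewrite /f1; congr (tcons (_, _)); apply: val_inj.
have f2E x t : f2 (tcons (x, t)) = tcons (x, tscale c t)%R.
  by rewrite /f2; congr (tcons (_, tscale _ _)); apply: val_inj.
have -> : @tscale N.+1 c = f1 \o f2.
  apply/funext => t; rewrite -[t]tunconsK; case: (tuncons t) => x u /=.
  rewrite f2E f1E; apply: eq_from_tnth => j; rewrite tnth_mktuple.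
  case: (unliftP ord0 j) => [j'|] ->; last by rewrite !tcons0.
  by rewrite !tconsS tnth_mktuple.
apply: ncr_comp.
- apply: (@ncr_head _ _ (fun _ x => c * x)%R).
  + apply: measurableT_comp; first exact: measurable_tcons.
    apply: measurable_fun_pair; last exact: measurable_behead.
    by apply: measurable_funM => //; exact: (measurable_tnth ord0).
  + exact: f1E.
  + move=> t A mA; have := @leb_affine c 0 A c0 mA.
    under eq_set do rewrite addr0.
    by move=> ->; rewrite gee_pMl// lee_fin invf_le1.
- apply: (@ncr_tail _ _ (fun _ => @tscale N c)) => //.
  + apply: measurableT_comp; first exact: measurable_tcons.
    apply: measurable_fun_pair; first exact: (measurable_tnth ord0).
    apply: (measurableT_comp (@measurable_tscale N c)).
    exact: measurable_behead.
Qed.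

Definition tbox N (lo hi : 'I_N -> R) : set (N.-tuple R) :=
  [set t | forall i, (lo i <= tnth t i <= hi i)%R].

Lemma measurable_tbox N lo hi : measurable (@tbox N lo hi).
Proof.
rewrite (_ : tbox lo hi = \bigcap_(i in [set: 'I_N])
    ((@tnth _ R ^~ i) @^-1` [set` `[lo i, hi i]%R])).
  apply: fin_bigcap_measurable; first exact: (@finite_finset _ [set: _]).
  move=> i _; rewrite -[X in measurable X]setTI.
  exact: measurable_tnth.
apply/seteqP; split => t /= H; first by move=> i _ /=; rewrite in_itv/=; exact: H.
by move=> i; have := H i I; rewrite /= in_itv.
Qed.

Lemma lebn_box N (lo hi : 'I_N -> R) : (forall i, lo i <= hi i)%R ->
  lebn N (tbox lo hi) = (\prod_(i < N) (hi i - lo i))%:E.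
Proof.
elim: N lo hi => [|N IH] lo hi lh.
  rewrite big_ord0 /= diracE (_ : _ \in _ = true)//.
  by apply/mem_set => -[].
rewrite tmeasSE big_ord_recl.
rewrite (_ : _ @^-1` _ = [set` `[lo ord0, hi ord0]%R] `*`
   tbox (lo \o lift ord0) (hi \o lift ord0)); last first.
  apply/seteqP; split => -[x t] /=.
    move=> H; split; first by have := H ord0; rewrite tcons0 in_itv.
    by move=> i; have := H (lift ord0 i); rewrite tconsS.
  rewrite in_itv/= => -[H1 H2] i; case: (unliftP ord0 i) => [i'|] ->//.
  by rewrite tconsS; exact: H2.
rewrite product_measure1E//; last exact: measurable_tbox.
rewrite IH => [|i]; last exact: lh.
rewrite [X in X * _]lebesgue_measure_itv/= lte_fin EFinM; case: ltP => // h.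
have -> : (hi ord0 - lo ord0 = 0)%R by apply/eqP; rewrite subr_eq0 eq_le h lh.
by [].
Qed.

End LebesgueTuple.

(** * Bounded elementary generation of SL_n *)

Section Elementary.
Variable F : fieldType.

Definition elmx n (i j : 'I_n) (c : F) : 'M[F]_n := 1%:M + c *: delta_mx i j.

Lemma elmxD n (i j : 'I_n) a b : i != j -> elmx i j a *m elmx i j b = elmx i j (a + b).
Proof.
move=> ij; rewrite /elmx mulmxDl mul1mx mulmxDr mulmx1 -scalemxAl -scalemxAr.
rewrite mul_delta_mx_cond eq_sym (negPf ij) mulr0n !scaler0 addr0 scalerDl.
by rewrite -addrA; congr (_ + _); rewrite addrC.
Qed.

Lemma elmx0 n (i j : 'I_n) : elmx i j 0 = 1%:M.
Proof. by rewrite /elmx scale0r addr0. Qed.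

Lemma det_elmx n (i j : 'I_n) c : i != j -> \det (elmx i j c) = 1.
Proof.
have H (k l : 'I_n) : (l < k)%N -> \det (elmx k l c) = 1.
  move=> lk; rewrite det_trig.
    apply: big1 => m _; rewrite !mxE eqxx; have [->|_] := eqVneq m k.
      by rewrite -(inj_eq val_inj)/= gtn_eqF// mulr0 addr0.
    by rewrite mulr0 addr0.
  apply/is_trig_mxP => a b ab; rewrite !mxE -(inj_eq val_inj) ltn_eqF// add0r.
  have [ak|_] := eqVneq a k; last by rewrite mulr0.
  have [bl|_] := eqVneq b l; last by rewrite mulr0.
  by move: ab; rewrite ak bl ltnNge (ltnW lk).
move=> ij; have [ji|ij'|/val_inj ijE] := ltngtP j i; first exact: H.
  rewrite -det_tr /elmx linearD /= trmx1 linearZ/= trmx_delta; exact: H.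
by rewrite ijE eqxx in ij.
Qed.

(** The index is an upper bound on the number of factors, not the number itself: the identity has
    every index. *)
Inductive elprod n : nat -> 'M[F]_n -> Prop :=
| elprod0 L : elprod L 1%:M
| elprodS L i j c A : i != j -> elprod L A -> elprod L.+1 (elmx i j c *m A).

Lemma elprodM n L L' (A B : 'M[F]_n) :
  elprod L A -> elprod L' B -> elprod (L + L') (A *m B).
Proof.
move=> hA hB; elim: hA => {L A} [L|L i j c A ij _ IH].
  rewrite mul1mx addnC; elim: hB => {L' B} [L'|L' i j c A ij _ IH]; first exact: elprod0.
  by rewrite addSn; exact: elprodS.
by rewrite -mulmxA addSn; exact: elprodS.
Qed.

Lemma elprod1 n (i j : 'I_n) c : i != j -> elprod 1 (elmx i j c).
Proof. by move=> ij; rewrite -[elmx _ _ _]mulmx1; apply: elprodS => //; exact: elprod0. Qed.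

Lemma elprod_leq n L L' (A : 'M[F]_n) : (L <= L')%N -> elprod L A -> elprod L' A.
Proof.
move=> /subnKC <- h; rewrite -[A]mulmx1; apply: elprodM => //; exact: elprod0.
Qed.

Lemma elprod_lmul n L (A : 'M[F]_n) i j c : i != j ->
  elprod L (elmx i j c *m A) -> elprod L.+1 A.
Proof.
move=> ij h; have -> : A = elmx i j (- c) *m (elmx i j c *m A).
  by rewrite mulmxA elmxD// addNr elmx0 mul1mx.
exact: elprodS.
Qed.

Lemma elprod_lower n (v : 'cV[F]_n) : elprod n (block_mx 1%:M 0 v 1%:M : 'M[F]_(1 + n)).
Proof.
pose P (s : seq 'I_n) : 'M[F]_(1 + n) :=
  1%:M + \sum_(k <- s) v k 0 *: delta_mx (rshift 1 k) (lshift n 0).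
suff H s : elprod (size s) (P s).
  have -> : block_mx 1%:M 0 v 1%:M = P (enum 'I_n).
    rewrite /P; apply/matrixP => i j; rewrite big_enum/=.
    rewrite [in RHS]mxE [X in _ + X]summxE.
    case: (split_ordP i) => i' ->; case: (split_ordP j) => j' ->;
      rewrite ?block_mxEul ?block_mxEur ?block_mxEdl ?block_mxEdr ?mxE
      ?eq_lshift ?eq_rshift ?eq_lrshift ?eq_rlshift.
    - by rewrite big1 ?addr0// => k _; rewrite !mxE eq_lrshift/= mulr0.
    - by rewrite big1 ?addr0// => k _; rewrite !mxE eq_lrshift/= mulr0.
    - rewrite (bigD1 i')//= big1 ?addr0 => [|k ki]; last first.
        by rewrite !mxE eq_rshift eq_sym (negPf ki) mulr0.
      by rewrite !mxE !eqxx !ord1 eqxx mulr1 add0r.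
    - by rewrite big1 ?addr0// => k _; rewrite !mxE eq_rlshift andbF mulr0.
  by rewrite -[n in elprod n]card_ord cardE; exact: H.
elim: s => [|k s IH]; first by rewrite /P big_nil addr0; exact: elprod0.
have -> : P (k :: s) = elmx (rshift 1 k) (lshift n 0) (v k 0) *m P s.
  rewrite /P big_cons /elmx mulmxDl mul1mx mulmxDr mulmx1 mulmx_sumr.
  rewrite [X in _ = _ + (_ + X)]big1 => [|l _]; last first.
    by rewrite -scalemxAl -scalemxAr mul_delta_mx_cond mulr0n !scaler0.
  by rewrite addr0 -!addrA; congr (_ + _); rewrite addrC.
by apply: elprodS => //; rewrite -(inj_eq val_inj).
Qed.

Lemma elprod_tr n L (A : 'M[F]_n) : elprod L A -> elprod L A^T.
Proof.
elim => {L A} [L|L i j c A ij _ IH]; first by rewrite trmx1; exact: elprod0.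
rewrite trmx_mul -addn1; apply: elprodM => //.
rewrite /elmx linearD /= trmx1 linearZ/= trmx_delta.
by apply: elprod1; rewrite eq_sym.
Qed.

Lemma elprod_upper n (v : 'rV[F]_n) : elprod n (block_mx 1%:M v 0 1%:M : 'M[F]_(1 + n)).
Proof.
have := elprod_tr (elprod_lower v^T).
by rewrite tr_block_mx !trmx1 trmxK trmx0.
Qed.

Lemma elprod_lift n L (B : 'M[F]_n) : elprod L B ->
  elprod L (block_mx 1%:M 0 0 B : 'M[F]_(1 + n)).
Proof.
elim => {L B} [L|L i j c A ij _ IH]; first by rewrite -scalar_mx_block; exact: elprod0.
have -> : block_mx 1%:M 0 0 (elmx i j c *m A) =
    elmx (rshift 1 i) (rshift 1 j) c *m block_mx 1%:M 0 0 A.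
  have -> : elmx (rshift 1 i) (rshift 1 j) c = block_mx 1%:M 0 0 (elmx i j c).
    rewrite /elmx; apply/matrixP => k l.
    case: (split_ordP k) => k' ->; case: (split_ordP l) => l' ->;
      rewrite ?block_mxEul ?block_mxEur ?block_mxEdl ?block_mxEdr ?mxE
      ?eq_lshift ?eq_rshift ?eq_lrshift ?eq_rlshift ?andbF/= ?mulr0 ?addr0//.
  by rewrite mulmx_block !mul0mx !mulmx0 !mul1mx !addr0 !add0r.
by apply: elprodS.
Qed.

(** In passing from m to m + 1, clearing the first column and the first row costs m operations each,
    and at most two more produce a pivot 1. *)
Fixpoint ellen n : nat := if n is m.+1 then (ellen m + m + m + 2)%N else 0%N.

Lemma elprod_SL n (A : 'M[F]_n) : \det A = 1 -> elprod (ellen n) A.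
Proof.
elim: n A => [|n IH] A dA.
  by rewrite (_ : A = 1%:M); [exact: elprod0|apply/matrixP => -[]].
(* A pivot 1 splits the matrix into a lower factor, a smaller block of determinant 1 and an upper
   factor. *)
have H1 (B : 'M[F]_(1 + n)) : \det B = 1 -> B 0 0 = 1 -> elprod (ellen n + n + n) B.
  move=> dB B0.
  pose r := ursubmx B; pose c := dlsubmx B; pose D := drsubmx B.
  have BE : B = block_mx 1%:M 0 c 1%:M *m block_mx 1%:M 0 0 (D - c *m r)
              *m block_mx 1%:M r 0 1%:M.
    rewrite !mulmx_block !mul0mx !mulmx0 !mulmx1 !mul1mx !addr0 !add0r subrKC.
    rewrite -[LHS]submxK; congr block_mx.
    by apply/matrixP => i j; rewrite !ord1 !mxE -[RHS]B0; congr (B _ _); apply: val_inj.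
    by rewrite mul1mx.
  have dD : \det (D - c *m r) = 1.
    have := dB; rewrite [X in \det X]BE !det_mulmx.
    by rewrite !det_lblock det_ublock !det1 !mul1r mulr1.
  rewrite [X in elprod _ X]BE; apply: elprodM; last exact: elprod_upper.
  rewrite [X in elprod X](addnC (ellen n)).
  apply: elprodM; first exact: elprod_lower.
  exact/elprod_lift/IH.
(* A nonzero entry below the corner turns the corner into 1 by a single row operation. *)
have H2 (B : 'M[F]_(1 + n)) k : \det B = 1 -> k != 0 -> B k 0 != 0 ->
    elprod (ellen n + n + n).+1 B.
  move=> dB k0 Bk; have k0' : 0 != k by rewrite eq_sym.
  apply: (@elprod_lmul _ _ _ 0 k ((1 - B 0 0) / B k 0)) => //; apply: H1.
    by rewrite det_mulmx dB mulr1 det_elmx.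
  rewrite /elmx mulmxDl mul1mx -scalemxAl !mxE (bigD1 k)//= big1 => [|l lk]; last first.
    by rewrite !mxE (negPf lk) andbF mul0r.
  by rewrite !mxE !eqxx mul1r addr0 mulfVK// subrKC.
case: n => [|n] in A dA IH H1 H2 *.
  rewrite (_ : A = 1%:M); first exact: elprod0.
  by apply/matrixP => i j; rewrite !ord1 !mxE eqxx/= -[RHS]dA det_mx11.
rewrite /= addn2; have [[k /andP[k0 Ak]]|H] :=
  pselect (exists k, (k != 0) && (A k 0 != 0)).
  by apply: elprod_leq (H2 _ k _ _ _) => //.
have H' k : k != 0 -> A k 0 = 0.
  by move=> k0; apply/eqP/negP => /negP Ak; apply: H; exists k; rewrite k0.
have A0 : A 0 0 != 0.
  apply/negP => /eqP A0; move/eqP: dA; rewrite (expand_det_col _ 0) big1.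
    by rewrite eq_sym oner_eq0.
  by move=> k _; have [->|/H' ->] := eqVneq k 0; rewrite ?A0 mul0r.
have n0 : (1 : 'I_n.+2) != 0 by [].
(* The first column vanishes below the corner; adding the first row to the second leads back to
   [H2]. *)
apply: (@elprod_lmul _ _ _ 1 0 1) => //; apply: (H2 _ 1) => //.
  by rewrite det_mulmx det_elmx// dA mulr1.
rewrite /elmx mulmxDl mul1mx -scalemxAl !mxE H'// (bigD1 0)//= big1 => [|l l0].
  by rewrite !mxE !eqxx !mul1r addr0 add0r.
by rewrite !mxE (negPf l0) andbF mul0r.
Qed.

End Elementary.

(** * Lebesgue measure on matrices and its invariance under SL_n *)

Section MatrixMeasurable.
Variables (R : realType) (n : nat).

Notation N := #|{: 'I_n * 'I_n}|.

Definition mdec (t : N.-tuple R) : 'M[R]_n :=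
  \matrix_(i, j) tnth t (enum_rank (i, j)).
Definition menc (X : 'M[R]_n) : N.-tuple R :=
  [tuple X (enum_val k).1 (enum_val k).2 | k < N].

Lemma mdecK : cancel mdec menc.
Proof.
move=> t; apply: eq_from_tnth => k; rewrite tnth_mktuple mxE.
by rewrite -surjective_pairing enum_valK.
Qed.
Lemma mencK : cancel menc mdec.
Proof. by move=> X; apply/matrixP => i j; rewrite mxE tnth_mktuple enum_rankK. Qed.

Definition mx_measurable : set (set 'M[R]_n) := [set A | measurable (mdec @^-1` A)].

Let mxm0 : mx_measurable set0.
Proof. by rewrite /mx_measurable /= preimage_set0; exact: measurable0. Qed.
Let mxmC A : mx_measurable A -> mx_measurable (~` A).
Proof. by rewrite /mx_measurable /= preimage_setC; exact: measurableC. Qed.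
Let mxmU (F : (set 'M[R]_n)^nat) : (forall i, mx_measurable (F i)) ->
  mx_measurable (\bigcup_i (F i)).
Proof.
by move=> h; rewrite /mx_measurable /= preimage_bigcup; exact: bigcupT_measurable.
Qed.

HB.instance Definition _ := @isMeasurable.Build default_measure_display
  'M[R]_n mx_measurable mxm0 mxmC mxmU.

Lemma measurable_mdec : measurable_fun setT mdec.
Proof. by move=> _ A mA; rewrite setTI. Qed.

Lemma measurable_mxP d (T : measurableType d) (f : T -> 'M[R]_n) :
  (forall i j, measurable_fun setT (fun x => f x i j)) -> measurable_fun setT f.
Proof.
move=> mf _ A mA; rewrite setTI.
have -> : f @^-1` A = (menc \o f) @^-1` (mdec @^-1` A).
  by apply/seteqP; split => x /=; rewrite mencK.
rewrite -[X in measurable X]setTI.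
suff : measurable_fun setT (menc \o f) by exact.
apply/measurable_fun_tnthP => k.
rewrite (_ : _ \o _ = fun x => f x (enum_val k).1 (enum_val k).2)//.
by apply/funext => x /=; rewrite tnth_mktuple.
Qed.

Lemma measurable_entry i j : measurable_fun setT (fun X : 'M[R]_n => X i j).
Proof.
move=> _ A mA; rewrite setTI.
rewrite (_ : _ @^-1` A = menc @^-1` ((@tnth _ R ^~ (enum_rank (i, j))) @^-1` A)).
  change (measurable (mdec @^-1` (menc @^-1` (@tnth N R ^~ (enum_rank (i, j)) @^-1` A)))).
  rewrite -comp_preimage (_ : menc \o mdec = id); last exact/funext/mdecK.
  rewrite preimage_id -[X in measurable X]setTI; exact: measurable_tnth.
by apply/seteqP; split => X /=; rewrite tnth_mktuple enum_rankK.
Qed.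

Lemma measurable_mx_entry d (T : measurableType d) (f : T -> 'M[R]_n) i j :
  measurable_fun setT f -> measurable_fun setT (fun x => f x i j).
Proof. by move=> mf; exact: (measurableT_comp (measurable_entry i j) mf). Qed.

Lemma measurable_sum d (T : measurableType d) (I : Type) (s : seq I) (F : I -> T -> R) :
  (forall i, measurable_fun setT (F i)) ->
  measurable_fun setT (fun x => \sum_(i <- s) F i x).
Proof.
move=> mF; elim: s => [|i s IH].
  by rewrite (_ : (fun _ => _) = cst 0)//; apply/funext => x; rewrite big_nil.
rewrite (_ : (fun _ => _) = (fun x => F i x + \sum_(i <- s) F i x)).
  exact: measurable_funD.
by apply/funext => x; rewrite big_cons.
Qed.

Lemma measurable_prod d (T : measurableType d) (I : Type) (s : seq I) (F : I -> T -> R) :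
  (forall i, measurable_fun setT (F i)) ->
  measurable_fun setT (fun x => \prod_(i <- s) F i x).
Proof.
move=> mF; elim: s => [|i s IH].
  by rewrite (_ : (fun _ => _) = cst 1)//; apply/funext => x; rewrite big_nil.
rewrite (_ : (fun _ => _) = (fun x => F i x * \prod_(i <- s) F i x)).
  exact: measurable_funM.
by apply/funext => x; rewrite big_cons.
Qed.

Lemma measurable_mulmx d (T : measurableType d) (f g : T -> 'M[R]_n) :
  measurable_fun setT f -> measurable_fun setT g ->
  measurable_fun setT (fun x => f x *m g x).
Proof.
move=> mf mg; apply: measurable_mxP => i j.
under eq_fun do rewrite mxE.
apply: measurable_sum => k; apply: measurable_funM; exact: measurable_mx_entry.
Qed.

Lemma measurable_scalemx d (T : measurableType d) (a : T -> R) (f : T -> 'M[R]_n) :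
  measurable_fun setT a -> measurable_fun setT f ->
  measurable_fun setT (fun x => a x *: f x).
Proof.
move=> ma mf; apply: measurable_mxP => i j.
under eq_fun do rewrite mxE.
apply: measurable_funM => //; exact: measurable_mx_entry.
Qed.

Lemma measurable_det : measurable_fun setT (fun X : 'M[R]_n => \det X).
Proof.
apply: measurable_sum => s; apply: measurable_funM => //.
by apply: measurable_prod => i; exact: measurable_entry.
Qed.

Local Open Scope ereal_scope.
Notation lebN := (tmeas [the {sigma_finite_measure set R -> \bar R} of @leb R] N).

Definition mxleb (A : set 'M[R]_n) : \bar R := lebN (mdec @^-1` A).

Let mxleb0 : mxleb set0 = 0.
Proof. by rewrite /mxleb preimage_set0 measure0. Qed.
Let mxleb_ge0 A : 0 <= mxleb A.
Proof. exact: measure_ge0. Qed.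
Let mxleb_sigma : semi_sigma_additive mxleb.
Proof.
exact: (@measure_semi_sigma_additive _ _ _
  (measure_function_pushforward__canonical__measure_function_Measure lebN measurable_mdec)).
Qed.
HB.instance Definition _ := isMeasure.Build _ _ _ mxleb mxleb0 mxleb_ge0 mxleb_sigma.

Let mxleb_sfin : sigma_finite setT mxleb.
Proof.
have [F FT Foo] := sigma_finiteT lebN.
exists (fun k => menc @^-1` F k).
  by rewrite -preimage_bigcup -FT preimage_setT.
have E k : mdec @^-1` (menc @^-1` F k) = F k.
  by apply/seteqP; split => t /=; rewrite mdecK.
move=> k; have [mF F1] := Foo k; split; last by rewrite /mxleb E.
by change (measurable (mdec @^-1` (menc @^-1` F k))); rewrite E.
Qed.
HB.instance Definition _ := Measure_isSigmaFinite.Build _ _ _ mxleb mxleb_sfin.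

Lemma ncr_mxleb (f : 'M[R]_n -> 'M[R]_n) g : ncr lebN g ->
  (forall t, f (mdec t) = mdec (g t)) -> ncr mxleb f.
Proof.
move=> [mg hg] fg; split.
  move=> _ A mA; rewrite setTI; change (measurable (mdec @^-1` (f @^-1` A))).
  rewrite (_ : _ @^-1` _ = g @^-1` (mdec @^-1` A)); last first.
    by apply/seteqP; split => t /=; rewrite fg.
  by rewrite -[X in measurable X]setTI; exact: mg.
move=> A mA; rewrite /mxleb (_ : mdec @^-1` (f @^-1` A) = g @^-1` (mdec @^-1` A)).
  exact: hg.
by apply/seteqP; split => t /=; rewrite fg.
Qed.

Lemma ncr_mxscale (c : R) : (1 <= c)%R -> ncr mxleb (fun X => c *: X)%R.
Proof.
move=> c1; apply: (ncr_mxleb (ncr_scale N c1)) => t.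
by apply/matrixP => i j; rewrite !mxE tnth_mktuple.
Qed.

Definition addent (a b : 'I_n * 'I_n) (c : R) (X : 'M[R]_n) : 'M[R]_n :=
  (X + (c * X b.1 b.2) *: delta_mx a.1 a.2)%R.

Lemma ncr_addent a b c : a != b -> ncr mxleb (addent a b c).
Proof.
case: a => a1 a2 ab; have ab' : enum_rank (a1, a2) != enum_rank b by rewrite (inj_eq enum_rank_inj).
apply: (ncr_mxleb (ncr_shear c ab')) => t; apply/matrixP => i j.
rewrite !mxE tnth_mktuple -surjective_pairing (inj_eq enum_rank_inj).
by rewrite xpair_eqE; case: (_ && _); rewrite ?mulr1 ?mulr0.
Qed.

(** The entries read are never among the entries written, so performing the shears one after the
    other amounts to performing them at once. Multiplication by an elementary matrix is of this
    kind, with one shear per row or column. *)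
Lemma ncr_addents (K : Type) (s : seq K) (a b : K -> 'I_n * 'I_n) c :
  (forall k l, a k != b l) ->
  ncr mxleb (fun X => X + \sum_(k <- s) (c * X (b k).1 (b k).2) *: delta_mx (a k).1 (a k).2)%R.
Proof.
move=> ab; elim: s => [|k s IH].
  rewrite (_ : (fun _ => _) = id); first by split => //; exact: measurable_id.
  by apply/funext => X; rewrite big_nil addr0.
rewrite (_ : (fun _ => _) = addent (a k) (b k) c \o (fun X : 'M[R]_n => X +
    \sum_(k <- s) (c * X (b k).1 (b k).2) *: delta_mx (a k).1 (a k).2)%R).
  by apply: ncr_comp => //; exact: ncr_addent.
apply/funext => X; rewrite big_cons /= /addent -addrA; congr (_ + _)%R.
set Y := (X + _)%R; suff -> : Y (b k).1 (b k).2 = X (b k).1 (b k).2 by rewrite addrC.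
rewrite mxE summxE big1 ?addr0// => l _; rewrite !mxE.
have := ab l k; case: (a l) (b k) => [a1 a2] [b1 b2] /=.
by rewrite eq_sym xpair_eqE => /negPf ->; rewrite mulr0.
Qed.

Lemma ncr_elmxr i j c : i != j -> ncr mxleb (fun X => X *m elmx i j c).
Proof.
move=> ij; rewrite (_ : (fun _ => _) = (fun X : 'M[R]_n => X +
    \sum_(k <- enum 'I_n) (c * X k i) *: delta_mx k j)%R).
  apply: (@ncr_addents _ _ (fun k => (k, j)) (fun k => (k, i))) => k l.
  by rewrite xpair_eqE negb_and [j == i]eq_sym ij orbT.
apply/funext => X; rewrite /elmx mulmxDr mulmx1; congr (_ + _)%R.
apply/matrixP => k l; rewrite -scalemxAr mxE big_enum/= summxE mxE.
rewrite (bigD1 i)//= big1 ?addr0 => [|m mi]; last by rewrite mxE (negPf mi) mulr0.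
rewrite (bigD1 k)//= big1 ?addr0 => [|m mi]; last by rewrite !mxE eq_sym (negPf mi) mulr0.
by rewrite !mxE !eqxx mulrA.
Qed.

Lemma ncr_elmxl i j c : i != j -> ncr mxleb (fun X => elmx i j c *m X).
Proof.
move=> ij; rewrite (_ : (fun _ => _) = (fun X : 'M[R]_n => X +
    \sum_(k <- enum 'I_n) (c * X j k) *: delta_mx i k)%R).
  apply: (@ncr_addents _ _ (fun k => (i, k)) (fun k => (j, k))) => k l.
  by rewrite xpair_eqE negb_and ij.
apply/funext => X; rewrite /elmx mulmxDl mul1mx; congr (_ + _)%R.
apply/matrixP => k l; rewrite -scalemxAl mxE big_enum/= summxE mxE.
rewrite (bigD1 j)//= big1 ?addr0 => [|m mi]; last by rewrite mxE (negPf mi) andbF mul0r.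
rewrite (bigD1 l)//= big1 ?addr0 => [|m mi].
  by rewrite !mxE !eqxx !andbT; case: (k == i); rewrite ?mulr1 ?mulr0 ?mul1r ?mul0r ?mulr0.
by rewrite !mxE [l == _]eq_sym (negPf mi) andbF mulr0.
Qed.

Lemma ncr_id : ncr mxleb id.
Proof. by split => //; exact: measurable_id. Qed.

Lemma ncr_SLr h : \det h = 1%R -> ncr mxleb (fun X => X *m h).
Proof.
move=> /elprod_SL; move: (ellen n) => L0; elim => {L0 h} [L|L i j c A ij _ IH].
  by under eq_fun do rewrite mulmx1; exact: ncr_id.
rewrite (_ : (fun _ => _) = (fun X : 'M[R]_n => X *m A) \o (fun X => X *m elmx i j c)).
  by apply: ncr_comp => //; exact: ncr_elmxr.
by apply/funext => X /=; rewrite mulmxA.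
Qed.

Lemma ncr_SLl h : \det h = 1%R -> ncr mxleb (fun X => h *m X).
Proof.
move=> /elprod_SL; move: (ellen n) => L0; elim => {L0 h} [L|L i j c A ij _ IH].
  by under eq_fun do rewrite mul1mx; exact: ncr_id.
rewrite (_ : (fun _ => _) = (fun X : 'M[R]_n => elmx i j c *m X) \o (fun X => A *m X)).
  by apply: ncr_comp => //; exact: ncr_elmxl.
by apply/funext => X /=; rewrite mulmxA.
Qed.

Lemma mxleb_SLr h A : \det h = 1%R -> measurable A ->
  mxleb [set X | A (X *m h)] = mxleb A.
Proof.
move=> dh mA; have [mf hf] := ncr_SLr dh.
have uh : h \in unitmx by rewrite unitmxE dh unitr1.
have dh' : \det (invmx h) = 1%R by rewrite det_inv dh invr1.
have [mg hg] := ncr_SLr dh'.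
apply/eqP; rewrite eq_le; apply/andP; split; first exact: hf.
have mA' : measurable ((fun X => X *m h) @^-1` A).
  by rewrite -[X in measurable X]setTI; exact: mf.
have := hg _ mA'; rewrite (_ : (fun X => X *m invmx h) @^-1` _ = A)//.
by apply/seteqP; split => X /=; rewrite mulmxKV.
Qed.

Lemma mxleb_SLl h A : \det h = 1%R -> measurable A ->
  mxleb [set X | A (h *m X)] = mxleb A.
Proof.
move=> dh mA; have [mf hf] := ncr_SLl dh.
have uh : h \in unitmx by rewrite unitmxE dh unitr1.
have dh' : \det (invmx h) = 1%R by rewrite det_inv dh invr1.
have [mg hg] := ncr_SLl dh'.
apply/eqP; rewrite eq_le; apply/andP; split; first exact: hf.
have mA' : measurable ((fun X => h *m X) @^-1` A).
  by rewrite -[X in measurable X]setTI; exact: mf.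
have := hg _ mA'; rewrite (_ : (fun X => invmx h *m X) @^-1` _ = A)//.
by apply/seteqP; split => X /=; rewrite mulKVmx.
Qed.

Lemma measurable_in_box lo hi : measurable [set X : 'M[R]_n | in_box lo hi X].
Proof.
change (measurable (mdec @^-1` [set X : 'M[R]_n | in_box lo hi X])).
rewrite (_ : _ @^-1` _ = tbox (tnth (menc lo)) (tnth (menc hi))).
  exact: measurable_tbox.
apply/seteqP; split => t /= H.
  by move=> k; have := H (enum_val k).1 (enum_val k).2;
    rewrite !mxE -surjective_pairing enum_valK !tnth_mktuple.
by move=> i j; have := H (enum_rank (i, j)); rewrite !tnth_mktuple enum_rankK mxE.
Qed.

Lemma mxleb_box (lo hi : 'M[R]_n) : (forall i j, lo i j <= hi i j)%R ->
  mxleb [set X : 'M[R]_n | in_box lo hi X] = (box_vol lo hi)%:E.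
Proof.
move=> lh; rewrite /mxleb (_ : _ @^-1` _ = tbox (tnth (menc lo)) (tnth (menc hi))).
  rewrite lebn_box => [|i]; last by rewrite !tnth_mktuple.
  congr EFin; rewrite /box_vol; rewrite (reindex (@enum_val _ {: 'I_n * 'I_n})) /=.
    by apply: eq_bigr => k _; rewrite !tnth_mktuple.
  exact: onW_bij (enum_val_bij _).
apply/seteqP; split => t /= H.
  by move=> k; have := H (enum_val k).1 (enum_val k).2;
    rewrite !mxE -surjective_pairing enum_valK !tnth_mktuple.
by move=> i j; have := H (enum_rank (i, j)); rewrite !tnth_mktuple enum_rankK mxE.
Qed.

End MatrixMeasurable.

(** * A measurable fundamental domain *)

Section MatrixSequences.
Variables (R : realType) (n : nat).
Implicit Types u v : nat -> 'M[R]_n.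

Definition mcvg u (l : 'M[R]_n) := forall i j, u k i j @[k --> \oo] --> l i j.

Lemma cvg_bigsum (I : Type) (s : seq I) (P : pred I) (f : I -> nat -> R) (l : I -> R) :
  (forall i, f i k @[k --> \oo] --> l i) ->
  (\sum_(i <- s | P i) f i k) @[k --> \oo] --> \sum_(i <- s | P i) l i.
Proof.
move=> fl; elim: s => [|i s IH].
  by under eq_fun do rewrite big_nil; rewrite big_nil; exact: cvg_cst.
under eq_fun do rewrite big_cons; rewrite big_cons.
by case: (P i) => //; exact: cvgD.
Qed.

Lemma cvg_bigprod (I : Type) (s : seq I) (P : pred I) (f : I -> nat -> R) (l : I -> R) :
  (forall i, f i k @[k --> \oo] --> l i) ->
  (\prod_(i <- s | P i) f i k) @[k --> \oo] --> \prod_(i <- s | P i) l i.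
Proof.
move=> fl; elim: s => [|i s IH].
  by under eq_fun do rewrite big_nil; rewrite big_nil; exact: cvg_cst.
under eq_fun do rewrite big_cons; rewrite big_cons.
by case: (P i) => //; exact: cvgM.
Qed.

Lemma mcvg_mul u v a b : mcvg u a -> mcvg v b -> mcvg (fun k => u k *m v k) (a *m b).
Proof.
move=> ua vb i j; under eq_fun do rewrite mxE; rewrite mxE.
by apply: cvg_bigsum => l; exact: cvgM.
Qed.

Lemma mcvg_cst a : mcvg (fun _ => a) a.
Proof. by move=> i j; exact: cvg_cst. Qed.

Lemma cvg_det u a : mcvg u a -> \det (u k) @[k --> \oo] --> \det a.
Proof.
move=> ua; apply: cvg_bigsum => s; apply: cvgM; first exact: cvg_cst.
by apply: cvg_bigprod => i; exact: ua.
Qed.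
End MatrixSequences.

Lemma mcvg_adj (R : realType) n (u : nat -> 'M[R]_n) a :
  mcvg u a -> mcvg (fun k => \adj (u k)) (\adj a).
Proof.
move=> ua i j; under eq_fun do rewrite mxE; rewrite mxE /cofactor.
apply: cvgM; first exact: cvg_cst.
apply: cvg_det => k l; under eq_fun do rewrite !mxE; rewrite !mxE; exact: ua.
Qed.

(** Serves to deduce that positive numbers tend to 1 when their n-th powers do. *)
Lemma dist_exprn_ge (R : realType) n (x : R) : 0 <= x -> (0 < n)%N ->
  `|x - 1| <= `|x ^+ n - 1|.
Proof.
move=> x0; case: n => // n _; rewrite subrX1 normrM ler_peMr//.
rewrite big_ord_recl expr0 ger0_norm ?lerDl ?addr_ge0//;
  by rewrite sumr_ge0// => i _; rewrite exprn_ge0.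
Qed.

Section Lattice.
Variables (R : realType) (n : nat) (Gam : 'M[R]_n -> Prop).
Hypothesis n0 : (0 < n)%N.
Hypothesis Gsub : is_subgroup_SL Gam.
Hypothesis Gdisc : discrete_set Gam.

Let GSL g : Gam g -> \det g = 1. Proof. by case: Gsub => h _ _ _ /h. Qed.
Let G1 : Gam 1%:M. Proof. by case: Gsub. Qed.
Let GM g h : Gam g -> Gam h -> Gam (g *m h). Proof. by case: Gsub => _ _ h1 _; exact: h1. Qed.
Let GV g : Gam g -> Gam (invmx g). Proof. by case: Gsub => _ _ _; exact. Qed.

Lemma Gam_unit g : Gam g -> g \in unitmx.
Proof. by move=> /GSL dg; rewrite unitmxE dg unitr1. Qed.

Lemma mxmax_lt (A : 'M[R]_n) r : 0 < r -> (forall i j, `|A i j| < r) -> mxmax A < r.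
Proof. by move=> r0 h; rewrite /mxmax; apply: bigmax_lt. Qed.

Definition code : Type := ('M[rat]_n * nat)%type.

Definition close (X : 'M[R]_n) (c : code) :=
  forall i j, `|X i j - ratr (c.1 i j)| < c.2.+1%:R^-1.

(** The factor 2 appears because two matrices close to the same code differ by less than twice its
    radius. *)
Lemma closeP X (r : R) : 0 < r -> exists c : code, close X c /\ 2 * c.2.+1%:R^-1 < r.
Proof.
move=> r0; pose k := Num.bound (2 / r).
have hk : 2 * k.+1%:R^-1 < r.
  rewrite ltr_pdivrMr// -ltr_pdivrMl// mulrC.
  have /archi_boundP h : 0 <= 2 / r by rewrite divr_ge0// ltW.
  by rewrite (lt_trans h)// ltr_nat.
have q_ i j : exists q : rat, `|X i j - ratr q| < k.+1%:R^-1.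
  have [q] := @rat_in_itvoo R (X i j - k.+1%:R^-1) (X i j + k.+1%:R^-1)
    ltac:(by rewrite ltrD2l gtrN// invr_gt0).
  rewrite in_itv/= => /andP[h1 h2]; exists q; rewrite ltr_norml.
  by move: (k.+1%:R^-1) h1 h2 => e h1 h2; apply/andP; split; lra.
exists (\matrix_(i, j) xget 0 [set q : rat | `|X i j - ratr q| < k.+1%:R^-1], k).
split => // i j; rewrite mxE; exact: (xgetPex 0 (q_ i j)).
Qed.

(* An element of a discrete group is determined by a good enough rational approximation. *)
Definition gam (k : nat) : 'M[R]_n :=
  if unpickle k is Some c then xget 1%:M [set g | Gam g /\ close g c] else 1%:M.

Lemma gamG k : Gam (gam k).
Proof.
rewrite /gam; case: unpickle => [c|]//.
by case: xgetP => [g -> []//|_].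
Qed.

Lemma gamP g : Gam g -> exists k, gam k = g.
Proof.
move=> Gg; have [r r0 hr] := Gdisc Gg.
have [c [gc cr]] := closeP g r0; exists (pickle c); rewrite /gam pickleK.
have [Gh hc] := @xgetPex _ 1%:M [set g | Gam g /\ close g c] (ex_intro _ g (conj Gg gc)).
apply: hr => //; apply: mxmax_lt => // i j; rewrite !mxE.
have := gc i j; have := hc i j; rewrite !ltr_norml => /andP[h1 h2] /andP[h3 h4].
move: (c.2.+1%:R^-1) cr h1 h2 h3 h4 => e cr h1 h2 h3 h4.
by apply/andP; split; lra.
Qed.

Definition idx g : nat := xget 0%N [set k | gam k = g].

Lemma idxK g : Gam g -> gam (idx g) = g.
Proof. by move=> /gamP; exact: xgetPex. Qed.

Definition rcone (c : code) (y : 'M[R]_n) := exists2 t : R, 0 < t & close (t *: y) c.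

Lemma rconeZ c y (u : R) : 0 < u -> rcone c y -> rcone c (u *: y).
Proof.
move=> u0 [t t0 ht]; exists (t / u); first exact: divr_gt0.
by rewrite scalerA mulfVK// gt_eqF.
Qed.

(* The open cones disjoint from all their nontrivial translates; they cover {det > 0}. *)
Definition goodc (c : code) := forall g y, Gam g -> 0 < \det y ->
  rcone c y -> rcone c (g *m y) -> g = 1%:M.

(** Otherwise ever smaller cones around [y] meet nontrivial translates of themselves: g_k y1_k =
    rho_k y2_k with g_k different from 1 and y1_k, y2_k tending to [y]. Since det g_k = 1, comparing
    determinants forces rho_k -> 1, so g_k -> 1, against discreteness of Gam at 1. *)
Lemma goodc_cover y : 0 < \det y -> exists c, goodc c /\ rcone c y.
Proof.
move=> dy; apply: contrapT => H.
have [r r0 hr] := Gdisc G1.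
have bad k : exists p : 'M[R]_n * 'M[R]_n * 'M[R]_n * R,
   [/\ Gam p.1.1.1, p.1.1.1 != 1%:M, 0 < p.2,
       p.1.1.1 *m p.1.1.2 = p.2 *: p.1.2 &
       (forall i j, `|p.1.1.2 i j - y i j| < k.+1%:R^-1) /\
       (forall i j, `|p.1.2 i j - y i j| < k.+1%:R^-1)].
  have k0 : 0 < k.+1%:R^-1 :> R by rewrite invr_gt0.
  have [c [yc ck]] := closeP y k0.
  have : ~ goodc c.
    by move=> gc; apply: H; exists c; split => //; exists 1 => //; rewrite scale1r.
  move=> /existsNP[g /existsNP[z /not_implyP[Gg /not_implyP[dz]]]].
  move=> /not_implyP[[t t0 ht] /not_implyP[[t' t0' ht'] g1]].
  exists (g, t *: z, t' *: (g *m z), t / t') => /=; split => //.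
  - exact/eqP.
  - exact: divr_gt0.
  - by rewrite scalerA mulfVK ?gt_eqF// scalemxAr.
  - split => i j.
      have := ht i j; have := yc i j; rewrite !ltr_norml => /andP[h1 h2] /andP[h3 h4].
      move: (c.2.+1%:R^-1) (k.+1%:R^-1) ck h1 h2 h3 h4 => e e' ck h1 h2 h3 h4.
      by apply/andP; split; lra.
    have := ht' i j; have := yc i j; rewrite !ltr_norml => /andP[h1 h2] /andP[h3 h4].
    move: (c.2.+1%:R^-1) (k.+1%:R^-1) ck h1 h2 h3 h4 => e e' ck h1 h2 h3 h4.
    by apply/andP; split; lra.
have [p hp] := choice bad.
pose g k := (p k).1.1.1; pose y1 k := (p k).1.1.2; pose y2 k := (p k).1.2; pose rho k := (p k).2.
have inv0 : (k.+1%:R^-1 : R) @[k --> \oo] --> 0 by exact: cvg_harmonic.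
have cv (z : nat -> 'M[R]_n) : (forall k i j, `|z k i j - y i j| < k.+1%:R^-1) -> mcvg z y.
  move=> hz i j; apply/cvgrPdistC_lt => e e0.
  have /cvgr0Pnorm_lt /(_ e e0) := inv0; apply: filterS => k.
  by rewrite ger0_norm//; apply: lt_trans; exact: hz.
have y1y : mcvg y1 y by apply: cv => k; have [_ _ _ _ []] := hp k.
have y2y : mcvg y2 y by apply: cv => k; have [_ _ _ _ []] := hp k.
have gE k : g k *m y1 k = rho k *: y2 k by have [] := hp k.
have rho0 k : 0 < rho k by have [] := hp k.
have Gg k : Gam (g k) by have [] := hp k.
have d1 := cvg_det y1y; have d2 := cvg_det y2y.
have dE k : \det (y1 k) = rho k ^+ n * \det (y2 k).
  by rewrite -detZ -gE det_mulmx (GSL (Gg k)) mul1r.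
have rcv : rho k @[k --> \oo] --> (1 : R).
  have h : (\det (y1 k) / \det (y2 k)) @[k --> \oo] --> (1 : R).
    rewrite -(@divff _ (\det y)) ?gt_eqF//; apply: cvgM => //.
    by apply: cvgV => //; rewrite gt_eqF.
  apply/cvgrPdistC_lt => e e0.
  have /cvgrPdistC_lt /(_ e e0) := h.
  have : \forall k \near \oo, 0 < \det (y2 k) by exact: (cvgr_gt _ d2).
  apply: filterS2 => k k0; apply: le_lt_trans.
  by rewrite dE mulfK ?gt_eqF// dist_exprn_ge// ltW.
have gcv : mcvg g 1%:M.
  (* The inverse of y1_k is written through the adjugate, which is continuous in the entries. *)
  have E : \forall k \near \oo, g k = (rho k / \det (y1 k)) *: (y2 k *m \adj (y1 k)).
    have : \forall k \near \oo, 0 < \det (y1 k) by exact: (cvgr_gt _ d1).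
    apply: filterS => k k0; rewrite mulrC -scalerA scalemxAl -gE -mulmxA mul_mx_adj.
    by rewrite mul_mx_scalar scalerA mulVf ?gt_eqF// scale1r.
  move=> i j.
  have : ((rho k / \det (y1 k)) * (y2 k *m \adj (y1 k)) i j) @[k --> \oo] --> (1%:M i j : R).
    have -> : 1%:M i j = (1 / \det y) * (y *m \adj y) i j.
      by rewrite mul_mx_adj !mxE; case: (i == j); rewrite ?mulr0//= mulrAC mul1r divff// gt_eqF.
    apply: cvgM; last exact: (mcvg_mul y2y (mcvg_adj y1y)).
    by apply: cvgM => //; apply: cvgV => //; rewrite gt_eqF.
  apply: cvg_trans; apply: near_eq_cvg.
  by apply: filterS E => k ->; rewrite [in RHS]mxE.
have : \forall k \near \oo, forall ij : 'I_n * 'I_n, `|g k ij.1 ij.2 - 1%:M ij.1 ij.2| < r.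
  apply: filter_forall => -[i j] /=.
  by have /cvgrPdistC_lt /(_ r r0) := gcv i j.
move=> [k _ /(_ k (leqnn k)) hk].
have [_ /eqP gk _ _ _] := hp k; apply: gk; apply: hr; first exact: (Gg k).
by apply: mxmax_lt => // i j; rewrite !mxE; have := hk (i, j); rewrite /= !mxE.
Qed.

End Lattice.

Lemma measure_bigcupT d (T : measurableType d) (R : realType)
    (mu : {measure set T -> \bar R}) (F : nat -> set T) :
  (forall i, measurable (F i)) -> trivIset setT F ->
  mu (\bigcup_n F n) = (\sum_(i <oo) mu (F i))%E.
Proof.
move=> mF tF; rewrite measure_bigcup//; apply: eq_eseriesl => k.
by rewrite in_setT.
Qed.

Section Domain.
Variables (R : realType) (n : nat) (Gam : 'M[R]_n -> Prop).
Hypothesis n0 : (0 < n)%N.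
Hypothesis Gsub : is_subgroup_SL Gam.
Hypothesis Gdisc : discrete_set Gam.

Let GSL g : Gam g -> \det g = 1. Proof. by case: Gsub => h _ _ _ /h. Qed.
Let G1 : Gam 1%:M. Proof. by case: Gsub. Qed.
Let GM g h : Gam g -> Gam h -> Gam (g *m h). Proof. by case: Gsub => _ _ h1 _; exact: h1. Qed.
Let GV g : Gam g -> Gam (invmx g). Proof. by case: Gsub => _ _ _; exact. Qed.
Let GU := Gam_unit Gsub.

Definition gcone (k : nat) (y : 'M[R]_n) :=
  if @unpickle (code n) k is Some c then goodc Gam c /\ rcone c y else False.
Definition sat k (y : 'M[R]_n) := exists2 g, Gam g & gcone k (invmx g *m y).
Definition cell k g (y : 'M[R]_n) :=
  [/\ 0 < \det y, Gam g, gcone k (invmx g *m y) & forall j, (j < k)%N -> ~ sat j y].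

(* [sfun] is a measurable map from {det > 0} to Gam, equivariant under Gam and invariant
   under scaling: the first good cone (in the enumeration of codes) meeting the orbit of [y]
   meets it in [sfun y]^-1 y. Its value is 1 outside {det > 0}. *)
Definition sfun y := xget 1%:M [set g | exists k, cell k g y].
Definition kfun y := xget 0%N [set k | exists g, cell k g y].

Lemma det_Gam g y : Gam g -> \det (g *m y) = \det y.
Proof. by move=> Gg; rewrite det_mulmx (GSL Gg) mul1r. Qed.

Lemma sat_Gam k h y : Gam h -> sat k y -> sat k (h *m y).
Proof.
move=> Gh [g Gg hg]; exists (h *m g); first exact: GM.
have [uh ug] := (GU Gh, GU Gg).
have -> // : invmx (h *m g) *m (h *m y) = invmx g *m y.
apply: (can_inj (mulKmx (GU (GM Gh Gg)))).
by rewrite mulKVmx ?GU//; [rewrite -mulmxA mulKVmx|exact: GM].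
Qed.

Lemma cell_ex y : 0 < \det y -> exists k g, cell k g y.
Proof.
move=> dy; have [c [gc rc]] := goodc_cover n0 Gsub Gdisc dy.
have H : exists k, `[< sat k y >].
  exists (pickle c); apply/asboolP; exists 1%:M => //.
  by rewrite invmx1 mul1mx /gcone pickleK.
case: (ex_minnP H) => k /asboolP[g Gg hg] kmin; exists k, g; split => // j jk /asboolP /kmin.
by rewrite leqNgt jk.
Qed.

Lemma gcone_inj k g h y : Gam g -> Gam h -> 0 < \det y ->
  gcone k (invmx g *m y) -> gcone k (invmx h *m y) -> g = h.
Proof.
rewrite /gcone; case: unpickle => [c|//] Gg Gh dy [gc hg] [_ hh].
have [ug uh] := (GU Gg, GU Gh).
have := gc (invmx h *m g) (invmx g *m y).
rewrite -mulmxA mulKVmx// det_Gam; last exact: GV.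
move=> /(_ (GM (GV Gh) Gg) dy hg hh) /(congr1 (mulmx h)).
by rewrite mulKVmx// mulmx1.
Qed.

Lemma cell_uniq k g k' g' y : cell k g y -> cell k' g' y -> k = k' /\ g = g'.
Proof.
move=> [dy Gg hg kmin] [_ Gg' hg' kmin'].
have kk : k = k'.
  apply/eqP; rewrite eqn_leq; apply/andP; split; rewrite leqNgt; apply/negP.
    by move=> /kmin; apply; exists g'.
  by move=> /kmin'; apply; exists g.
by split => //; rewrite -kk in hg'; exact: (@gcone_inj k g g' y).
Qed.

Lemma sfun_eq k g y : cell k g y -> sfun y = g.
Proof.
move=> c; have [k' c'] := @xgetPex _ 1%:M [set g | exists k, cell k g y]
  (ex_intro _ g (ex_intro _ k c)).
by have [] := cell_uniq c' c.
Qed.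

Lemma kfun_eq k g y : cell k g y -> kfun y = k.
Proof.
move=> c; have [g' c'] := @xgetPex _ 0%N [set k | exists g, cell k g y]
  (ex_intro _ k (ex_intro _ g c)).
by have [] := cell_uniq c' c.
Qed.

Lemma cellP y : 0 < \det y -> cell (kfun y) (sfun y) y.
Proof. by move=> /cell_ex[k [g c]]; rewrite (sfun_eq c) (kfun_eq c). Qed.

Lemma sfunG y : Gam (sfun y).
Proof. by rewrite /sfun; case: xgetP => [g _ [k []]|]. Qed.

Lemma cellM k g y h : Gam h -> cell k g y -> cell k (h *m g) (h *m y).
Proof.
move=> Gh [dy Gg hg kmin]; split.
- by rewrite det_Gam.
- exact: GM.
- have -> // : invmx (h *m g) *m (h *m y) = invmx g *m y.
  apply: (can_inj (mulKmx (GU (GM Gh Gg)))).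
  by rewrite mulKVmx ?GU//; [rewrite -mulmxA mulKVmx ?GU|exact: GM].
- move=> j jk /(sat_Gam (GV Gh)); rewrite mulKmx ?GU//; exact: kmin.
Qed.

Lemma sfunM h y : Gam h -> 0 < \det y -> sfun (h *m y) = h *m sfun y.
Proof. by move=> Gh dy; apply: sfun_eq (cellM Gh (cellP dy)). Qed.

Lemma gconeZ k y u : 0 < u -> gcone k y -> gcone k (u *: y).
Proof.
by rewrite /gcone; case: unpickle => // c u0 [? ?]; split => //; exact: rconeZ.
Qed.

Lemma satZ k y u : 0 < u -> sat k y -> sat k (u *: y).
Proof. by move=> u0 [g Gg hg]; exists g => //; rewrite -scalemxAr; exact: gconeZ. Qed.

Lemma cellZ k g y u : 0 < u -> cell k g y -> cell k g (u *: y).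
Proof.
move=> u0 [dy Gg hg kmin]; split => //.
- by rewrite detZ mulr_gt0// exprn_gt0.
- by rewrite -scalemxAr; exact: gconeZ.
- move=> j jk /(@satZ _ _ u^-1); rewrite invr_gt0 scalerA mulVf ?gt_eqF// scale1r.
  by move=> /(_ u0); exact: kmin.
Qed.

Lemma sfunZ u y : 0 < u -> 0 < \det y -> sfun (u *: y) = sfun y.
Proof. by move=> u0 dy; apply: sfun_eq (cellZ u0 (cellP dy)). Qed.

Lemma measurable_close (c : code n) : measurable [set y : 'M[R]_n | close y c].
Proof.
rewrite (_ : [set y | _] = \bigcap_(ij in [set: 'I_n * 'I_n])
   [set y : 'M[R]_n | `|y ij.1 ij.2 - ratr (c.1 ij.1 ij.2)| < c.2.+1%:R^-1]).
  apply: fin_bigcap_measurable; first exact: (@finite_finset _ [set: _]).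
  move=> -[i j] _ /=.
  have mf : measurable_fun setT (fun y : 'M[R]_n => `|y i j - ratr (c.1 i j)|).
    apply: (@measurableT_comp _ _ _ _ _ _ (@Num.norm R R) setT
      (fun y : 'M[R]_n => y i j - ratr (c.1 i j))) => //.
    by apply: measurable_funB => //; exact: measurable_entry.
  rewrite (_ : [set y | _] = (fun y : 'M[R]_n => `|y i j - ratr (c.1 i j)|) @^-1`
     `]-oo, c.2.+1%:R^-1[%classic); last by apply/seteqP; split => y /=; rewrite in_itv.
  by rewrite -[X in measurable X]setTI; exact: mf.
by apply/seteqP; split => y /= H; [move=> -[i j] _; exact: H|move=> i j; exact: (H (i, j))].
Qed.

(** [close] is an open condition, so the scale can be moved to a nearby rational; the cone becomes a
    countable union of measurable sets. *)
Lemma rcone_rat (c : code n) (y : 'M[R]_n) :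
  rcone c y <-> exists2 t : rat, 0 < t & close (ratr t *: y) c.
Proof.
split=> [[t t0 ht]|[t t0 ht]]; last by exists (ratr t) => //; rewrite ltr0q.
have : \forall u \near t, forall ij : 'I_n * 'I_n,
    `|u * y ij.1 ij.2 - ratr (c.1 ij.1 ij.2)| < c.2.+1%:R^-1.
  apply: (@filter_forall R _ (fun (ij : 'I_n * 'I_n) u => `|u * y ij.1 ij.2 - ratr (c.1 ij.1 ij.2)| < c.2.+1%:R^-1) (nbhs t)) => -[i j] /=.
  have h : `|u * y i j - ratr (c.1 i j)| @[u --> t] --> `|t * y i j - ratr (c.1 i j)|.
    by apply: cvg_norm; apply: cvgB; [apply: cvgM; [exact: cvg_id|exact: cvg_cst]|exact: cvg_cst].
  apply: (cvgr_lt _ h); have := ht i j; by rewrite mxE.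
move=> /nbhs_ballP[e /= e0 he].
have [q] := @rat_in_itvoo R t (t + e) ltac:(by rewrite ltrDl).
rewrite in_itv/= => /andP[h1 h2]; exists q.
  by rewrite -(@ltr0q R) (lt_trans t0).
move=> i j; rewrite mxE; apply: (he _ _ (i, j)).
by rewrite /ball/= ltr0_norm ?subr_lt0// opprB ltrBlDl.
Qed.

Lemma measurable_scale_preimage (a : R) A : measurable A ->
  measurable [set y : 'M[R]_n | A (a *: y)].
Proof.
move=> mA; have mf : measurable_fun setT (fun y : 'M[R]_n => a *: y).
  by apply: measurable_scalemx => //; exact: measurable_id.
by rewrite -[X in measurable X]setTI; exact: mf.
Qed.

Lemma measurable_mul_preimage (a b : 'M[R]_n) A : measurable A ->
  measurable [set y : 'M[R]_n | A (a *m y *m b)].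
Proof.
move=> mA; have mf : measurable_fun setT (fun y : 'M[R]_n => a *m y *m b).
  apply: measurable_mulmx => //; apply: measurable_mulmx => //; exact: measurable_id.
by rewrite -[X in measurable X]setTI; exact: mf.
Qed.

Lemma measurable_mull_preimage (a : 'M[R]_n) A : measurable A ->
  measurable [set y : 'M[R]_n | A (a *m y)].
Proof.
by move=> /(measurable_mul_preimage a 1%:M); under eq_set do rewrite mulmx1.
Qed.

Lemma measurable_mulr_preimage (a : 'M[R]_n) A : measurable A ->
  measurable [set y : 'M[R]_n | A (y *m a)].
Proof.
by move=> /(measurable_mul_preimage 1%:M a); under eq_set do rewrite mul1mx.
Qed.

Lemma measurable_rcone (c : code n) : measurable [set y : 'M[R]_n | rcone c y].
Proof.
rewrite (_ : [set y | _] = \bigcup_k (if @unpickle rat k is Some t then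
   (if 0 < t then [set y : 'M[R]_n | close (ratr t *: y) c] else set0) else set0)).
  apply: bigcupT_measurable => k; case: unpickle => [t|//]; case: ifP => // _.
  exact: (measurable_scale_preimage (ratr t) (measurable_close c)).
apply/seteqP; split => y.
  move=> /rcone_rat[t t0 ht]; exists (pickle t); first exact: I.
  by rewrite pickleK t0.
move=> [k _]; case: unpickle => [t|//]; case: ifP => // t0 /= ht.
by apply/rcone_rat; exists t.
Qed.

Lemma measurable_prop (P : Prop) (A : set 'M[R]_n) : measurable A ->
  measurable [set y | P /\ A y].
Proof.
move=> mA; have [p|p] := pselect P.
  by rewrite (_ : [set y | _] = A)//; apply/seteqP; split => y //= [].
by rewrite (_ : [set y | _] = set0)//; apply/seteqP; split => y //= [].
Qed.

Lemma measurable_gcone k : measurable [set y : 'M[R]_n | gcone k y].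
Proof.
rewrite /gcone; case: unpickle => [c|]; last first.
  by rewrite (_ : [set y | _] = set0).
by apply: measurable_prop; exact: measurable_rcone.
Qed.

Lemma satE k y : sat k y <-> exists j, gcone k (invmx (gam Gam j) *m y).
Proof.
split=> [[g Gg hg]|[j hj]]; last by exists (gam Gam j) => //; exact: gamG.
by exists (idx Gam g); rewrite (idxK Gdisc Gg).
Qed.

Lemma measurable_sat k : measurable [set y | sat k y].
Proof.
rewrite (_ : [set y | _] = \bigcup_j [set y | gcone k (invmx (gam Gam j) *m y)]).
  apply: bigcupT_measurable => j.
  exact: (measurable_mull_preimage _ (measurable_gcone k)).
by apply/seteqP; split => y /=; [move=> /satE[j h]; exists j|move=> [j _ h]; apply/satE; exists j].
Qed.

Definition Omega : set 'M[R]_n := [set y | 0 < \det y].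

Lemma measurable_Omega : measurable Omega.
Proof.
rewrite (_ : Omega = (fun y : 'M[R]_n => \det y) @^-1` `]0, +oo[%classic).
  by rewrite -[X in measurable X]setTI; exact: measurable_det.
by apply/seteqP; split => y /=; rewrite in_itv/= andbT.
Qed.

Lemma measurable_cell k g : measurable [set y | cell k g y].
Proof.
rewrite (_ : [set y | _] = [set y | Gam g /\ (Omega `&` [set y | gcone k (invmx g *m y)] `&`
   \bigcap_(j in `I_k) ~` [set y | sat j y]) y]).
  apply: measurable_prop; apply: measurableI; first apply: measurableI.
  - exact: measurable_Omega.
  - exact: (measurable_mull_preimage _ (measurable_gcone k)).
  - by apply: bigcap_measurableType => j _; apply: measurableC; exact: measurable_sat.
apply/seteqP; split => y /=.
  by move=> [dy Gg hg kmin]; do !split.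
by move=> [Gg [[dy hg] h]]; split.
Qed.

Lemma measurable_sfun g : measurable [set y | 0 < \det y /\ sfun y = g].
Proof.
rewrite (_ : [set y | _] = \bigcup_k [set y | cell k g y]).
  by apply: bigcupT_measurable => k; exact: measurable_cell.
apply/seteqP; split => y /=.
  by move=> [dy <-]; exists (kfun y) => //; exact: cellP.
by move=> [k _ c]; split; [case: c|exact: sfun_eq c].
Qed.

(* The cone over a fundamental domain of Gam in SL_n, so that its Lebesgue measure is the covolume. *)
Definition D1 : set 'M[R]_n := [set y | [/\ 0 < \det y, \det y <= 1 & sfun y = 1%:M]].

Lemma measurable_det_le1 : measurable [set y : 'M[R]_n | \det y <= 1].
Proof.
rewrite (_ : [set y | _] = (fun y : 'M[R]_n => \det y) @^-1` `]-oo, 1]%classic).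
  by rewrite -[X in measurable X]setTI; exact: measurable_det.
by apply/seteqP; split => y /=; rewrite in_itv/=.
Qed.

Lemma measurable_D1 : measurable D1.
Proof.
rewrite (_ : D1 = [set y | 0 < \det y /\ sfun y = 1%:M] `&` [set y | \det y <= 1]).
  by apply: measurableI; [exact: measurable_sfun|exact: measurable_det_le1].
by apply/seteqP; split => y /=; [move=> []|move=> [[? ?] ?]].
Qed.

Local Open Scope ereal_scope.
Notation lam := (@mxleb R n).

(** [gam] may enumerate an element several times; this condition keeps one index per element, so
    that sums over indices become sums over Gam. *)
Definition canon k := idx Gam (gam Gam k) = k.

Lemma canonP g : Gam g -> canon (idx Gam g).
Proof. by move=> Gg; rewrite /canon idxK. Qed.

(** [W] is cut according to the value of [sfun], and each piece is translated to where [sfun] is 1;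
    left multiplication by Gam preserves the measure. *)
Lemma lam_unfold W : measurable W -> W `<=` Omega ->
  lam W = \sum_(k <oo) lam [set x | canon k /\
     ((0 < \det x)%R /\ sfun x = 1%:M) /\ W (gam Gam k *m x)].
Proof.
move=> mW WO.
pose V k := [set y | canon k /\ ([set y | (0 < \det y)%R /\ sfun y = gam Gam k] `&` W) y].
have mV k : measurable (V k).
  by apply: measurable_prop; apply: measurableI => //; exact: measurable_sfun.
have -> : W = \bigcup_k V k.
  apply/seteqP; split => y.
    move=> Wy; have Gs := sfunG y; exists (idx Gam (sfun y)) => //.
    by split; [exact: canonP|rewrite idxK//; do !split => //; exact: WO].
  by move=> [k _ [_ []]].
rewrite measure_bigcupT//; last first.
  apply/trivIsetP => i j _ _ ij; apply/seteqP; split => y //= -[[ci [[_ si] _]] [cj [[_ sj] _]]].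
  by move/eqP: ij; apply; rewrite -ci -cj -si -sj.
apply: eq_eseriesr => k _.
have Gk := gamG Gsub k.
transitivity (lam [set x | V k (gam Gam k *m x)]).
  by apply/esym/mxleb_SLl => //; exact: GSL.
congr (lam _); apply/seteqP; split => x /=.
  move=> [ck [[dx sx] Wx]]; split => //; split; last first.
    by exists k => //; split => //; split => //; split.
  rewrite det_Gam// in dx; split => //; move: sx; rewrite sfunM// => /(congr1 (mulmx (invmx (gam Gam k)))).
  by rewrite mulKmx ?GU// mulVmx ?GU.
move=> [ck [[dx sx] [k' _ [ck' [[d' s'] W']]]]]; split => //; split => //; split.
  by rewrite det_Gam.
by rewrite sfunM// sx mulmx1.
Qed.

End Domain.

(** * Finiteness, positivity and invariance of the covolume *)

Section Covolume.
Variables (R : realType) (n : nat) (Gam : 'M[R]_n -> Prop).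
Hypothesis n0 : (0 < n)%N.
Hypothesis Gsub : is_subgroup_SL Gam.
Hypothesis Gdisc : discrete_set Gam.
Hypothesis Gfin : finite_covolume Gam.

Let GSL g : Gam g -> \det g = 1. Proof. by case: Gsub => h _ _ _ /h. Qed.
Let G1 : Gam 1%:M. Proof. by case: Gsub. Qed.
Let GM g h : Gam g -> Gam h -> Gam (g *m h). Proof. by case: Gsub => _ _ h1 _; exact: h1. Qed.
Let GV g : Gam g -> Gam (invmx g). Proof. by case: Gsub => _ _ _; exact. Qed.
Let GU := Gam_unit Gsub.

Notation lam := (@mxleb R n).
Notation D1 := (D1 Gam).
Notation gam := (gam Gam).
Notation idx := (idx Gam).
Notation canon := (canon Gam).
Notation sfun := (sfun Gam).
Let mD1 : measurable D1 := measurable_D1 n0 Gsub Gdisc.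

Lemma SL_normalize (y : 'M[R]_n) : 0 < \det y ->
  exists2 t : R, 0 < t & t ^+ n = \det y /\ \det (t^-1 *: y) = 1.
Proof.
move=> dy; exists (\det y `^ n%:R^-1); first exact: powR_gt0.
have E : (\det y `^ n%:R^-1) ^+ n = \det y.
  rewrite -powR_mulrn ?powR_ge0// -powRrM mulVf ?pnatr_eq0 -?lt0n//.
  by rewrite powRr1// ltW.
by split => //; rewrite detZ exprVn E mulVf// gt_eqF.
Qed.

Local Open Scope ereal_scope.

(** The set [F] given by the hypothesis may fail to be measurable, so the union [U] of the boxes
    covering its cone takes its place. A point y = t g A of [D1] with A in [F] has g^-1 y in that
    cone, hence the pieces in the unfolding of [W] cover [D1]. *)
Lemma lam_D1_lty : lam D1 < +oo.
Proof.
have [F [FSL Fcov [lo [hi [M [lohi Fbox hM]]]]]] := Gfin.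
pose U := \bigcup_k [set X : 'M[R]_n | in_box (lo k) (hi k) X].
have mU : measurable U by apply: bigcupT_measurable => k; exact: measurable_in_box.
have lamU : lam U <= M%:E.
  apply: (@le_trans _ _ (\sum_(k <oo) lam [set X : 'M[R]_n | in_box (lo k) (hi k) X])).
    apply: measure_sigma_subadditive => //.
    by move=> k; exact: measurable_in_box.
  apply: lime_le; first by apply: is_cvg_nneseries.
  apply: nearW => N; under eq_bigr do rewrite mxleb_box//.
  by rewrite sumEFin lee_fin big_mkord; exact: hM.
pose W := U `&` (Omega (n:=n) (R:=R) `&` [set y | (\det y <= 1)%R]).
have mW : measurable W.
  apply: measurableI => //; apply: measurableI; first exact: measurable_Omega.
  exact: measurable_det_le1.
have lamW : lam W < +oo.
  apply: (@le_lt_trans _ _ M%:E); last exact: ltry.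
  by apply: le_trans lamU; apply: le_measure; rewrite ?inE//; exact: subIsetl.
apply: le_lt_trans lamW.
rewrite (lam_unfold n0 Gsub Gdisc mW); last by move=> y [_ []].
pose V k := [set x | canon k /\ ((0 < \det x)%R /\ sfun x = 1%:M) /\ W (gam k *m x)].
have mV k : measurable (V k).
  apply: measurable_prop; apply: (@measurableI _ _ [set x | (0 < \det x)%R /\ sfun x = 1%:M]).
    exact: measurable_sfun.
  exact: (measurable_mull_preimage _ mW).
apply: measure_sigma_subadditive => //.
move=> y [dy dy1 sy].
have [t t0 [tn dty]] := SL_normalize dy.
have [g [A [Gg FA yE]]] := Fcov _ dty.
have yE' : y = (t *: (g *m A))%R by rewrite -yE scalerA mulfV ?gt_eqF// scale1r.
exists (idx (invmx g)) => //; split; first exact: (canonP Gdisc (GV Gg)).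
split => //; rewrite idxK//; last exact: GV.
have t1 : (t <= 1)%R.
  rewrite leNgt; apply/negP => t1; move: dy1; rewrite -tn leNgt => /negP; apply.
  by rewrite expr_gt1// ltW.
split; last by split; rewrite /Omega /= (det_Gam Gsub)//; exact: GV.
have [k hk] : exists k, in_box (lo k) (hi k) (invmx g *m y).
  apply: Fbox; exists t, A; split => //.
  by rewrite yE' -scalemxAr mulKmx ?GU.
by exists k.
Qed.

(** The centre is half the identity because its determinant 2^-n lies strictly between 0 and 1,
    whereas the identity is on the boundary of det <= 1. *)
Lemma Omega1_box : exists r : R, (0 < r)%R /\ forall X : 'M[R]_n,
  (forall i j, `|X i j - (2^-1)%:M i j| < r)%R -> (0 < \det X)%R /\ (\det X <= 1)%R.
Proof.
apply: contrapT => H.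
have bad k : exists X : 'M[R]_n, (forall i j, `|X i j - (2^-1)%:M i j| < k.+1%:R^-1)%R /\
    ~ ((0 < \det X)%R /\ (\det X <= 1)%R).
  apply: contrapT => h; apply: H; exists (k.+1%:R^-1)%R; split; first by rewrite invr_gt0.
  by move=> X hX; apply: contrapT => hX'; apply: h; exists X.
have [X hX] := choice bad.
have inv0 : (k.+1%:R^-1 : R)%R @[k --> \oo] --> (0 : R)%R by exact: cvg_harmonic.
have Xcv : mcvg X (2^-1)%:M%R.
  move=> i j; apply/cvgrPdistC_lt => e e0.
  have /cvgr0Pnorm_lt /(_ e e0) := inv0; apply: filterS => k.
  by rewrite ger0_norm//; apply: lt_trans; exact: (hX k).1.
have dcv := cvg_det Xcv; rewrite det_scalar in dcv.
have h0 : (0 < 2^-1 ^+ n :> R)%R by rewrite exprn_gt0// invr_gt0.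
have h1 : (2^-1 ^+ n < 1 :> R)%R.
  by rewrite expr_lt1 ?invr_ge0// invf_lt1// ltr1n.
have [k _ hk] : \forall k \near \oo, (0 < \det (X k))%R /\ (\det (X k) < 1)%R.
  by apply: filterI; [exact: (cvgr_gt _ dcv)|exact: (cvgr_lt _ dcv)].
have [] := hk k (leqnn k) => hk0 hk1; apply: (hX k).2; split => //; exact: ltW.
Qed.

(** If [D1] were null, unfolding would make {0 < det <= 1} null, yet this set contains a box. *)
Lemma lam_D1_gt0 : 0 < lam D1.
Proof.
rewrite lt0e measure_ge0 andbT; apply/negP => /eqP D0.
pose W := Omega (n:=n) (R:=R) `&` [set y | (\det y <= 1)%R].
have mW : measurable W.
  by apply: measurableI; [exact: measurable_Omega|exact: measurable_det_le1].
have W0 : lam W = 0.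
  rewrite (lam_unfold n0 Gsub Gdisc mW) => [|y []//].
  apply: eseries0 => k _ _; apply/eqP; rewrite eq_le measure_ge0 andbT -D0.
  apply: le_measure; rewrite ?inE//.
    apply: measurable_prop; apply: (@measurableI _ _ [set x | (0 < \det x)%R /\ sfun x = 1%:M]).
      exact: measurable_sfun.
    exact: (measurable_mull_preimage _ mW).
  move=> x [_ [[dx sx] [_ /=]]]; rewrite (det_Gam Gsub)//; last exact: gamG.
have [r [r0 hr]] := Omega1_box.
pose lo : 'M[R]_n := ((2^-1)%:M - const_mx (r / 2))%R.
pose hi : 'M[R]_n := ((2^-1)%:M + const_mx (r / 2))%R.
have lohi i j : (lo i j <= hi i j)%R by rewrite !mxE; lra.
have : lam [set X | in_box lo hi X] <= lam W.
  apply: le_measure; rewrite ?inE//; first exact: measurable_in_box.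
  move=> X hX; suff [? ?] : (0 < \det X)%R /\ (\det X <= 1)%R by split.
  apply: hr => i j; have := hX i j; rewrite !mxE => /andP[h1 h2].
  by rewrite ltr_norml; apply/andP; split; lra.
rewrite W0 mxleb_box// lee_fin leNgt => /negP; apply.
apply: prodr_gt0 => ij _; rewrite !mxE; lra.
Qed.

(** The right translate of [D1] by [h] is another fundamental domain of the same measure. Its part
    in [S] unfolds over Gam into disjoint pieces, which fill the part of [D1] in [S] because [S] is
    invariant. *)
Lemma lam_D1_inv h S : \det h = 1%R -> measurable S ->
  (forall g y, Gam g -> (0 < \det y)%R -> S y -> S (g *m y)) ->
  lam (D1 `&` [set y | S (y *m h)]) = lam (D1 `&` S).
Proof.
move=> dh mS Sinv.
have uh : h \in unitmx by rewrite unitmxE dh unitr1.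
have dhV : \det (invmx h) = 1%R by rewrite det_inv dh invr1.
pose W := [set y | D1 (y *m invmx h)] `&` S.
have mW : measurable W.
  by apply: measurableI => //; exact: (measurable_mulr_preimage _ mD1).
have <- : lam [set y | W (y *m h)] = lam (D1 `&` [set y | S (y *m h)]).
  by congr (lam _); apply/seteqP; split => y /=; rewrite /W /= mulmxK.
rewrite mxleb_SLr// (lam_unfold n0 Gsub Gdisc mW); last first.
  by move=> y [[]]; rewrite det_mulmx dhV mulr1.
pose V k := [set x | canon k /\ ((0 < \det x)%R /\ sfun x = 1%:M) /\ W (gam k *m x)].
have mV k : measurable (V k).
  apply: measurable_prop; apply: (@measurableI _ _ [set x | (0 < \det x)%R /\ sfun x = 1%:M]).
    exact: measurable_sfun.
  exact: (measurable_mull_preimage _ mW).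
have tV : trivIset setT V.
  apply/trivIsetP => i j _ _ ij; apply/seteqP; split => y //=.
  move=> [[ci [[dy _] [[_ _ si] _]]] [cj [_ [[_ _ sj] _]]]].
  move/eqP: ij; apply; rewrite -ci -cj; congr (idx _).
  have dy' : (0 < \det (y *m invmx h))%R by rewrite det_mulmx dhV mulr1.
  have H k : sfun (gam k *m y *m invmx h) = 1%:M -> gam k = invmx (sfun (y *m invmx h)).
    rewrite -mulmxA (sfunM n0 Gsub Gdisc)//; last exact: gamG.
    have := sfunG Gsub (y *m invmx h); set s := sfun _ => Gs E.
    by rewrite -[LHS](mulmxK (GU Gs)) E mul1mx.
  by rewrite (H _ si) (H _ sj).
rewrite -measure_bigcupT//; congr (lam _); apply/seteqP; split => y /=.
  move=> [k _ [ck [[dy sy] [[_ d1 _] Sy]]]].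
  move: d1; rewrite det_mulmx dhV mulr1 (det_Gam Gsub)//; last exact: gamG.
  move=> d1; split => //.
  have := Sinv _ _ (GV (gamG Gsub k)) _ Sy; rewrite (det_Gam Gsub)//; last exact: gamG.
  by rewrite mulKmx ?GU//; [exact|exact: gamG].
move=> [[dy d1 sy] Sy].
have dy' : (0 < \det (y *m invmx h))%R by rewrite det_mulmx dhV mulr1.
have Gs := sfunG Gsub (y *m invmx h).
exists (idx (invmx (sfun (y *m invmx h)))) => //; split; first exact: (canonP Gdisc (GV Gs)).
split => //; rewrite idxK//; last exact: GV.
split; last by apply: Sinv => //; exact: GV.
rewrite /= -mulmxA; split.
- by rewrite (det_Gam Gsub _ (GV Gs)).
- by rewrite (det_Gam Gsub _ (GV Gs)) det_mulmx dhV mulr1.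
- by rewrite (sfunM n0 Gsub Gdisc (GV Gs))// mulVmx// GU.
Qed.

End Covolume.

(** * The mean over the fundamental domain and the return cocycle *)

Definition bm (R : realType) d (T : measurableType d) (f : T -> R) :=
  measurable_fun setT f /\ exists M, forall y, `|f y| <= M.

Section BoundedMeasurable.
Context (R : realType) d (T : measurableType d).
Implicit Types f g : T -> R.

Lemma bm_cst (c : R) : bm (fun _ : T => c).
Proof. by split => //; exists `|c|. Qed.

Lemma bmD f g : bm f -> bm g -> bm (fun y => f y + g y).
Proof.
move=> [mf [M hM]] [mg [N hN]]; split; first exact: measurable_funD.
by exists (M + N) => y; rewrite (le_trans (ler_normD _ _))// lerD.
Qed.

Lemma bmM f g : bm f -> bm g -> bm (fun y => f y * g y).
Proof.
move=> [mf [M hM]] [mg [N hN]]; split; first exact: measurable_funM.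
by exists (M * N) => y; rewrite normrM ler_pM.
Qed.

Lemma bmZ c f : bm f -> bm (fun y => c * f y).
Proof. by move=> hf; apply: bmM => //; exact: bm_cst. Qed.

Lemma bmN f : bm f -> bm (fun y => - f y).
Proof. by move=> /(bmZ (-1)); under eq_fun do rewrite mulN1r. Qed.

Lemma bmB f g : bm f -> bm g -> bm (fun y => f y - g y).
Proof. by move=> hf hg; apply: bmD => //; exact: bmN. Qed.

Lemma bm_max0 f : bm f -> bm (fun y => Num.max 0 (f y)).
Proof.
move=> [mf [M hM]]; split; first exact: measurable_maxr.
exists M => y; rewrite ger0_norm ?le_max ?lexx// ge_max.
by rewrite (le_trans _ (hM y))//= (le_trans _ (hM y))// ler_norm.
Qed.

Lemma bm_sum (I : Type) (s : seq I) (F : I -> T -> R) :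
  (forall i, bm (F i)) -> bm (fun y => \sum_(i <- s) F i y).
Proof.
move=> hF; elim: s => [|i s IH].
  by under eq_fun do rewrite big_nil; exact: bm_cst.
by under eq_fun do rewrite big_cons; exact: bmD.
Qed.

Lemma bm_indic (A : set T) : measurable A -> bm (\1_A : T -> R).
Proof.
move=> mA; split; first exact: measurable_indic.
by exists 1 => y; rewrite indicE; case: (_ \in _); rewrite ?normr1 ?normr0.
Qed.
End BoundedMeasurable.

Section Expectation.
Variables (R : realType) (n : nat) (Gam : 'M[R]_n -> Prop).
Hypothesis n0 : (0 < n)%N.
Hypothesis Gsub : is_subgroup_SL Gam.
Hypothesis Gdisc : discrete_set Gam.
Hypothesis Gfin : finite_covolume Gam.

Notation lam := (@mxleb R n).
Notation D1 := (D1 Gam).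
Let mD1 : measurable D1 := measurable_D1 n0 Gsub Gdisc.

Definition Pm : set 'M[R]_n -> \bar R := mrestr lam mD1.
HB.instance Definition _ := Measure.on Pm.

Lemma PmE S : Pm S = lam (S `&` D1). Proof. by []. Qed.

Let PmT_lty : (Pm setT < +oo)%E.
Proof. by rewrite PmE setTI; exact: lam_D1_lty. Qed.

Definition mass : R := fine (Pm setT).

Lemma PmT : Pm setT = mass%:E.
Proof. by rewrite /mass fineK// ge0_fin_numE. Qed.

Lemma mass_gt0 : 0 < mass.
Proof.
by rewrite -lte_fin -PmT PmE setTI; exact: lam_D1_gt0.
Qed.

Definition Ex (f : 'M[R]_n -> R) : R := mass^-1 * Rintegral Pm setT f.

Lemma bm_integrable f : bm f -> Pm.-integrable setT (EFin \o f).
Proof.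
move=> [mf [M hM]]; apply: measurable_bounded_integrable => //.
exists M; split => [|x Mx y _]; first exact: num_real.
by apply: (le_trans (hM y)); exact: ltW.
Qed.

Lemma Ex_cst c : Ex (fun _ => c) = c.
Proof.
rewrite /Ex Rintegral_cst//= [fine _](_ : _ = mass)//.
by rewrite mulrCA mulVf ?mulr1// gt_eqF// mass_gt0.
Qed.

Lemma ExD f g : bm f -> bm g -> Ex (fun y => f y + g y) = Ex f + Ex g.
Proof.
move=> hf hg; rewrite /Ex -mulrDr -RintegralD//; exact: bm_integrable.
Qed.

Lemma ExZ c f : bm f -> Ex (fun y => c * f y) = c * Ex f.
Proof.
by move=> hf; rewrite /Ex RintegralZl//; [rewrite mulrCA|exact: bm_integrable].
Qed.

Lemma ExB f g : bm f -> bm g -> Ex (fun y => f y - g y) = Ex f - Ex g.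
Proof.
move=> hf hg; rewrite ExD//; last exact: bmN.
by congr (_ + _); under eq_fun do rewrite -mulN1r; rewrite ExZ// mulN1r.
Qed.

Lemma Ex_sum (I : Type) (s : seq I) (F : I -> 'M[R]_n -> R) :
  (forall i, bm (F i)) -> Ex (fun y => \sum_(i <- s) F i y) = \sum_(i <- s) Ex (F i).
Proof.
move=> hF; elim: s => [|i s IH].
  by under eq_fun do rewrite big_nil; rewrite big_nil Ex_cst.
under eq_fun do rewrite big_cons.
by rewrite big_cons ExD ?IH//; exact: bm_sum.
Qed.

Lemma Pm_D1C : Pm (~` D1) = 0%E.
Proof. by rewrite PmE setICl measure0. Qed.

Lemma Ex_eq f g : bm f -> bm g -> (forall y, D1 y -> f y = g y) -> Ex f = Ex g.
Proof.
move=> [mf _] [mg _] fg; rewrite /Ex /Rintegral; congr (_ * fine _).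
apply: ae_eq_integral => //; [exact/measurable_EFinP|exact/measurable_EFinP|].
exists (~` D1); split; [exact: measurableC|exact: Pm_D1C|].
by move=> y /= h Dy; apply: h => _; rewrite fg.
Qed.

Lemma Ex_le f g : bm f -> bm g -> (forall y, D1 y -> f y <= g y) -> Ex f <= Ex g.
Proof.
move=> hf hg fg.
(* The inequality is known on [D1] only; [g] is replaced by a function that dominates [f] everywhere
   and equals [g] on [D1]. *)
have hm : bm (fun y => f y + Num.max 0 (g y - f y)).
  by apply: bmD => //; apply: bm_max0; exact: bmB.
rewrite [leRHS](@Ex_eq g _ hg hm); last first.
  by move=> y Dy; rewrite /Num.max; case: ltP => h; have := fg y Dy; lra.
rewrite /Ex ler_pM2l ?invr_gt0 ?mass_gt0//; apply: le_Rintegral => //.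
- exact: bm_integrable.
- exact: bm_integrable.
- by move=> y _; rewrite lerDl le_max lexx.
Qed.

Lemma Ex_ge0 f : bm f -> (forall y, D1 y -> 0 <= f y) -> 0 <= Ex f.
Proof. by move=> hf f0; rewrite -[leLHS](Ex_cst 0); apply: Ex_le => //; exact: bm_cst. Qed.

Definition Ginv (T : Type) (f : 'M[R]_n -> T) :=
  forall g y, Gam g -> 0 < \det y -> f (g *m y) = f y.

(** After adding a constant the function is nonnegative, and its mean is determined by its
    distribution. Level sets of an invariant function are invariant, so translation by [h] does not
    change the distribution. *)
Lemma Ex_inv h f : \det h = 1 -> bm f -> Ginv f -> Ex (fun y => f (y *m h)) = Ex f.
Proof.
move=> dh [mf [M hM]] fi.
have mR : measurable_fun setT (fun y : 'M[R]_n => y *m h).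
  by apply: measurable_mulmx => //; exact: measurable_id.
have bf : bm f by split => //; exists M.
have bfh : bm (fun y => f (y *m h)).
  by split; [exact: (measurableT_comp mf mR)|exists M].
suff H (u : 'M[R]_n -> R) : bm u -> Ginv u -> (forall y, 0 <= u y) ->
    Ex (fun y => u (y *m h)) = Ex u.
  have := H (fun y => f y + M).
  rewrite !ExD ?Ex_cst//; try exact: bm_cst.
  move=> /(_ (bmD bf (bm_cst _ _)))  /(_ _ _)/addIr; apply.
    by move=> g y Gg dy; rewrite fi.
  by move=> y; have := hM y; rewrite ler_norml => /andP[]; lra.
move=> [mu _] ui u0; rewrite /Ex /Rintegral; congr (_ * fine _).
pose uh (y : 'M[R]_n) := u (y *m h); have muh : measurable_fun setT uh by exact: (measurableT_comp mu mR).
have E (v : 'M[R]_n -> R) : measurable_fun setT v -> (forall y, 0 <= v y) ->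
   (\int[Pm]_y (v y)%:E = \int[pushforward Pm v]_x (Num.max 0 x)%:E)%E.
  move=> mv v0; rewrite ge0_integral_pushforward//.
  - by apply: eq_integral => y _ /=; rewrite max_r.
  - by apply/measurable_EFinP; exact: measurable_maxr.
  - by move=> x _; rewrite lee_fin le_max lexx.
rewrite (E u)// (E uh)//; last by move=> y; exact: u0.
apply: eq_measure_integral => A mA _; change (lam (uh @^-1` A `&` D1) = lam (u @^-1` A `&` D1)).
have mS : measurable (u @^-1` A) by rewrite -[X in measurable X]setTI; exact: mu.
rewrite ![_ `&` D1]setIC; apply: lam_D1_inv => //.
by move=> g y Gg dy /=; rewrite ui.
Qed.

End Expectation.

Section Cocycle.
Variables (R : realType) (n : nat) (Gam : 'M[R]_n -> Prop).
Hypothesis n0 : (0 < n)%N.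
Hypothesis Gsub : is_subgroup_SL Gam.
Hypothesis Gdisc : discrete_set Gam.
Hypothesis Gfin : finite_covolume Gam.

Let GSL g : Gam g -> \det g = 1. Proof. by case: Gsub => h _ _ _ /h. Qed.
Let G1 : Gam 1%:M. Proof. by case: Gsub. Qed.
Let GM g h : Gam g -> Gam h -> Gam (g *m h). Proof. by case: Gsub => _ _ h1 _; exact: h1. Qed.
Let GV g : Gam g -> Gam (invmx g). Proof. by case: Gsub => _ _ _; exact. Qed.
Let GU := Gam_unit Gsub.

Notation D1 := (D1 Gam).
Notation gam := (gam Gam).
Notation idx := (idx Gam).
Notation sfun := (sfun Gam).
Notation Pm := (Pm n0 Gsub Gdisc).
Notation mass := (mass n0 Gsub Gdisc).
Notation Ex := (Ex n0 Gsub Gdisc).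
Let sG := sfunG Gsub.
Let mD1 : measurable D1 := measurable_D1 n0 Gsub Gdisc.

Definition pr (S : set 'M[R]_n) : R := Ex \1_S.

Lemma prE S : measurable S -> pr S = mass^-1 * fine (Pm S).
Proof. by move=> mS; rewrite /pr /Ex /Rintegral integral_indic// setIT. Qed.

Lemma pr_le (A B : set 'M[R]_n) : measurable A -> measurable B ->
  A `&` D1 `<=` B -> pr A <= pr B.
Proof.
move=> mA mB AB; apply: (Ex_le n0 Gsub Gdisc Gfin); try exact: bm_indic.
move=> y Dy; rewrite !indicE; case: (boolP (y \in A)) => // /set_mem Ay.
by rewrite mem_set//; exact: AB.
Qed.

Lemma prU (A B : set 'M[R]_n) : measurable A -> measurable B ->
  pr (A `|` B) <= pr A + pr B.
Proof.
move=> mA mB; rewrite /pr -(ExD n0 Gsub Gdisc Gfin); try exact: bm_indic.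
apply: (Ex_le n0 Gsub Gdisc Gfin); first by apply: bm_indic; exact: measurableU.
  by apply: bmD; exact: bm_indic.
move=> y _; rewrite !indicE in_setU; case: (y \in A); case: (y \in B) => /=; lra.
Qed.

Lemma prD (A B : set 'M[R]_n) : measurable A -> measurable B ->
  pr (A `\` B) = pr A - pr (A `&` B).
Proof.
move=> mA mB; have mAB : measurable (A `&` B) by exact: measurableI.
have bA : bm (\1_A : 'M[R]_n -> R) by exact: bm_indic.
have bB : bm (\1_(A `&` B) : 'M[R]_n -> R) by exact: bm_indic.
rewrite /pr -(ExB n0 Gsub Gdisc Gfin bA bB); congr (Ex _).
apply/funext => y; rewrite !indicE in_setD in_setI.
by case: (y \in A); case: (y \in B); rewrite /= ?subrr ?subr0.
Qed.

Lemma pr_ge0 A : measurable A -> 0 <= pr A.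
Proof. by move=> mA; apply: (Ex_ge0 n0 Gsub Gdisc Gfin) => [|y _]; [exact: bm_indic|rewrite indicE]. Qed.

Lemma pr_inv h S : \det h = 1 -> measurable S ->
  (forall g y, Gam g -> 0 < \det y -> S y -> S (g *m y)) ->
  pr [set y | S (y *m h)] = pr S.
Proof.
move=> dh mS Sinv; rewrite !prE//; last exact: (measurable_mulr_preimage _ mS).
congr (_ * fine _); rewrite !PmE ![_ `&` D1]setIC.
exact: (lam_D1_inv n0 Gsub Gdisc dh mS).
Qed.

(** The unions of the tails decrease to the empty set within [D1], and continuity from above applies
    because the measure is finite. *)
Lemma pr_cvg0 (E : nat -> set 'M[R]_n) : (forall m, measurable (E m)) ->
  (forall y, 0 < \det y -> \forall m \near \oo, ~ E m y) ->
  pr (E m) @[m --> \oo] --> (0 : R).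
Proof.
move=> mE hE.
pose T M := D1 `&` \bigcup_(m in [set m | (M <= m)%N]) E m.
have mT M : measurable (T M) by apply: measurableI => //; exact: bigcup_measurable.
have T0 : \bigcap_M T M = set0.
  apply/seteqP; split => y // h.
  have [[dy _ _] _] := h 0%N I.
  have [M _ hM] := hE _ dy; have [_ [m /= Mm Em]] := h M I.
  exact: (hM m).
have cv : Pm (T M) @[M --> \oo] --> (0 : \bar R)%E.
  rewrite -(measure0 Pm) -T0; apply: nonincreasing_cvg_mu => //.
  - apply: (@le_lt_trans _ _ (Pm setT)); last by rewrite (PmT n0 Gsub Gdisc Gfin) ltry.
    by apply: le_measure; rewrite ?inE.
  - by rewrite T0.
  - move=> i j ij; apply/subsetPset => y [Dy [m /= jm Em]]; split => //.
    by exists m => //=; exact: leq_trans jm.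
have cv' : pr (T M) @[M --> \oo] --> (0 : R).
  under eq_fun do rewrite prE//.
  rewrite -(mulr0 mass^-1); apply: cvgM; first exact: cvg_cst.
  by apply: (@fine_cvg _ _ _ _ (fun M => Pm (T M)) 0).
apply: (@squeeze_cvgr _ _ _ _ (fun _ => 0) (fun m => pr (T m))) => //.
  apply: nearW => m; rewrite pr_ge0//=; apply: pr_le => // y [Ey Dy].
  by split => //; exists m => /=.
exact: cvg_cst.
Qed.

(** The cocycle of the right action of SL_n on the quotient by Gam, relative to the section [sfun];
    being Gam-invariant in [y], it lives on the quotient. *)
Definition alpha y h := invmx (sfun y) *m sfun (y *m h).

Lemma alphaG y h : Gam (alpha y h).
Proof. exact: GM (GV (sG y)) (sG _). Qed.

Lemma alphaM y h h' : alpha y (h *m h') = alpha y h *m alpha (y *m h) h'.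
Proof. by rewrite /alpha !mulmxA mulmxK//; exact: GU. Qed.

Lemma alpha1 y : alpha y 1%:M = 1%:M.
Proof. by rewrite /alpha mulmx1 mulVmx//; exact: GU. Qed.

Lemma alpha_inv h : \det h = 1 -> Ginv Gam (alpha ^~ h).
Proof.
move=> dh g y Gg dy; have dyh : 0 < \det (y *m h) by rewrite det_mulmx dh mulr1.
rewrite /alpha -mulmxA (sfunM n0 Gsub Gdisc Gg dy) (sfunM n0 Gsub Gdisc Gg dyh).
have [ug us] := (GU Gg, GU (sG y)).
by rewrite -[RHS](mulKmx (GU (GM Gg (sG y)))) -(mulmxA g (sfun y)) mulKVmx.
Qed.

Lemma alpha_D1 y h : D1 y -> alpha y h = sfun (y *m h).
Proof. by rewrite /alpha => -[_ _ ->]; rewrite invmx1 mul1mx. Qed.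

Lemma measurable_sfun_eq g : measurable [set y | sfun y = g].
Proof.
rewrite (_ : [set y | _] = [set y | 0 < \det y /\ sfun y = g] `|`
   [set y | (g = 1%:M) /\ (~` (Omega (R:=R) (n:=n))) y]).
  apply: measurableU; first exact: measurable_sfun.
  by apply: measurable_prop; apply: measurableC; exact: measurable_Omega.
have s1 y : ~ 0 < \det y -> sfun y = 1%:M.
  by move=> dy; rewrite /sfun; case: xgetP => // h _ [k []].
apply/seteqP; split => y /=.
  move=> sy; have [dy|dy] := pselect (0 < \det y); first by left.
  by right; split => //; rewrite -sy s1.
by move=> [[]//|[-> dy]]; exact: s1.
Qed.

Lemma measurable_alpha_eq h g : measurable [set y | alpha y h = g].
Proof.
rewrite (_ : [set y | _] = \bigcup_k ([set y | sfun y = gam k] `&`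
   [set y | sfun (y *m h) = gam k *m g])).
  apply: bigcupT_measurable => k; apply: measurableI; first exact: measurable_sfun_eq.
  exact: (measurable_mulr_preimage _ (measurable_sfun_eq _)).
apply/seteqP; split => y /=.
  move=> <-; exists (idx (sfun y)) => //; rewrite idxK//; split => //=.
  by rewrite /alpha mulKVmx//; exact: GU.
move=> [k _ [/= s1 s2]]; rewrite /alpha s1 s2 mulKmx//; apply: GU; exact: gamG.
Qed.

Lemma measurable_Gfun d (T : measurableType d) (a : T -> 'M[R]_n) (phi : 'M[R]_n -> R) :
  (forall y, Gam (a y)) -> (forall g, measurable [set y | a y = g]) ->
  measurable_fun setT (phi \o a).
Proof.
move=> aG ma _ B mB; rewrite setTI.
rewrite (_ : _ @^-1` B = \bigcup_k (if `[< B (phi (gam k)) >] then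
   [set y | a y = gam k] else set0)).
  by apply: bigcupT_measurable => k; case: ifP.
apply/seteqP; split => y /=.
  move=> By; exists (idx (a y)) => //; rewrite idxK// asboolT//=.
by move=> [k _]; case: asboolP => //= Bk ->.
Qed.

(** The cocycle takes countably many values, so finitely many of them carry all but [eta] of the
    mass. Such values will form the finite set on which the two maps are assumed close. *)
Lemma tight h eta : \det h = 1 -> 0 < eta -> exists B : seq 'M[R]_n,
  (forall g, g \in B -> Gam g) /\ measurable [set y | alpha y h \notin B] /\
  pr [set y | alpha y h \notin B] <= eta.
Proof.
move=> dh eta0.
pose B m := [seq gam k | k <- iota 0 m].
pose E m := [set y | alpha y h \notin B m].
have mE m : measurable (E m).
  rewrite (_ : E m = ~` \bigcup_(k in `I_m) [set y | alpha y h = gam k]).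
    by apply: measurableC; apply: bigcup_measurable => k _; exact: measurable_alpha_eq.
  apply/seteqP; split => y /=.
    move=> /negP h1 [k /= km hk]; apply: h1; rewrite hk; apply: map_f.
    by rewrite mem_iota.
  move=> h1; apply/negP => /mapP[k]; rewrite mem_iota/= => km hk.
  by apply: h1; exists k.
have : pr (E m) @[m --> \oo] --> (0 : R).
  apply: pr_cvg0 => // y dy; exists (idx (alpha y h)).+1 => // m /= hm; apply/negP/negPn.
  rewrite -(idxK Gdisc (alphaG y h)); apply: map_f; rewrite mem_iota/=.
  exact: hm.
move=> /cvgr0Pnorm_lt /(_ _ eta0)[m _ hm].
exists (B m); split; first by move=> g /mapP[k _ ->]; exact: gamG.
split; first exact: mE.
by have := hm m (leqnn m); rewrite ger0_norm ?pr_ge0// => /ltW.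
Qed.

Lemma gcone_open k (z : nat -> 'M[R]_n) y : mcvg z y -> gcone Gam k y ->
  \forall m \near \oo, gcone Gam k (z m).
Proof.
rewrite /gcone; case: unpickle => [c|//] zy [gc [t t0 ht]].
have : \forall m \near \oo, forall ij : 'I_n * 'I_n,
    `|(t *: z m) ij.1 ij.2 - ratr (c.1 ij.1 ij.2)| < c.2.+1%:R^-1.
  apply: (@filter_forall _ _ (fun (ij : 'I_n * 'I_n) m =>
    `|(t *: z m) ij.1 ij.2 - ratr (c.1 ij.1 ij.2)| < c.2.+1%:R^-1) \oo) => -[i j] /=.
  have h : `|(t *: z m) i j - ratr (c.1 i j)| @[m --> \oo] --> `|t * y i j - ratr (c.1 i j)|.
    under eq_fun do rewrite mxE.
    apply: cvg_norm; apply: cvgB; last exact: cvg_cst.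
    by apply: cvgM; [exact: cvg_cst|exact: zy].
  by apply: (cvgr_lt _ h); have := ht i j; rewrite mxE.
apply: filterS => m h; split => //; exists t => // i j; exact: (h (i, j)).
Qed.

Lemma mcvg_mulr (q : nat -> 'M[R]_n) (a y : 'M[R]_n) :
  mcvg q 1%:M -> mcvg (fun m => a *m (y *m q m)) (a *m y).
Proof.
move=> q1; rewrite -{2}[y]mulmx1; apply: mcvg_mul; first exact: mcvg_cst.
by apply: mcvg_mul => //; exact: mcvg_cst.
Qed.

Notation kfun := (kfun Gam).

Lemma measurable_kfun_gt K : measurable [set y | 0 < \det y /\ (K < kfun y)%N].
Proof.
rewrite (_ : [set y | _] = Omega (R:=R) (n:=n) `&` ~` \bigcup_(k in `I_K.+1)
   \bigcup_m [set y | cell Gam k (gam m) y]).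
  apply: measurableI; first exact: measurable_Omega.
  apply: measurableC; apply: bigcup_measurable => k _; apply: bigcupT_measurable => m.
  exact: measurable_cell.
apply/seteqP; split => y /=.
  move=> [dy Ky]; split => // -[k /= kK [m _ c]].
  by move: Ky; rewrite (kfun_eq Gsub c) ltnNge -ltnS kK.
move=> [dy h]; split => //; rewrite ltnNge; apply/negP => Ky; apply: h.
exists (kfun y) => //; exists (idx (sfun y)) => //=; rewrite idxK//.
exact: (cellP n0 Gsub Gdisc).
Qed.

Lemma measurable_sfun_neq h : measurable [set y | sfun (y *m h) <> sfun y].
Proof.
rewrite (_ : [set y | _] = ~` \bigcup_k ([set y | sfun y = gam k] `&`
   [set y | sfun (y *m h) = gam k])).
  apply: measurableC; apply: bigcupT_measurable => k; apply: measurableI.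
    exact: measurable_sfun_eq.
  exact: (measurable_mulr_preimage _ (measurable_sfun_eq _)).
apply/seteqP; split => y /=.
  by move=> H [k _ [/= s1 s2]]; apply: H; rewrite s1 s2.
by move=> H e; apply: H; exists (idx (sfun y)) => //; rewrite idxK.
Qed.

(** [sfun] can change between y and y q only if y q leaves the translated cone of y or enters the
    saturation [O j] of an earlier cone. Openness shows that leaving becomes rare but does not
    control entering. Invariance of the measure does: [O j] and its translate have equal mass, so
    the parts entered ([V]) and left ([U]) have equal mass. Cones of large index carry little mass
    and are set apart. *)
Lemma sfun_continuity (q : nat -> 'M[R]_n) : (forall m, \det (q m) = 1) -> mcvg q 1%:M ->
  pr [set y | sfun (y *m q m) <> sfun y] @[m --> \oo] --> (0 : R).
Proof.
move=> dq q1.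
pose O j := [set y | sat Gam j y].
have mO j : measurable (O j) by exact: measurable_sat.
pose U j m := O j `\` [set y | O j (y *m q m)].
pose V j m := [set y | O j (y *m q m)] `\` O j.
have mOq j m : measurable [set y | O j (y *m q m)] by exact: (measurable_mulr_preimage _ (mO j)).
have mU j m : measurable (U j m) by exact: measurableD.
have mV j m : measurable (V j m) by exact: measurableD.
have UV j m : pr (V j m) = pr (U j m).
  have e1 : pr [set y | O j (y *m q m)] = pr (O j).
    by apply: pr_inv => // g y Gg dy; exact: sat_Gam.
  rewrite /V /U (prD (mOq j m) (mO j)) (prD (mO j) (mOq j m)) e1 (setIC (O j)).
  by [].
have U0 j : pr (U j m) @[m --> \oo] --> (0 : R).
  apply: pr_cvg0 => // y dy; have [[g Gg hg]|nO] := pselect (O j y); last first.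
    by apply: nearW => m [].
  have := gcone_open (mcvg_mulr (a := invmx g) (y := y) q1) hg.
  by apply: filterS => m hm [_]; apply; exists g.
pose W m := [set y | 0 < \det y /\ ~ gcone Gam (kfun y) (invmx (sfun y) *m (y *m q m))].
have mW m : measurable (W m).
  rewrite (_ : W m = \bigcup_k \bigcup_l ([set y | cell Gam k (gam l) y] `&`
     ~` [set y | gcone Gam k (invmx (gam l) *m y *m q m)])).
    apply: bigcupT_measurable => k; apply: bigcupT_measurable => l.
    apply: measurableI; first exact: measurable_cell.
    by apply: measurableC; exact: (measurable_mul_preimage _ _ (measurable_gcone Gam k)).
  apply/seteqP; split => y /=.
    move=> [dy h]; exists (kfun y) => //; exists (idx (sfun y)) => //; rewrite idxK//.
    by split; [exact: (cellP n0 Gsub Gdisc)|rewrite /= -mulmxA].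
  move=> [k _ [l _ [c /=]]]; rewrite -mulmxA => h; split; first by case: c.
  by rewrite (kfun_eq Gsub c) (sfun_eq Gsub c).
have W0 : pr (W m) @[m --> \oo] --> (0 : R).
  apply: pr_cvg0 => // y dy.
  have [_ _ hg _] := cellP n0 Gsub Gdisc dy.
  have := gcone_open (mcvg_mulr (a := invmx (sfun y)) (y := y) q1) hg.
  by apply: filterS => m hm [].
pose Kt K := [set y | 0 < \det y /\ (K < kfun y)%N].
have mK K : measurable (Kt K) by exact: measurable_kfun_gt.
have K0 : pr (Kt K) @[K --> \oo] --> (0 : R).
  apply: pr_cvg0 => // y dy; exists (kfun y) => // m /= hm [_].
  by rewrite ltnNge hm.
pose A m := [set y | sfun (y *m q m) <> sfun y].
have mA m : measurable (A m) by exact: measurable_sfun_neq.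
have bound K m : pr (A m) <= pr (Kt K) + pr (W m) + \sum_(0 <= j < K) pr (U j m).
  have -> : \sum_(0 <= j < K) pr (U j m) = \sum_(0 <= j < K) pr (V j m).
    by apply: eq_bigr => j _; rewrite UV.
  pose S := \bigcup_(j in `I_K) V j m.
  have mS : measurable S by apply: bigcup_measurable.
  have prS : pr S <= \sum_(0 <= j < K) pr (V j m).
    rewrite /S; elim: (K) => [|K' IH].
      by rewrite II0 bigcup_set0 big_nil /pr indic0 (Ex_cst n0 Gsub Gdisc Gfin).
    rewrite big_nat_recr//= IIS bigcup_setU bigcup_set1; apply: le_trans (prU _ _) _ => //.
      by apply: bigcup_measurable.
    by rewrite lerD2r.
  apply: (@le_trans _ _ (pr (Kt K `|` W m `|` S))).
    apply: pr_le => //; first by do !apply: measurableU.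
    move=> y [Ay Dy]; have [dy _ _] := Dy.
    have [Ky|Ky] := pselect (Kt K y); first by left; left.
    have [Wy|Wy] := pselect (W m y); first by left; right.
    right; apply: contrapT => Sy; apply: Ay.
    have [_ _ hg kmin] := cellP n0 Gsub Gdisc dy.
    have kK : (kfun y <= K)%N by rewrite leqNgt; apply/negP => h; apply: Ky.
    apply: (sfun_eq Gsub (k := kfun y)); split.
    - by rewrite det_mulmx dq mulr1.
    - exact: sG.
    - by apply: contrapT => h; apply: Wy.
    - move=> j jk Oj; apply: Sy; exists j => /=; first exact: leq_trans kK.
      by split => //; exact: kmin.
  apply: le_trans (prU _ _) _ => //; first exact: measurableU.
  by apply: lerD => //; exact: prU.
apply/cvgr0Pnorm_lt => e e0.
have e2 : 0 < e / 2 by lra.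
have /cvgr0Pnorm_lt /(_ _ e2) [K _ /(_ K (leqnn K)) hK] := K0.
rewrite ger0_norm ?pr_ge0// in hK.
have cvS : (pr (W m) + \sum_(0 <= j < K) pr (U j m)) @[m --> \oo] --> (0 : R).
  rewrite -[X in _ --> X](addr0 0); apply: cvgD => //.
  have := @cvg_bigsum R _ (index_iota 0 K) xpredT (fun j m => pr (U j m)) (fun _ => 0) U0.
  by rewrite big1.
have /cvgr0Pnorm_lt /(_ _ e2) := cvS; apply: filterS => m.
rewrite ger0_norm; last by rewrite addr_ge0 ?pr_ge0// sumr_ge0// => j _; rewrite pr_ge0.
move=> hm; rewrite ger0_norm; last exact: (pr_ge0 (mA m)).
by apply: (le_lt_trans (bound K m)); lra.
Qed.

End Cocycle.

(** * Invariant means and Toeplitz forms on Z^2 *)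

Lemma ultra_nat_ex : exists U : set_system nat, UltraFilter U /\ \oo `<=` U.
Proof. by have [U [UU FU]] := ultraFilterLemma (F := \oo); exists U. Qed.

Definition ultra_nat : set_system nat := projT1 (cid ultra_nat_ex).

Lemma ultra_nat_ultra : UltraFilter ultra_nat.
Proof. by rewrite /ultra_nat; case: cid => U []. Qed.

Lemma ultra_nat_oo : \oo `<=` ultra_nat.
Proof. by rewrite /ultra_nat; case: cid => U []. Qed.

#[global] Existing Instance ultra_nat_ultra.

Lemma ultra_fmap (T U : Type) (f : T -> U) (F : set_system T) :
  UltraFilter F -> UltraFilter (f @ F).
Proof.
move=> UF; have PF := @ultra_proper _ _ UF; split; first exact: fmap_proper_filter.
move=> G PG FG; apply/seteqP; split => // A GA.
have [//|nA] := in_ultra_setVsetC (f @^-1` A) UF.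
have GnA : G (~` A) by exact: FG.
by have := filter_not_empty G; case; rewrite -(setICr A); exact: filterI.
Qed.

#[local] Instance ultra_nat_proper : ProperFilter ultra_nat := ultra_proper.

Section LIM.
Context {R : realType}.
Definition bnd (T : Type) (f : T -> R) := exists M, forall x, `|f x| <= M.

Lemma bnd_cst T (c : R) : bnd (fun _ : T => c). Proof. by exists `|c|. Qed.
Lemma bndD T (f g : T -> R) : bnd f -> bnd g -> bnd (fun x => f x + g x).
Proof.
move=> [M hM] [N hN]; exists (M + N) => x.
by rewrite (le_trans (ler_normD _ _))// lerD.
Qed.
Lemma bndZ T c (f : T -> R) : bnd f -> bnd (fun x => c * f x).
Proof.
by move=> [M hM]; exists (`|c| * M) => x; rewrite normrM ler_wpM2l.
Qed.

(** Limit along a fixed non-principal ultrafilter: it exists for every bounded sequence and is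
    linear and multiplicative. It serves both for the invariant mean and, at the end, for the limit
    representation. *)
Definition LIM (u : nat -> R) : R := lim (u @ ultra_nat).

Lemma LIM_cvg u : bnd u -> u @ ultra_nat --> LIM u.
Proof.
move=> [M hM].
have uU : UltraFilter (u @ ultra_nat) by exact: ultra_fmap.
have := @segment_compact R (- M) M; rewrite compact_ultra => /(_ (u @ ultra_nat) uU) h.
have [|p [_ cp]] := h.
  by apply: (@filterE _ ultra_nat) => k /=; rewrite in_itv/= -ler_norml.
by apply/cvg_ex; exists p.
Qed.

Lemma LIM_eq u l : u @ ultra_nat --> l -> LIM u = l.
Proof. by move=> h; apply: cvg_lim. Qed.

Lemma LIM_lim u l : u @ \oo --> l -> LIM u = l.
Proof.
move=> h; apply: LIM_eq => A /h; exact: ultra_nat_oo.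
Qed.

Lemma LIM_cst c : LIM (fun _ => c) = c.
Proof. by apply: LIM_lim; exact: cvg_cst. Qed.

Lemma LIMD u v : bnd u -> bnd v -> LIM (fun k => u k + v k) = LIM u + LIM v.
Proof. by move=> /LIM_cvg hu /LIM_cvg hv; apply: LIM_eq; exact: cvgD. Qed.

Lemma LIMZ c u : bnd u -> LIM (fun k => c * u k) = c * LIM u.
Proof. by move=> /LIM_cvg hu; apply: LIM_eq; apply: cvgM => //; exact: cvg_cst. Qed.

Lemma LIMM u v : bnd u -> bnd v -> LIM (fun k => u k * v k) = LIM u * LIM v.
Proof. by move=> /LIM_cvg hu /LIM_cvg hv; apply: LIM_eq; exact: cvgM. Qed.

Lemma LIM_le u v : bnd u -> bnd v -> (forall k, u k <= v k) -> LIM u <= LIM v.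
Proof.
move=> /LIM_cvg hu /LIM_cvg hv uv.
by apply: (ler_cvg_to hu hv); apply: nearW.
Qed.

Lemma LIM_near u eps (N : nat) : bnd u -> 0 < eps ->
  exists2 k, (N <= k)%N & `|u k - LIM u| < eps.
Proof.
move=> bu eps0; have := LIM_cvg bu.
move=> /cvgrPdist_lt /(_ _ eps0) h.
have hN : ultra_nat [set k | (N <= k)%N] by apply: ultra_nat_oo; exists N.
have /filter_ex [k [/= h1 h2]] : ultra_nat ((fun t => `|LIM u - u t| < eps) `&` [set k | (N <= k)%N]).
  exact: filterI.
by exists k => //; rewrite distrC.
Qed.

(** Invariance holds because a shift changes the sum over {0, ..., N} by two boundary terms only. *)
Definition mean1 (f : int -> R) : R := LIM (fun N => N.+1%:R^-1 * \sum_(a < N.+1) f a%:Z).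

Lemma avg_bnd (f : int -> R) M : (forall x, `|f x| <= M) ->
  forall N, `|N.+1%:R^-1 * \sum_(a < N.+1) f a%:Z| <= M.
Proof.
move=> hM N; rewrite normrM ger0_norm ?invr_ge0// ler_pdivrMl ?ltr0n//.
rewrite (le_trans (ler_norm_sum _ _ _))//.
apply: (@le_trans _ _ (\sum_(a < N.+1) M)); first by apply: ler_sum.
by rewrite sumr_const card_ord mulr_natl.
Qed.

Let bnd1 f : bnd f -> bnd (fun N => N.+1%:R^-1 * \sum_(a < N.+1) f a%:Z).
Proof. by move=> [M /avg_bnd hM]; exists M. Qed.

Lemma mean1_cst c : mean1 (fun _ => c) = c.
Proof.
rewrite /mean1 -[RHS]LIM_cst; congr LIM; apply/funext => N.
by rewrite sumr_const card_ord -[c *+ _]mulr_natl mulKf// pnatr_eq0.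
Qed.

Lemma mean1D f g : bnd f -> bnd g -> mean1 (fun x => f x + g x) = mean1 f + mean1 g.
Proof.
move=> bf bg; rewrite /mean1 -LIMD; [|exact: bnd1|exact: bnd1].
by congr LIM; apply/funext => N; rewrite big_split/= mulrDr.
Qed.

Lemma mean1Z c f : bnd f -> mean1 (fun x => c * f x) = c * mean1 f.
Proof.
move=> bf; rewrite /mean1 -LIMZ; last exact: bnd1.
by congr LIM; apply/funext => N; rewrite -mulr_sumr mulrCA.
Qed.

Lemma mean1_le f g : bnd f -> bnd g -> (forall x, f x <= g x) -> mean1 f <= mean1 g.
Proof.
move=> bf bg fg; apply: LIM_le; [exact: bnd1|exact: bnd1|move=> N].
by rewrite ler_wpM2l ?invr_ge0//; apply: ler_sum.
Qed.

Lemma mean1_bnd f M : (forall x, `|f x| <= M) -> `|mean1 f| <= M.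
Proof.
move=> hM; have bf : bnd f by exists M.
rewrite ler_norml; apply/andP; split.
  rewrite -(mean1_cst (-M)) mean1_le//; first exact: bnd_cst.
  by move=> x; have := hM x; rewrite ler_norml => /andP[].
rewrite -[leRHS](mean1_cst M) mean1_le//; first exact: bnd_cst.
by move=> x; have := hM x; rewrite ler_norml => /andP[].
Qed.

Let mean1S f : bnd f -> mean1 (fun x => f (x + 1)) = mean1 f.
Proof.
move=> bf; have [M hM] := bf.
have bs : bnd (fun x => f (x + 1)) by exists M => x.
apply/eqP; rewrite -subr_eq0 -mulN1r -mean1Z// -mean1D//; last exact: bndZ.
apply/eqP; apply: LIM_lim.
have hb N : `|N.+1%:R^-1 * \sum_(a < N.+1) (f (a%:Z + 1) + -1 * f a%:Z)| <= (M + M) * N.+1%:R^-1.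
  have -> : \sum_(a < N.+1) (f (a%:Z + 1) + -1 * f a%:Z) = f N.+1%:Z - f 0.
    rewrite -(big_mkord xpredT (fun a : nat => f (a%:Z + 1) + -1 * f a%:Z)).
    rewrite -(@telescope_sumr _ 0 N.+1 (fun a : nat => f a%:Z))//.
    by apply: eq_bigr => a _; rewrite mulN1r -addn1 PoszD.
  rewrite normrM ger0_norm ?invr_ge0// mulrC ler_wpM2r ?invr_ge0//.
  by rewrite (le_trans (ler_normB _ _))// lerD.
apply/cvgr0Pnorm_lt => e e0.
have h : ((M + M) * N.+1%:R^-1) @[N --> \oo] --> ((M + M) * 0 : R).
  by apply: cvgM; [exact: cvg_cst|exact: cvg_harmonic].
rewrite mulr0 in h.
have /cvgr0Pnorm_lt /(_ _ e0) := h; apply: filterS => N; apply: le_lt_trans.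
by rewrite (le_trans (hb N))// ler_norm.
Qed.

Lemma mean1_shift f (z : int) : bnd f -> mean1 (fun x => f (x + z)) = mean1 f.
Proof.
have key k g : bnd g -> mean1 (fun x => g (x + k%:Z)) = mean1 g.
  elim: k g => [|k IH] g bg; first by congr mean1; apply/funext => x; rewrite addr0.
  rewrite -[RHS]IH// -(@mean1S (fun x => g (x + k%:Z))).
    by congr mean1; apply/funext => x; rewrite -addrA -PoszD add1n.
  by case: bg => M hM; exists M => x.
move=> bf; case: z => k; first exact: key.
have -> : mean1 f = mean1 (fun x => f (x + k.+1%:Z + Negz k)).
  by congr mean1; apply/funext => x; rewrite NegzE addrK.
rewrite (key k.+1 (fun x => f (x + Negz k)))//.
by case: bf => M hM; exists M.
Qed.

Definition mean2 (f : int * int -> R) : R := mean1 (fun a => mean1 (fun b => f (a, b))).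

Let bnd2 f : bnd f -> bnd (fun a : int => mean1 (fun b => f (a, b))).
Proof. by move=> [M hM]; exists M => a; apply: mean1_bnd. Qed.
Let bnd3 f (a : int) : bnd f -> bnd (fun b : int => f (a, b)).
Proof. by move=> [M hM]; exists M. Qed.

Lemma mean2_cst c : mean2 (fun _ => c) = c.
Proof. by rewrite /mean2 !mean1_cst. Qed.

Lemma mean2D f g : bnd f -> bnd g -> mean2 (fun x => f x + g x) = mean2 f + mean2 g.
Proof.
move=> bf bg; rewrite /mean2 -mean1D; [|exact: bnd2|exact: bnd2].
by congr mean1; apply/funext => a; rewrite mean1D//; exact: bnd3.
Qed.

Lemma mean2Z c f : bnd f -> mean2 (fun x => c * f x) = c * mean2 f.
Proof.
move=> bf; rewrite /mean2 -mean1Z; last exact: bnd2.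
by congr mean1; apply/funext => a; rewrite mean1Z//; exact: bnd3.
Qed.

Lemma mean2_le f g : bnd f -> bnd g -> (forall x, f x <= g x) -> mean2 f <= mean2 g.
Proof.
move=> bf bg fg; apply: mean1_le; [exact: bnd2|exact: bnd2|move=> a].
by apply: mean1_le; [exact: bnd3|exact: bnd3|].
Qed.

Lemma mean2_shift f (z : int * int) : bnd f -> mean2 (fun x => f (x + z)) = mean2 f.
Proof.
move=> bf; rewrite /mean2 -[RHS](mean1_shift z.1); last exact: bnd2.
congr mean1; apply/funext => a.
by rewrite -[RHS](mean1_shift z.2)//; exact: bnd3.
Qed.

Lemma bnd_sum T (I : Type) (s : seq I) (F : I -> T -> R) :
  (forall i, bnd (F i)) -> bnd (fun x => \sum_(i <- s) F i x).
Proof.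
move=> hF; elim: s => [|i s IH].
  by under eq_fun do rewrite big_nil; exact: bnd_cst.
by under eq_fun do rewrite big_cons; exact: bndD.
Qed.

Lemma mean2_sum (I : Type) (s : seq I) (F : I -> int * int -> R) :
  (forall i, bnd (F i)) -> mean2 (fun x => \sum_(i <- s) F i x) = \sum_(i <- s) mean2 (F i).
Proof.
move=> hF; elim: s => [|i s IH].
  by under eq_fun do rewrite big_nil; rewrite big_nil mean2_cst.
under eq_fun do rewrite big_cons.
by rewrite big_cons mean2D ?IH//; exact: bnd_sum.
Qed.
End LIM.

(** * Trigonometric sums and Toeplitz forms *)

Section Dirichlet.
Context {R : realType}.

Lemma sin_pi_int (x : R) (z : int) : sin (x + 2 * (pi * z%:~R)) = sin x.
Proof.
have key k y : sin (y + 2 * (pi * k%:R)) = sin y :> R.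
  have -> : 2 * (pi * k%:R) = (pi *+ 2) *+ k :> R.
    by rewrite -[RHS]mulr_natr -[pi *+ 2]mulr_natr; ring.
  exact: (periodicn (@sinD2pi R)).
case: z => k; first by rewrite -pmulrn.
rewrite NegzE mulrNz -pmulrn -[LHS](key k.+1).
by congr sin; ring.
Qed.

(** Multiplied by 2 sin (pi z / M) the sum telescopes to a difference of two sines whose arguments
    differ by a multiple of 2 pi; the factor is nonzero as 0 < |z| < M. *)
Lemma sum_cos_eq0 (M : nat) (z : int) (b : R) : (0 < M)%N -> (0 < `|z| < M)%N ->
  \sum_(k < M) cos (z%:~R * (2 * pi / M%:R * k%:R) + b) = 0.
Proof.
move=> M0 /andP[z0 zM].
have M0' : 0 < M%:R :> R by rewrite ltr0n.
have MN : M%:R != 0 :> R by rewrite gt_eqF.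
have sa : sin (pi * z%:~R / M%:R) != 0 :> R.
  have h : 0 < sin (pi * `|z|%N%:R / M%:R) :> R.
    apply: sin_gt0_pi; apply/andP; split.
      by rewrite !mulr_gt0 ?pi_gt0 ?ltr0n ?invr_gt0.
    by rewrite ltr_pdivrMr// ltr_pM2l ?pi_gt0// ltr_nat.
  move: z0 zM h; case: z => k _ _ h; first by rewrite -pmulrn gt_eqF.
  by rewrite NegzE mulrNz mulrN mulNr sinN oppr_eq0 -pmulrn gt_eqF.
pose a : R := pi * z%:~R / M%:R; rewrite -/a in sa.
pose u (k : nat) : R := sin ((2 * k%:R - 1) * a + b).
have tel : 2 * sin a * \sum_(k < M) cos (z%:~R * (2 * pi / M%:R * k%:R) + b) = u M - u 0%N.
  rewrite mulr_sumr -(@telescope_sumr _ 0 M u)// big_mkord; apply: eq_bigr => k _.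
  have -> : z%:~R * (2 * pi / M%:R * k%:R) + b = 2 * k%:R * a + b by rewrite /a; ring.
  rewrite /u.
  have -> : (2 * k.+1%:R - 1) * a + b = (2 * k%:R * a + b) + a by rewrite -natr1; ring.
  have -> : (2 * k%:R - 1) * a + b = (2 * k%:R * a + b) - a by ring.
  by rewrite sinD sinB; ring.
have uM : u M = u 0%N.
  rewrite /u -[RHS](sin_pi_int _ z); congr sin.
  by rewrite /a; field.
apply: (mulfI (mulf_neq0 (_ : 2 != 0) sa)); first by rewrite pnatr_eq0.
by rewrite tel uM subrr mulr0.
Qed.

Definition ang (v : int * int) (th : R * R) : R := v.1%:~R * th.1 + v.2%:~R * th.2.

Lemma angD v w th : ang (v + w) th = ang v th + ang w th.
Proof. by rewrite /ang !intrD; ring. Qed.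
Lemma angB v w th : ang (v - w) th = ang v th - ang w th.
Proof. by rewrite /ang !intrB; ring. Qed.

Definition node (M : nat) (k : 'I_M * 'I_M) : R * R :=
  (2 * pi / M%:R * k.1%:R, 2 * pi / M%:R * k.2%:R).

(** Orthogonality of the characters of (Z/M)^2; the bounds on [z] exclude aliasing. *)
Lemma sum_cos_node (M : nat) (z : int * int) : (0 < M)%N -> (`|z.1| < M)%N -> (`|z.2| < M)%N ->
  \sum_(k : 'I_M * 'I_M) cos (ang z (node k)) = M%:R ^+ 2 * (z == 0)%:R.
Proof.
case: z => z1 z2 /= M0 h1 h2; rewrite -(pair_big xpredT xpredT (fun i j => cos (ang (z1, z2) (node (i, j)))))/=.
rewrite /ang/=.
have [z10|z10] := eqVneq z1 0; last first.
  rewrite exchange_big big1/=; last first.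
    by move=> j _; rewrite sum_cos_eq0// h1 absz_gt0 z10.
  by rewrite xpair_eqE (negbTE z10) mulr0.
have [z20|z20] := eqVneq z2 0; last first.
  rewrite big1/=; last first.
    move=> i _; under eq_bigr do rewrite addrC.
    by rewrite sum_cos_eq0// h2 absz_gt0 z20.
  by rewrite xpair_eqE (negbTE z20) andbF mulr0.
rewrite z10 z20 eqxx mulr1.
under eq_bigr do under eq_bigr do rewrite !mul0r addr0 cos0.
by rewrite !sumr_const !card_ord -[LHS]mulr_natr expr2.
Qed.
End Dirichlet.

Section Toeplitz.
Context {R : realType} (E : lmodType R) (dot : E -> E -> R).
Hypothesis dotC : forall x y, dot x y = dot y x.
Hypothesis dotDl : forall x y z, dot (x + y) z = dot x z + dot y z.
Hypothesis dotZl : forall c x y, dot (c *: x) y = c * dot x y.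
Hypothesis dot_ge0 : forall x, 0 <= dot x x.

Let dotDr x y z : dot x (y + z) = dot x y + dot x z.
Proof. by rewrite dotC dotDl dotC [dot z x]dotC. Qed.
Let dotZr c x y : dot x (c *: y) = c * dot x y.
Proof. by rewrite dotC dotZl dotC. Qed.
Let dotNl x y : dot (- x) y = - dot x y.
Proof. by rewrite -scaleN1r dotZl mulN1r. Qed.
Let dotNr x y : dot x (- y) = - dot x y.
Proof. by rewrite dotC dotNl dotC. Qed.

Lemma dot_suml (I : Type) (s : seq I) (F : I -> E) x :
  dot (\sum_(i <- s) F i) x = \sum_(i <- s) dot (F i) x.
Proof.
elim: s => [|i s IH]; last by rewrite !big_cons dotDl IH.
by rewrite !big_nil -(scale0r 0) dotZl mul0r.
Qed.
Lemma dot_sumr (I : Type) (s : seq I) (F : I -> E) x :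
  dot x (\sum_(i <- s) F i) = \sum_(i <- s) dot x (F i).
Proof. by rewrite dotC dot_suml; apply: eq_bigr => i _; rewrite dotC. Qed.

Lemma sq_dotD x y : dot (x + y) (x + y) <= 2 * dot x x + 2 * dot y y.
Proof.
have := dot_ge0 (x - y); rewrite !(dotDl, dotDr, dotNl, dotNr) (dotC y x).
lra.
Qed.

Lemma dot_absle x y : `|dot x y| <= (dot x x + dot y y) / 2.
Proof.
have := dot_ge0 (x - y); have := dot_ge0 (x + y).
rewrite !(dotDl, dotDr, dotNl, dotNr) (dotC y x) ler_norml => h1 h2.
by apply/andP; split; lra.
Qed.

(** A formal list of coefficients and frequencies, with repetitions allowed. Cosines suffice because
    Gram matrices are symmetric, so that sine terms cancel. *)
Definition tpoly := seq (R * (int * int)).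
Definition eval (l : tpoly) (th : R * R) : R := \sum_(p <- l) p.1 * cos (ang p.2 th).

Section Form.
Variables (I : finType) (pos : I -> int * int).
Definition toep (l : tpoly) (b : I -> E) : R :=
  \sum_(p <- l) p.1 * \sum_(i : I) \sum_(j : I) (pos i - pos j == p.2)%:R * dot (b i) (b j).

Let toep_wave (v : int * int) (b : I -> E) th :
  \sum_i \sum_j cos (ang (pos i - pos j - v) th) * dot (b i) (b j) =
  cos (ang v th) *
   (dot (\sum_i cos (ang (pos i) th) *: b i) (\sum_i cos (ang (pos i) th) *: b i)
    + dot (\sum_i sin (ang (pos i) th) *: b i) (\sum_i sin (ang (pos i) th) *: b i)).
Proof.
pose c i := cos (ang (pos i) th); pose s i := sin (ang (pos i) th).
have exp (f g : I -> R) : dot (\sum_i f i *: b i) (\sum_i g i *: b i) =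
    \sum_i \sum_j f i * g j * dot (b i) (b j).
  rewrite dot_suml; apply: eq_bigr => i _; rewrite dot_sumr; apply: eq_bigr => j _.
  by rewrite dotZl dotZr mulrA.
have anti : \sum_i \sum_j s i * c j * dot (b i) (b j) = \sum_i \sum_j c i * s j * dot (b i) (b j).
  by rewrite -!exp dotC.
transitivity (\sum_i \sum_j (cos (ang v th) * (c i * c j * dot (b i) (b j)
    + s i * s j * dot (b i) (b j)) + sin (ang v th) * (s i * c j * dot (b i) (b j) - c i * s j * dot (b i) (b j)))).
  apply: eq_bigr => i _; apply: eq_bigr => j _.
  by rewrite !angB cosB [cos (_ - _)]cosB sinB /c /s; ring.
rewrite -[\sum_i cos _ *: _]/(\sum_i c i *: b i) -[\sum_i sin _ *: _]/(\sum_i s i *: b i) !exp.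
under eq_bigr do rewrite big_split/= -!mulr_sumr big_split/= sumrB.
rewrite big_split/= -!mulr_sumr big_split/= sumrB anti subrr mulr0 addr0.
by [].
Qed.

(** On a grid of M x M angles fine enough to exclude aliasing, M^2 times the form is the sum over
    the nodes of the symbol times the squared norm of the discrete Fourier transform of [b]. *)
Lemma toep_ge0 l b : (forall th, 0 <= eval l th) -> 0 <= toep l b.
Proof.
move=> l0.
have [M [M0 hM]] : exists M : nat, (0 < M)%N /\ forall p i j, p \in l ->
    (absz (pos i - pos j - p.2)%R.1 < M)%N /\ (absz (pos i - pos j - p.2)%R.2 < M)%N.
  pose f (p : R * (int * int)) (ij : I * I) : nat := (absz (pos ij.1 - pos ij.2 - p.2)%R.1 + absz (pos ij.1 - pos ij.2 - p.2)%R.2)%N.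
  exists (\sum_(p <- l) \sum_(ij : I * I) f p ij).+1; split => // p i j pl.
  have h : (f p (i, j) <= \sum_(p <- l) \sum_(ij : I * I) f p ij)%N.
    rewrite (big_rem p)//= (bigD1 (i, j))//= -addnA; exact: leq_addr.
  by split; rewrite ltnS (leq_trans _ h)// ?leq_addr ?leq_addl.
have M2 : 0 < M%:R ^+ 2 :> R by rewrite exprn_gt0// ltr0n.
rewrite -(pmulr_rge0 _ M2).
have -> : M%:R ^+ 2 * toep l b = \sum_(k : 'I_M * 'I_M) eval l (node k) *
   (dot (\sum_i cos (ang (pos i) (node k)) *: b i) (\sum_i cos (ang (pos i) (node k)) *: b i)
    + dot (\sum_i sin (ang (pos i) (node k)) *: b i) (\sum_i sin (ang (pos i) (node k)) *: b i)).
  rewrite /toep mulr_sumr.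
  under [RHS]eq_bigr do rewrite /eval mulr_suml.
  rewrite [RHS]exchange_big/= big_seq [RHS]big_seq; apply: eq_bigr => p pl.
  under [RHS]eq_bigr do rewrite -mulrA -toep_wave.
  rewrite -mulr_sumr mulrCA; congr (_ * _).
  rewrite [RHS]exchange_big/= mulr_sumr; apply: eq_bigr => i _.
  rewrite [RHS]exchange_big/= mulr_sumr; apply: eq_bigr => j _.
  have [h1 h2] := hM p i j pl.
  by rewrite -mulr_suml sum_cos_node// subr_eq0 mulrA.
apply: sumr_ge0 => k _; apply: mulr_ge0; first exact: l0.
by apply: addr_ge0; exact: dot_ge0.
Qed.

Lemma toep_cat l l' b : toep (l ++ l') b = toep l b + toep l' b.
Proof. by rewrite /toep big_cat. Qed.

Definition scl (c : R) (l : tpoly) : tpoly := [seq (c * p.1, p.2) | p <- l].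

Lemma toep_scl c l b : toep (scl c l) b = c * toep l b.
Proof. by rewrite /toep /scl big_map mulr_sumr; apply: eq_bigr => p _; rewrite mulrA. Qed.
End Form.

Lemma eval_cat l l' th : eval (l ++ l') th = eval l th + eval l' th.
Proof. by rewrite /eval big_cat. Qed.
Lemma eval_scl c l th : eval (scl c l) th = c * eval l th.
Proof. by rewrite /eval /scl big_map mulr_sumr; apply: eq_bigr => p _; rewrite mulrA. Qed.
Definition tcst (c : R) : tpoly := [:: (c, 0)].
Lemma eval_cst c th : eval (tcst c) th = c.
Proof. by rewrite /eval big_seq1/= /ang/= !mul0r addr0 cos0 mulr1. Qed.

Section TV.
Variables (I : finType) (pos : I -> int * int).
Hypothesis pos_inj : injective pos.
Notation toep := (toep pos).

Lemma toep_cst c b : toep (tcst c) b = c * \sum_i dot (b i) (b i).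
Proof.
rewrite /toep big_seq1/=; congr (_ * _); apply: eq_bigr => i _.
rewrite (bigD1 i)//= subrr eqxx mul1r big1 ?addr0// => j ji.
by rewrite subr_eq0 (inj_eq pos_inj) eq_sym (negbTE ji) mul0r.
Qed.

Lemma toep_abs l s b : (forall th, `|eval l th| <= s) -> `|toep l b| <= s * \sum_i dot (b i) (b i).
Proof.
move=> hs; rewrite ler_norml.
have h1 : 0 <= toep (l ++ tcst s) b.
  apply: toep_ge0 => th; rewrite eval_cat eval_cst; have := hs th; rewrite ler_norml => /andP[]; lra.
have h2 : 0 <= toep (scl (-1) l ++ tcst s) b.
  apply: toep_ge0 => th; rewrite eval_cat eval_cst eval_scl; have := hs th; rewrite ler_norml => /andP[]; lra.
move: h1 h2; rewrite !toep_cat toep_scl toep_cst => h1 h2.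
by apply/andP; split; lra.
Qed.

(* [toep l] is a quadratic form: the difference of its values at two nearby families is a value
   of the polar form, which is estimated by polarization. *)
Let toep_polar l (a b : I -> E) (t : R) : t != 0 ->
  toep l a - toep l b =
  (toep l (fun i => t *: (a i + b i) + t^-1 *: (a i - b i)) -
   toep l (fun i => t *: (a i + b i) - t^-1 *: (a i - b i))) / 4.
Proof.
move=> t0; rewrite /toep -!sumrB mulr_suml; apply: eq_bigr => p _.
rewrite -!mulrBr -mulrA; congr (_ * _).
rewrite -!sumrB mulr_suml.
pose K i j : R := (pos i - pos j == p.2)%:R.
transitivity (\sum_i \sum_j K i j * (dot (a i) (a j) - dot (b i) (b j))).
  by apply: eq_bigr => i _; rewrite -sumrB; apply: eq_bigr => j _; rewrite mulrBr.
apply: eq_bigr => i _; rewrite -sumrB mulr_suml; apply: eq_bigr => j _.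
rewrite !(dotDl, dotDr, dotNl, dotNr, dotZl, dotZr) -/(K i j).
by field.
Qed.

(** With t = sqrt kap in the polar form, both families have squared norms of order [kap]: per point
    they contribute together at most 8 kap from the sums and 2 kap from the differences, and
    division by 4 gives 5/2. The bound is linear in the number of points, while a termwise estimate
    would involve the number of pairs. *)
Lemma toep_close l s kap (a b : I -> E) : 0 < kap -> (forall th, `|eval l th| <= s) ->
  (forall i, dot (a i) (a i) <= 1) -> (forall i, dot (b i) (b i) <= 1) ->
  (forall i, dot (a i - b i) (a i - b i) <= kap ^+ 2) ->
  `|toep l a - toep l b| <= 5 / 2 * kap * s * #|I|%:R.
Proof.
move=> k0 hs ha hb hab.
have s0 : 0 <= s by exact: le_trans (normr_ge0 _) (hs (0, 0)).
have t0 : 0 < Num.sqrt kap by rewrite sqrtr_gt0.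
have t2 : Num.sqrt kap * Num.sqrt kap = kap by rewrite -expr2 sqr_sqrtr// ltW.
set t := Num.sqrt kap in t0 t2.
have tN : t != 0 by rewrite gt_eqF.
rewrite (toep_polar l a b tN) normrM (@ger0_norm _ (4^-1))//.
rewrite ler_pdivrMr// (le_trans (ler_normB _ _))//.
have h1 := toep_abs (fun i => t *: (a i + b i) + t^-1 *: (a i - b i)) hs.
have h2 := toep_abs (fun i => t *: (a i + b i) - t^-1 *: (a i - b i)) hs.
rewrite (le_trans (lerD h1 h2))// -mulrDr.
rewrite [leRHS](_ : _ = s * (#|I|%:R * (10 * kap))); last by field.
rewrite ler_wpM2l// -big_split/= mulr_natl -sumr_const.
apply: ler_sum => i _.
have tt : t * t * (t^-1 * t^-1) = 1 by field.
have u0 : 0 <= t^-1 * t^-1 by rewrite mulr_ge0// invr_ge0 ltW.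
have e1 : t^-1 * t^-1 * kap ^+ 2 = kap by rewrite -t2; field.
have := hab i; have := dot_ge0 (a i - b i); have := ha i; have := hb i.
rewrite !(dotDl, dotDr, dotNl, dotNr, dotZl, dotZr) (dotC (b i) (a i)).
set A := dot (a i) (a i); set B := dot (b i) (b i); set X := dot (a i) (b i).
move=> hB hA hp hk.
have h3 : t^-1 * t^-1 * (A - X + (- X + B)) <= kap by rewrite -e1 ler_wpM2l//; lra.
have h4 : t * t * (A + X + (X + B)) <= kap * 4 by rewrite t2 (ler_wpM2l (ltW k0))//; lra.
nra.
Qed.
End TV.
End Toeplitz.

Lemma le_harmonic_le (R : realType) (x y C : R) : (forall N : nat, x <= y + C / N.+1%:R) -> x <= y.
Proof.
move=> h; have c : (y + C / N.+1%:R) @[N --> \oo] --> (y + C * 0 : R).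
  apply: cvgD; first exact: cvg_cst.
  by apply: cvgM; [exact: cvg_cst|exact: cvg_harmonic].
rewrite mulr0 addr0 in c.
rewrite -(cvg_lim _ c)//; apply: limr_ge; first by apply/cvg_ex; exists y.
by apply: nearW.
Qed.

Section Count.
Variable N : nat.

Definition gpos (i : 'I_N * 'I_N) : int * int := (i.1%:Z, i.2%:Z).

Lemma gpos_inj : injective gpos.
Proof. by move=> [a b] [c d] [/val_inj -> /val_inj ->]. Qed.

Lemma count1 (z : int) : (\sum_(a < N) ~~ (0 <= a%:Z + z < N%:Z)%R <= `|z|)%N.
Proof.
have -> : (\sum_(a < N) ~~ (0 <= a%:Z + z < N%:Z)%R =
  \sum_(0 <= a < N) ~~ (0 <= a%:Z + z < N%:Z)%R)%N by rewrite big_mkord.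
have tr (P : pred nat) m k : (\sum_(m <= a < k) P a <= k - m)%N.
  rewrite -[leqRHS]muln1 -sum_nat_const_nat; apply: leq_sum => a _; exact: leq_b1.
have [zN|Nz] := leqP `|z|%N N; last first.
  by rewrite (leq_trans (tr (fun a : nat => ~~ (0 <= a%:Z + z < N%:Z)%R) _ _))// subn0 ltnW.
case: z zN => k /= kN.
  rewrite (@big_cat_nat _ _ _ (N - k))//=; last exact: leq_subr.
  rewrite big_nat big1; last by move=> a /andP[_ ak]; apply/eqP; lia.
  by rewrite add0n (leq_trans (tr (fun a : nat => ~~ (0 <= a%:Z + k%:Z < N%:Z)%R) _ _))//; lia.
rewrite (@big_cat_nat _ _ _ k.+1)//=.
rewrite [X in (_ + X)%N]big_nat [X in (_ + X)%N]big1; last by move=> a /andP[ak aN]; apply/eqP; lia.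
by rewrite addn0 (leq_trans (tr (fun a : nat => ~~ (0 <= a%:Z + Negz k < N%:Z)%R) _ _))// subn0.
Qed.

Definition cnt (R : realType) (v : int * int) : R := \sum_i \sum_j (gpos i - gpos j == v)%:R.

(** The pairs lost come from the points that leave the grid under translation by [v]: a boundary
    effect of order N against N^2. *)
Lemma cnt_bound (R : realType) (v : int * int) :
  `|N%:R ^+ 2 - cnt R v| <= N%:R * (`|v.1| + `|v.2|)%N%:R.
Proof.
have e1 : N%:R ^+ 2 - cnt R v =
    \sum_(j : 'I_N * 'I_N) (~~ ((0 <= j.1%:Z + v.1 < N%:Z) && (0 <= j.2%:Z + v.2 < N%:Z)))%:R.
  have -> : N%:R ^+ 2 = \sum_(j : 'I_N * 'I_N) 1 :> R.
    by rewrite sumr_const card_prod !card_ord natrM expr2.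
  rewrite /cnt exchange_big/= -sumrB; apply: eq_bigr => j _.
  have [h|h] := boolP (_ && _).
    have [h1 h2] : (absz (j.1%:Z + v.1)%R < N)%N /\ (absz (j.2%:Z + v.2)%R < N)%N by move: h; lia.
    rewrite (bigD1 (Ordinal h1, Ordinal h2))//=.
    have -> : gpos (Ordinal h1, Ordinal h2) - gpos j == v.
      rewrite /gpos/=; case: (v) h h1 h2 => v1 v2 /= h h1 h2.
      by rewrite /= xpair_eqE/=; apply/andP; split; apply/eqP; lia.
    rewrite big1 ?addr0 ?subrr// => i /eqP iN; case: eqP => // iv; exfalso; apply: iN.
    apply: gpos_inj; rewrite -[LHS](subrK (gpos j)) iv /gpos/=; case: (v) h h1 h2 => v1 v2 /= h h1 h2.
    change ((v1 + j.1%:Z, v2 + j.2%:Z) = (Posz (absz (j.1%:Z + v1)), Posz (absz (j.2%:Z + v2)))).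
    by congr pair; lia.
  rewrite big1 ?subr0// => i _; case: eqP => // iv; exfalso; move: h => /negP; apply.
  rewrite -iv /gpos/=; have := ltn_ord i.1; have := ltn_ord i.2; lia.
rewrite e1 ger0_norm; last by apply: sumr_ge0.
rewrite -natr_sum -natrM ler_nat.
rewrite -(pair_big xpredT xpredT (fun a b : 'I_N => (~~ ((0 <= a%:Z + v.1 < N%:Z) && (0 <= b%:Z + v.2 < N%:Z)) : nat)))/=.
apply: (@leq_trans (\sum_(a < N) \sum_(b < N) (~~ (0 <= a%:Z + v.1 < N%:Z)%R + ~~ (0 <= b%:Z + v.2 < N%:Z)%R))%N).
  by apply: leq_sum => a _; apply: leq_sum => b _; case: (0 <= a%:Z + v.1 < _); case: (0 <= b%:Z + v.2); case: (b%:Z + v.2 < _).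
under eq_bigr do rewrite big_split/=.
rewrite big_split/= sum_nat_const card_ord mulnDr leq_add//.
  under eq_bigr do rewrite sum_nat_const card_ord.
  by rewrite -big_distrr/= leq_mul2l count1 orbT.
by rewrite leq_mul2l count1 orbT.
Qed.
End Count.

(** * The averaged positive definite function on Z^2 *)

Section Mean.
Context {R : realType} (E : lmodType R) (dot : E -> E -> R).
Hypothesis dotC : forall x y, dot x y = dot y x.
Hypothesis dotDl : forall x y z, dot (x + y) z = dot x z + dot y z.
Hypothesis dotZl : forall c x y, dot (c *: x) y = c * dot x y.
Hypothesis dot_ge0 : forall x, 0 <= dot x x.
Variables (xi : int * int -> E) (kap : R).
Hypothesis kap0 : 0 < kap.
Hypothesis xi1 : forall v, dot (xi v) (xi v) <= 1.

(* [K] is positive definite on Z^2; [EE] is integration against its spectral measure on the torus,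
   restricted to trigonometric polynomials. *)
Definition K (v : int * int) : R := mean2 (fun u => dot (xi (u + v)) (xi u)).
Definition EE (l : tpoly) : R := \sum_(p <- l) p.1 * K p.2.

(* Closeness of [xi \o g] (up to a translation) to the image of [xi] under some isometry; the
   isometry itself is never needed, only that it preserves the Gram matrix. *)
Definition gramclose (g : int * int -> int * int) := forall x, exists eta : int * int -> E,
  (forall v w, dot (eta v) (eta w) = dot (xi v) (xi w)) /\
  (forall v, dot (xi (x + g v) - eta v) (xi (x + g v) - eta v) <= kap ^+ 2).

Lemma bnd_gram (f g : int * int -> int * int) : bnd (fun u => dot (xi (f u)) (xi (g u))).
Proof.
exists 1 => u; apply: (le_trans (dot_absle dotC dotDl dotZl dot_ge0 _ _)).
by have := xi1 (f u); have := xi1 (g u); lra.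
Qed.

Lemma K_le1 v : `|K v| <= 1.
Proof.
have h u : `|dot (xi (u + v)) (xi u)| <= 1.
  apply: (le_trans (dot_absle dotC dotDl dotZl dot_ge0 _ _)).
  by have := xi1 (u + v); have := xi1 u; lra.
rewrite ler_norml; apply/andP; split.
  rewrite -(mean2_cst (-1)); apply: mean2_le; [exact: bnd_cst|exact: bnd_gram|].
  by move=> u; have := h u; rewrite ler_norml => /andP[].
rewrite -[leRHS](mean2_cst 1); apply: mean2_le; [exact: bnd_gram|exact: bnd_cst|].
by move=> u; have := h u; rewrite ler_norml => /andP[].
Qed.

(** The value of the Toeplitz form on a grid of side [N] when the Gram matrix is a function [k] of
    the difference of positions. It is N^2 times the integral of [l] up to the boundary error N
    times [Cl l]. *)
Definition EN N (k : int * int -> R) (l : tpoly) : R := \sum_(p <- l) p.1 * (cnt N R p.2 * k p.2).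
Definition Cl (l : tpoly) : R := \sum_(p <- l) `|p.1| * (`|p.2.1| + `|p.2.2|)%N%:R.

Lemma EN_approx N (k : int * int -> R) (l : tpoly) : (forall v, `|k v| <= 1) ->
  `|N%:R ^+ 2 * (\sum_(p <- l) p.1 * k p.2) - EN N k l| <= N%:R * Cl l.
Proof.
move=> k1; rewrite /EN /Cl !mulr_sumr -sumrB (le_trans (ler_norm_sum _ _ _))//.
apply: ler_sum => p _.
have -> : N%:R ^+ 2 * (p.1 * k p.2) - p.1 * (cnt N R p.2 * k p.2) =
  (N%:R ^+ 2 - cnt N R p.2) * p.1 * k p.2 by ring.
rewrite !normrM mulrCA -mulrA [leLHS]mulrC -mulrA ler_wpM2l// mulrC.
rewrite -[leRHS]mulr1 ler_pM//; exact: cnt_bound.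
Qed.

(** Averaging over the base point [x] makes the scalar products depend on differences alone, by
    invariance of the mean; thus exact positivity emerges from approximate data. *)
Lemma EN_mean N (g : int * int -> int * int) (l : tpoly) :
  (forall v w, g (v - w) = g v - g w) ->
  mean2 (fun x => toep dot (@gpos N) l (fun i => xi (x + g (gpos i)))) = EN N (K \o g) l.
Proof.
move=> gB; rewrite /toep /EN.
have b1 i j (c : R) : bnd (fun x => c * dot (xi (x + g (@gpos N i))) (xi (x + g (@gpos N j)))).
  by apply: bndZ; exact: bnd_gram.
rewrite mean2_sum; last first.
  by move=> p; apply: bndZ; apply: bnd_sum => i; apply: bnd_sum => j; exact: b1.
apply: eq_bigr => p _; rewrite mean2Z; last first.
  by apply: bnd_sum => i; apply: bnd_sum => j; exact: b1.
congr (_ * _); rewrite mean2_sum; last by move=> i; apply: bnd_sum => j; exact: b1.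
rewrite /cnt mulr_suml; apply: eq_bigr => i _.
rewrite mean2_sum; last by move=> j; exact: b1.
rewrite mulr_suml; apply: eq_bigr => j _.
rewrite mean2Z; last exact: bnd_gram.
case: eqP => [<-|]; last by rewrite !mul0r.
congr (_ * _); rewrite /= /K -[RHS](mean2_shift (g (gpos j))); last exact: bnd_gram.
by congr mean2; apply/funext => x; rewrite gB -addrA [g (gpos j) + _]addrC subrK.
Qed.

Let bnd_toep N g l : bnd (fun x => toep dot (@gpos N) l (fun i => xi (x + g (gpos i)))).
Proof.
apply: bnd_sum => p; apply: bndZ; apply: bnd_sum => i; apply: bnd_sum => j.
by apply: bndZ; exact: bnd_gram.
Qed.

Lemma EE_ge0 l : (forall th, 0 <= eval l th) -> 0 <= EE l.
Proof.
move=> l0; apply: (@le_harmonic_le _ _ _ (Cl l)) => N.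
have h : 0 <= EN N.+1 K l.
  rewrite -(@EN_mean _ id)//= -[leLHS](mean2_cst 0); apply: mean2_le.
  - exact: bnd_cst.
  - exact: (@bnd_toep N.+1 id l).
  - by move=> x; apply: toep_ge0.
have := @EN_approx N.+1 K l K_le1; rewrite ler_norml -/(EE l) => /andP[h1 _].
have N0 : 0 < N.+1%:R :> R by rewrite ltr0n.
rewrite -(pmulr_rge0 _ (exprn_gt0 2 N0)).
rewrite [_ * _](_ : _ = N.+1%:R ^+ 2 * EE l + N.+1%:R * Cl l); first by lra.
by field; rewrite gt_eqF.
Qed.

Lemma EE_cat l l' : EE (l ++ l') = EE l + EE l'. Proof. by rewrite /EE big_cat. Qed.
Lemma EE_scl c l : EE (scl c l) = c * EE l.
Proof. by rewrite /EE /scl big_map mulr_sumr; apply: eq_bigr => p _; rewrite mulrA. Qed.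

Lemma EE_le l l' : (forall th, eval l th <= eval l' th) -> EE l <= EE l'.
Proof.
move=> h; have : 0 <= EE (l' ++ scl (-1) l).
  by apply: EE_ge0 => th; rewrite eval_cat eval_scl; have := h th; lra.
by rewrite EE_cat EE_scl; lra.
Qed.

Definition lcomp (g : int * int -> int * int) (l : tpoly) : tpoly (R := R) :=
  [seq (p.1, g p.2) | p <- l].

(** Both integrals are compared with the form [T] at base point 0: the copies [eta] have the Gram
    matrix of [xi], so [toep_close] applies and contributes 5/2 twice. Only the sup norm of [l]
    enters the bound, which therefore expresses closeness in total variation of the spectral measure
    and its image. *)
Lemma EE_gram g l s : (forall v w, g (v - w) = g v - g w) ->
  gramclose id -> gramclose g -> (forall th, `|eval l th| <= s) ->
  `|EE (lcomp g l) - EE l| <= 5 * kap * s.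
Proof.
move=> gB gid gg hs; rewrite /EE /lcomp big_map/=.
apply: (@le_harmonic_le _ _ _ (2 * Cl l)) => N.
pose T := toep dot (@gpos N.+1) l (fun i => xi (gpos i)).
have key h : (forall v w, h (v - w) = h v - h w) -> gramclose h ->
    `|EN N.+1 (K \o h) l - T| <= 5 / 2 * kap * s * N.+1%:R ^+ 2.
  move=> hB gh; rewrite -EN_mean//.
  have h1 x : `|toep dot (@gpos N.+1) l (fun i => xi (x + h (gpos i))) - T|
      <= 5 / 2 * kap * s * N.+1%:R ^+ 2.
    have [eta [e1 e2]] := gh x.
    have -> : T = toep dot (@gpos N.+1) l (fun i => eta (gpos i)).
      by apply: eq_bigr => p _; congr (_ * _); apply: eq_bigr => i _; apply: eq_bigr => j _; rewrite e1.
    have -> : N.+1%:R ^+ 2 = #|{: 'I_N.+1 * 'I_N.+1}|%:R :> R.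
      by rewrite card_prod !card_ord natrM expr2.
    by apply: toep_close => //; [exact: gpos_inj|move=> i; rewrite e1].
  rewrite ler_norml lerBrDr lerBlDr; apply/andP; split.
    rewrite -[leLHS]mean2_cst; apply: mean2_le => //; first exact: bnd_cst.
    by move=> x; have := h1 x; rewrite ler_norml => /andP[]; lra.
  rewrite -[leRHS]mean2_cst; apply: mean2_le => //; first exact: bnd_cst.
  by move=> x; have := h1 x; rewrite ler_norml => /andP[]; lra.
have k1 := key _ gB gg; have k2 := key id (fun _ _ => erefl) gid.
have a1 : `|N.+1%:R ^+ 2 * (\sum_(p <- l) p.1 * K (g p.2)) - EN N.+1 (K \o g) l| <= N.+1%:R * Cl l.
  by apply: EN_approx => v; exact: K_le1.
have a2 : `|N.+1%:R ^+ 2 * (\sum_(p <- l) p.1 * K p.2) - EN N.+1 (K \o id) l| <= N.+1%:R * Cl l.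
  by apply: EN_approx => v; exact: K_le1.
have N0 : 0 < N.+1%:R :> R by rewrite ltr0n.
rewrite -(ler_pM2l (exprn_gt0 2 N0)).
rewrite [leRHS](_ : _ = 5 * kap * s * N.+1%:R ^+ 2 + 2 * (N.+1%:R * Cl l)); last first.
  by field; rewrite gt_eqF.
rewrite -[X in X * `|_|]ger0_norm ?exprn_ge0// -normrM mulrBr.
move: a1 a2 k1 k2; rewrite !ler_norml => /andP[a1 a2] /andP[a3 a4] /andP[a5 a6] /andP[a7 a8].
by apply/andP; split; lra.
Qed.
End Mean.

(** * An inequality on the torus and relative property (T) *)

Section TorusInequality.
Context {R : realType}.
Implicit Types X Y e : R.

(* With the constant 1/20 the difference is a polynomial in [e] with nonnegative coefficients. *)
Lemma torus_hom X Y e : 0 <= X -> 0 <= Y -> 0 < e ->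
  (Y + e) * (2 * X + 10 * Y + 4 * e) / (X ^+ 2 - 6 * X * Y + 25 * Y ^+ 2 + 4 * X * e + 20 * Y * e + 4 * e ^+ 2)
  <= (X + e) / (X + Y + 2 * e) + 1 / 2 - 1 / 20 * ((X + Y) / (X + Y + 2 * e)).
Proof.
move=> X0 Y0 e0.
set D := X ^+ 2 - _ + _ + _ + _ + _.
have XY := mulr_ge0 X0 Y0; have Xe := mulr_ge0 X0 (ltW e0); have Ye := mulr_ge0 Y0 (ltW e0).
have D0 : 0 < D.
  rewrite /D; have : 0 <= (X - 3 * Y) ^+ 2 by exact: sqr_ge0.
  have : 0 < e ^+ 2 by rewrite exprn_gt0.
  have : 0 <= Y ^+ 2 by exact: sqr_ge0.
  by rewrite !expr2; nra.
have S0 : 0 < X + Y + 2 * e by lra.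
rewrite [leRHS](_ : _ = ((X + e) * 40 + 20 * (X + Y + 2 * e) - 2 * (X + Y)) / (40 * (X + Y + 2 * e))); last first.
  by field; rewrite gt_eqF.
rewrite ler_pdivrMr// mulrAC ler_pdivlMr; last by rewrite mulr_gt0.
have q0 : 0 <= X * (29 / 10 * X ^+ 2 - 205 / 10 * X * Y + 431 / 10 * Y ^+ 2).
  apply: (mulr_ge0 X0); have : 0 <= (X - 205 / 58 * Y) ^+ 2 by exact: sqr_ge0.
  have : 0 <= Y ^+ 2 by exact: sqr_ge0.
  by rewrite !expr2; nra.
have q1 : 0 <= e * (116 / 10 * X ^+ 2 - 24 / 10 * X * Y + 50 * Y ^+ 2).
  apply: (mulr_ge0 (ltW e0)); have : 0 <= (X - Y) ^+ 2 by exact: sqr_ge0.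
  have : 0 <= X ^+ 2 by exact: sqr_ge0.
  have : 0 <= Y ^+ 2 by exact: sqr_ge0.
  by rewrite !expr2; nra.
have q2 : 0 <= e ^+ 2 * (116 / 10 * X + 196 / 10 * Y).
  by apply: (mulr_ge0 (sqr_ge0 e)); lra.
have q3 : 0 <= Y ^+ 3 by rewrite exprn_ge0.
rewrite -subr_ge0 [leRHS](_ : _ = 20 * (X * (29 / 10 * X ^+ 2 - 205 / 10 * X * Y + 431 / 10 * Y ^+ 2)
   + 25 / 10 * Y ^+ 3 + e * (116 / 10 * X ^+ 2 - 24 / 10 * X * Y + 50 * Y ^+ 2)
   + e ^+ 2 * (116 / 10 * X + 196 / 10 * Y))); last by rewrite /D; field.
lra.
Qed.

(** Here X = 2 - 2 cos a and Y = 2 - 2 cos b, while Xp and Xm are the values of X at a + 2 b and a -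
    2 b. Near the origin their sum and product are approximately 2 X + 8 Y and (X - 4 Y)^2;
    inserting these values gives the left side of [torus_hom], with denominator D. Passing to the
    true values costs a factor 1 - (X + Y) in the denominator, and in the end 3 (X + Y). *)
Lemma torus_ineq X Y e Xp Xm : 0 <= X -> 0 <= Y -> X <= 4 -> Y <= 4 -> 0 < e -> 0 <= Xp -> 0 <= Xm ->
  Xp + Xm = 2 * X + 2 * (Y * (4 - Y)) - X * (Y * (4 - Y)) -> Xp * Xm = (X - Y * (4 - Y)) ^+ 2 ->
  3 / 2 + 1 / 20 * ((X + Y) / (X + Y + 2 * e)) - 4 * (X + Y) <=
  (X + e) / (X + Y + 2 * e) + (Xp + e) / (Xp + Y + 2 * e) + (Xm + e) / (Xm + Y + 2 * e).
Proof.
move=> X0 Y0 X4 Y4 e0 Xp0 Xm0 hS hP.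
have S0 : 0 < X + Y + 2 * e by lra.
have Sp0 : 0 < Xp + Y + 2 * e by lra.
have Sm0 : 0 < Xm + Y + 2 * e by lra.
have s1 : (X + Y) / (X + Y + 2 * e) <= 1 by rewrite ler_pdivrMr//; lra.
have s0 : 0 <= (X + Y) / (X + Y + 2 * e) by apply: divr_ge0; lra.
have f0 : 0 <= (X + e) / (X + Y + 2 * e) by apply: divr_ge0; lra.
have f1 : (X + e) / (X + Y + 2 * e) <= 1 by rewrite ler_pdivrMr//; lra.
(* Away from the origin the left side is negative, owing to the coefficient 4. *)
have [big|small] := lerP (1 / 2) (X + Y).
  have : 0 <= (Xp + e) / (Xp + Y + 2 * e) by apply: divr_ge0; lra.
  have : 0 <= (Xm + e) / (Xm + Y + 2 * e) by apply: divr_ge0; lra.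
  lra.
have XY := mulr_ge0 X0 Y0; have Xe := mulr_ge0 X0 (ltW e0); have Ye := mulr_ge0 Y0 (ltW e0).
have YY : 0 <= Y * Y by rewrite mulr_ge0.
have hB := torus_hom X0 Y0 e0.
set D := X ^+ 2 - _ + _ + _ + _ + _ in hB.
have De : D = (X - 3 * Y) ^+ 2 + 16 * (Y * Y) + 4 * (X * e) + 20 * (Y * e) + 4 * (e * e).
  by rewrite /D; ring.
have D0 : 0 < D.
  have : 0 < e * e by rewrite mulr_gt0.
  have : 0 <= (X - 3 * Y) ^+ 2 by exact: sqr_ge0.
  by rewrite De; lra.
set B := _ / D in hB.
have B0 : 0 <= B by apply: divr_ge0; [apply: mulr_ge0; lra|exact: ltW].
have B1 : B <= 3 / 2 by lra.
pose Dt := (Xp + Y + 2 * e) * (Xm + Y + 2 * e).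
pose Nt := (Xp + Y + 2 * e) + (Xm + Y + 2 * e).
have Dt0 : 0 < Dt by rewrite mulr_gt0.
have NtN : Nt <= 2 * X + 10 * Y + 4 * e.
  have : X * Y * Y <= X * Y * 4 by rewrite ler_wpM2l.
  by rewrite /Nt; lra.
have DtD : (1 - (X + Y)) * D <= Dt.
  have h1 : 10 * (Y * Y + 2 * (Y * e)) <= D.
    have : 0 <= (X - 3 * Y) ^+ 2 by exact: sqr_ge0.
    have : 0 <= e * e by rewrite mulr_ge0 ?ltW.
    by rewrite De; lra.
  have h2 : 16 * (Y * Y) <= D.
    have : 0 <= (X - 3 * Y) ^+ 2 by exact: sqr_ge0.
    have : 0 <= e * e by rewrite mulr_ge0 ?ltW.
    by rewrite De; lra.
  have e1 : Dt = D + 2 * (Y * Y) * (X - 4 * Y) + (Y * Y) * (Y * Y)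
      + (- 2 * (Y * Y) - 4 * (X * Y) + X * (Y * Y)) * (Y + 2 * e).
    have -> : Dt = Xp * Xm + (Xp + Xm) * (Y + 2 * e) + (Y + 2 * e) ^+ 2 by rewrite /Dt; ring.
    by rewrite hS hP /D; ring.
  have p1 := ler_wpM2l Y0 h1; have p2 := ler_wpM2l Y0 h2; have p3 := ler_wpM2l X0 h1.
  have r1 : 0 <= X * (Y * Y) by rewrite mulr_ge0.
  have r2 : 0 <= (Y * Y) * (Y * Y) by rewrite mulr_ge0.
  have r3 : 0 <= X * (Y * Y) * (Y + 2 * e) by apply: mulr_ge0 => //; lra.
  have r4 : 0 <= X * D by rewrite mulr_ge0// ltW.
  have r5 : 0 <= Y * D by rewrite mulr_ge0// ltW.
  rewrite e1; move: p1 p2 p3 r1 r2 r3 r4 r5; lra.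
have -> : (Xp + e) / (Xp + Y + 2 * e) = 1 - (Y + e) / (Xp + Y + 2 * e).
  by field; rewrite gt_eqF.
have -> : (Xm + e) / (Xm + Y + 2 * e) = 1 - (Y + e) / (Xm + Y + 2 * e).
  by field; rewrite gt_eqF.
have hsum : (Y + e) / (Xp + Y + 2 * e) + (Y + e) / (Xm + Y + 2 * e) = (Y + e) * Nt / Dt.
  by rewrite /Nt /Dt; field; rewrite !gt_eqF.
have key : (Y + e) * Nt / Dt <= B + 3 * (X + Y).
  rewrite ler_pdivrMr//.
  apply: (@le_trans _ _ (B * D)).
    rewrite /B divfK ?gt_eqF// ler_wpM2l//; lra.
  have c1 : B <= (B + 3 * (X + Y)) * (1 - (X + Y)).
    have : 0 <= (X + Y) * (3 - B - 3 * (X + Y)) by apply: mulr_ge0; lra.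
    lra.
  apply: (@le_trans _ _ ((B + 3 * (X + Y)) * (1 - (X + Y)) * D)); first by rewrite (ler_wpM2r (ltW D0)).
  by rewrite -mulrA ler_wpM2l//; lra.
lra.
Qed.
End TorusInequality.

(** * Trigonometric polynomials and approximation of the resolvent *)

Section TrigPolynomials.
Context {R : realType}.
Implicit Types (F G : R * R -> R) (th : R * R).

Definition istp F := exists l, forall th, eval l th = F th.

Lemma istp_cst c : istp (fun _ => c).
Proof. by exists (tcst c) => th; rewrite eval_cst. Qed.

Lemma istp_cos (v : int * int) : istp (fun th => cos (ang v th)).
Proof. by exists [:: (1, v)] => th; rewrite /eval big_seq1/= mul1r. Qed.

Lemma istpD F G : istp F -> istp G -> istp (fun th => F th + G th).
Proof. by move=> [l hl] [k hk]; exists (l ++ k) => th; rewrite eval_cat hl hk. Qed.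

Lemma istpZ c F : istp F -> istp (fun th => c * F th).
Proof. by move=> [l hl]; exists (scl c l) => th; rewrite eval_scl hl. Qed.

Lemma istpM F G : istp F -> istp G -> istp (fun th => F th * G th).
Proof.
move=> [l hl] [k hk].
exists ([seq (p.1 * q.1 / 2, p.2 + q.2) | p <- l, q <- k] ++
        [seq (p.1 * q.1 / 2, p.2 - q.2) | p <- l, q <- k]) => th.
rewrite eval_cat -hl -hk /eval !big_allpairs_dep big_distrlr/= -big_split/=.
apply: eq_bigr => p _; rewrite -big_split/=; apply: eq_bigr => q _.
by rewrite angD angB cosD cosB; field.
Qed.

Lemma istp_ext F G : istp F -> (forall th, F th = G th) -> istp G.
Proof. by move=> [l hl] h; exists l => th; rewrite hl h. Qed.

Definition X1 th : R := 2 - 2 * cos th.1.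
Definition X2 th : R := 2 - 2 * cos th.2.

Lemma X1_itv th : 0 <= X1 th <= 4.
Proof. by rewrite /X1; have := cos_le1 th.1; have := cos_geN1 th.1; lra. Qed.
Lemma X2_itv th : 0 <= X2 th <= 4.
Proof. by rewrite /X2; have := cos_le1 th.2; have := cos_geN1 th.2; lra. Qed.

Lemma istp_X1 : istp X1.
Proof.
apply: (istp_ext (istpD (istp_cst 2) (istpZ (-2) (istp_cos (1, 0))))) => th.
by rewrite /ang/= mul1r mul0r addr0 /X1; ring.
Qed.
Lemma istp_X2 : istp X2.
Proof.
apply: (istp_ext (istpD (istp_cst 2) (istpZ (-2) (istp_cos (0, 1))))) => th.
by rewrite /ang/= mul1r mul0r add0r /X2; ring.
Qed.

(** Partial sum of the geometric series of 1 / (D - c). It is a polynomial in [c], which turns the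
    rational test functions into trigonometric polynomials. *)
Definition geo (D : R) (J : nat) (c : R) : R := \sum_(j < J) D^-1 * (c / D) ^+ j.

Lemma geoE D J c : D != 0 -> D - c != 0 -> geo D J c = (1 - (c / D) ^+ J) / (D - c).
Proof.
move=> D0 Dc; apply: (mulIf Dc); rewrite divfK//.
elim: J => [|J IH]; first by rewrite /geo big_ord0 mul0r expr0 subrr.
rewrite /geo big_ord_recr/= mulrDl -/(geo D J c) IH exprS.
by field.
Qed.

Lemma istp_geo D J : istp (fun th => geo D J (4 - (X1 th + X2 th))).
Proof.
have hc : istp (fun th => (4 - (X1 th + X2 th)) / D).
  apply: (istp_ext (istpZ D^-1 (istpD (istp_cst 4) (istpZ (-1) (istpD istp_X1 istp_X2))))) => th.
  by rewrite mulN1r mulrC.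
have hp j : istp (fun th => ((4 - (X1 th + X2 th)) / D) ^+ j).
  elim: j => [|j IH]; first exact: (istp_ext (istp_cst 1)).
  by apply: (istp_ext (istpM hc IH)) => th; rewrite exprS.
elim: J => [|J IH].
  by apply: (istp_ext (istp_cst 0)) => th; rewrite /geo big_ord0.
apply: (istp_ext (istpD IH (istpZ D^-1 (hp J)))) => th.
by rewrite /geo big_ord_recr.
Qed.

(** Expansion around s = 4 gives |4 - s| <= 4 < 4 + 2 e on the whole range [0, 8] of X1 + X2, so the
    series converges uniformly there. *)
Lemma resolvent_approx e eta : 0 < e -> 0 < eta -> exists J, forall s, 0 <= s <= 8 ->
  `|geo (4 + 2 * e) J (4 - s) - (s + 2 * e)^-1| <= eta.
Proof.
move=> e0 eta0; pose D := 4 + 2 * e.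
have D0 : 0 < D by rewrite /D; lra.
have D4 : 4 < D by rewrite /D; lra.
have r0 : 0 <= 4 / D by rewrite divr_ge0 ?ltW.
have r1 : 4 / D < 1 by rewrite ltr_pdivrMr// mul1r.
have : (4 / D) ^+ J @[J --> \oo] --> (0 : R) by apply: cvg_expr; rewrite ger0_norm.
have ee : 0 < eta * (2 * e) by rewrite !mulr_gt0.
move=> /cvgr0Pnorm_lt /(_ _ ee) [J _ /(_ J (leqnn J)) hJ].
exists J => s /andP[s0 s8].
have Ds : D - (4 - s) = s + 2 * e by rewrite /D; ring.
have sp : 0 < s + 2 * e by lra.
have -> : geo (4 + 2 * e) J (4 - s) - (s + 2 * e)^-1 = - (((4 - s) / D) ^+ J / (s + 2 * e)).
  by rewrite geoE -/D ?Ds ?gt_eqF// mulrBl mul1r; ring.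
rewrite normrN normrM normrX (@ger0_norm _ (s + 2 * e)^-1) ?invr_ge0; last exact: ltW.
rewrite ler_pdivrMr//; apply: (@le_trans _ _ ((4 / D) ^+ J)).
  rewrite normrM (@ger0_norm _ D^-1) ?invr_ge0 ?(ltW D0)//.
  have iD : 0 <= D^-1 by rewrite invr_ge0 ltW.
  apply: lerXn2r; rewrite ?nnegrE; [exact: mulr_ge0|exact: mulr_ge0|].
  by apply: (ler_wpM2r iD); rewrite ler_norml; apply/andP; split; lra.
rewrite ger0_norm in hJ; last by rewrite exprn_ge0.
apply: (le_trans (ltW hJ)); rewrite (ler_wpM2l (ltW eta0))//; lra.
Qed.

Lemma norm_sin_mul (k : nat) (x : R) : `|sin (k%:R * x)| <= k%:R * `|sin x|.
Proof.
elim: k => [|k IH]; first by rewrite !mul0r sin0 normr0.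
rewrite -natr1 !mulrDl !mul1r sinD (le_trans (ler_normD _ _))// !normrM.
rewrite lerD//.
  by apply: le_trans IH; rewrite ler_piMr// cos_max.
by rewrite ler_piMl// cos_max.
Qed.

Lemma norm_sin_mulz (k : int) (x : R) : `|sin (k%:~R * x)| <= `|k|%:~R * `|sin x|.
Proof.
case: k => k; first exact: norm_sin_mul.
by rewrite NegzE mulrNz mulNr sinN !normrN; exact: norm_sin_mul.
Qed.

Lemma cos_half (x : R) : 2 - 2 * cos x = 4 * sin (x / 2) ^+ 2.
Proof.
have {1}-> : x = (x / 2) *+ 2 by rewrite -mulr_natr divfK.
by rewrite cos_mulr2n cos2sin2; ring.
Qed.

(** Half-angle formula, |sin (k x)| <= |k| |sin x|, and the Cauchy-Schwarz inequality. *)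
Lemma wave_bound (v : int * int) th :
  2 - 2 * cos (ang v th) <= (v.1%:~R ^+ 2 + v.2%:~R ^+ 2) * (X1 th + X2 th).
Proof.
rewrite /X1 /X2 !cos_half.
have -> : ang v th / 2 = v.1%:~R * (th.1 / 2) + v.2%:~R * (th.2 / 2) by rewrite /ang; field.
have := norm_sin_mulz v.1 (th.1 / 2); have := norm_sin_mulz v.2 (th.2 / 2).
set a := v.1%:~R * _; set b := v.2%:~R * _; set p := sin (th.1 / 2); set q := sin (th.2 / 2).
move=> hb ha.
have hab : `|sin (a + b)| <= `|v.1|%:~R * `|p| + `|v.2|%:~R * `|q|.
  rewrite sinD (le_trans (ler_normD _ _))// !normrM lerD//.
    by apply: le_trans ha; rewrite ler_piMr// cos_max.
  by apply: le_trans hb; rewrite ler_piMl// cos_max.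
have h2 : sin (a + b) ^+ 2 <= (`|v.1|%:~R * `|p| + `|v.2|%:~R * `|q|) ^+ 2.
  by rewrite -real_normK ?num_real// lerXn2r// nnegrE ?(le_trans _ hab).
have n1 : (`|v.1|%:~R : R) ^+ 2 = v.1%:~R ^+ 2 by rewrite intr_norm real_normK ?num_real.
have n2 : (`|v.2|%:~R : R) ^+ 2 = v.2%:~R ^+ 2 by rewrite intr_norm real_normK ?num_real.
rewrite -n1 -n2 -(real_normK (num_real p)) -(real_normK (num_real q)).
have := sqr_ge0 (`|v.1|%:~R * `|q| - `|v.2|%:~R * `|p| : R).
move: h2; rewrite !expr2; nra.
Qed.

(** The expression Y (4 - Y) is 2 - 2 cos (2 b) for Y = 2 - 2 cos b. *)
Lemma shear_sum (a b : R) :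
  (2 - 2 * cos (a + 2 * b)) + (2 - 2 * cos (a - 2 * b)) =
  2 * (2 - 2 * cos a) + 2 * ((2 - 2 * cos b) * (4 - (2 - 2 * cos b)))
   - (2 - 2 * cos a) * ((2 - 2 * cos b) * (4 - (2 - 2 * cos b))).
Proof.
rewrite cosD cosB.
have -> : cos (2 * b) = cos b ^+ 2 *+ 2 - 1 by rewrite mulr_natl cos_mulr2n.
ring.
Qed.

Lemma shear_prod (a b : R) :
  (2 - 2 * cos (a + 2 * b)) * (2 - 2 * cos (a - 2 * b)) =
  ((2 - 2 * cos a) - (2 - 2 * cos b) * (4 - (2 - 2 * cos b))) ^+ 2.
Proof.
rewrite cosD cosB.
transitivity (4 * (cos a - cos (2 * b)) ^+ 2).
  have ha := sin2cos2 a; have hb := sin2cos2 (2 * b).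
  rewrite [LHS](_ : _ = 4 * (1 - 2 * (cos a * cos (2 * b)) + cos a ^+ 2 * cos (2 * b) ^+ 2
     - sin a ^+ 2 * sin (2 * b) ^+ 2)); last by ring.
  by rewrite ha hb; ring.
have -> : cos (2 * b) = cos b ^+ 2 *+ 2 - 1 by rewrite mulr_natl cos_mulr2n.
ring.
Qed.
End TrigPolynomials.

Definition wmap (v : int * int) : int * int := (- v.2, v.1).
Definition smap (c : int) (v : int * int) : int * int := (v.1, v.2 + c * v.1).

Lemma wmapB v w : wmap (v - w) = wmap v - wmap w.
Proof. by case: v w => [a b] [c d]; congr pair; rewrite /= opprB addrC opprK. Qed.
Lemma smapB c v w : smap c (v - w) = smap c v - smap c w.
Proof.
case: v w => [a b] [a' b']; congr pair => /=.
by rewrite mulrBr opprD addrACA.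
Qed.

Lemma eval_lcomp_w (R : realType) (l : tpoly (R := R)) th :
  eval (lcomp wmap l) th = eval l (th.2, - th.1).
Proof.
rewrite /eval /lcomp big_map; apply: eq_bigr => p _; congr (_ * cos _).
by rewrite /ang /wmap/= intrN; ring.
Qed.

Lemma eval_lcomp_s (R : realType) c (l : tpoly (R := R)) th :
  eval (lcomp (smap c) l) th = eval l (th.1 + c%:~R * th.2, th.2).
Proof.
rewrite /eval /lcomp big_map; apply: eq_bigr => p _; congr (_ * cos _).
by rewrite /ang /smap/= intrD intrM; ring.
Qed.

(** * Relative property (T) for an approximately equivariant family *)

Section RelativeT.
Context {R : realType} (E : lmodType R) (dot : E -> E -> R).
Hypothesis dotC : forall x y, dot x y = dot y x.
Hypothesis dotDl : forall x y z, dot (x + y) z = dot x z + dot y z.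
Hypothesis dotZl : forall c x y, dot (c *: x) y = c * dot x y.
Hypothesis dot_ge0 : forall x, 0 <= dot x x.
Variables (xi : int * int -> E) (kap : R).
Hypothesis kap0 : 0 < kap.
Hypothesis kap1 : kap <= 1.
Hypothesis xi1 : forall v, dot (xi v) (xi v) <= 1.
Hypothesis gid : gramclose dot xi kap id.
Hypothesis gw : gramclose dot xi kap wmap.
Hypothesis gs : gramclose dot xi kap (smap 2).
Hypothesis gsN : gramclose dot xi kap (smap (- 2)).
Notation sq x := (dot (x) (x)).
Hypothesis xi_e1 : sq (xi (1, 0) - xi 0) <= kap ^+ 2.
Hypothesis xi_e2 : sq (xi (0, 1) - xi 0) <= kap ^+ 2.

Notation EE := (EE dot xi).
Notation K := (K dot xi).

Let dotDr x y z : dot x (y + z) = dot x y + dot x z.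
Proof. by rewrite dotC dotDl dotC [dot z x]dotC. Qed.
Let dotNl x y : dot (- x) y = - dot x y.
Proof. by rewrite -scaleN1r dotZl mulN1r. Qed.
Let dotNr x y : dot x (- y) = - dot x y.
Proof. by rewrite dotC dotNl dotC. Qed.
Let sqB x y : sq (x - y) = sq x - 2 * dot x y + sq y.
Proof. by rewrite !(dotDl, dotDr, dotNl, dotNr) (dotC y x); ring. Qed.

Let sq3 x y z : sq (x + y + z) <= 3 * (sq x + sq y + sq z).
Proof.
have := dot_ge0 (x - y); have := dot_ge0 (x - z); have := dot_ge0 (y - z).
rewrite !sqB !(dotDl, dotDr) (dotC y x) (dotC z x) (dotC z y); lra.
Qed.

Let bg f g := bnd_gram dotC dotDl dotZl dot_ge0 xi1 f g.

Let bsq v : bnd (fun u => sq (xi (u + v) - xi u)).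
Proof.
under eq_fun do rewrite sqB.
apply: bndD; last exact: (bg id id).
apply: bndD; first exact: (bg (fun u => u + v) (fun u => u + v)).
under eq_fun do rewrite -mulNr.
exact: bndZ (bg (fun u => u + v) id).
Qed.

Lemma mean_sq v : mean2 (fun u => sq (xi (u + v) - xi u)) = 2 * K 0 - 2 * K v.
Proof.
under eq_fun do rewrite sqB -mulNr.
have b1 := bg (fun u => u + v) (fun u => u + v).
have b2 := bndZ (-2) (bg (fun u => u + v) id).
rewrite mean2D; [|exact: bndD|exact: (bg id id)].
rewrite mean2D// mean2Z; last exact: (bg _ id).
rewrite (mean2_shift v (bg id id)) -/(K v).
have -> : mean2 (fun u => sq (xi u)) = K 0 by congr mean2; apply/funext => u; rewrite addr0.
ring.
Qed.

(** The copy [eta] carries a displacement at the origin to every base point, hence to the mean;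
    [Kge] is the converse passage. *)
Let Kle (v : int * int) : sq (xi v - xi 0) <= kap ^+ 2 -> 2 * K 0 - 2 * K v <= 9 * kap.
Proof.
move=> hv; rewrite -mean_sq -[leRHS]mean2_cst; apply: mean2_le; [exact: bsq|exact: bnd_cst|].
move=> u; have [eta [e1 e2]] := gid u.
have -> : xi (u + v) - xi u = (xi (u + v) - eta v) + (eta v - eta 0) - (xi (u + 0) - eta 0).
  by rewrite addr0 addrA subrK opprB addrA subrK.
apply: (le_trans (sq3 _ _ _)).
have h1 := e2 v; have h2 := e2 0.
have h3 : sq (eta v - eta 0) <= kap ^+ 2 by rewrite sqB !e1 -sqB.
have h4 : sq (- (xi (u + 0) - eta 0)) <= kap ^+ 2 by rewrite dotNl dotNr opprK.
have h5 : kap ^+ 2 <= kap by rewrite expr2 ler_piMr// ltW.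
lra.
Qed.

Let Kge (v : int * int) : sq (xi v - xi 0) <= 3 * (2 * K 0 - 2 * K v) + 6 * kap.
Proof.
have b1 : bnd (fun u => 3 * sq (xi (u + v) - xi u)) by apply: bndZ.
rewrite -mean_sq -mean2Z// -(mean2_cst (6 * kap)) -mean2D//; last exact: bnd_cst.
rewrite -[leLHS]mean2_cst; apply: mean2_le; [exact: bnd_cst|apply: bndD => //; exact: bnd_cst|].
move=> u; have [eta [e1 e2]] := gid u.
have -> : sq (xi v - xi 0) = sq (eta v - eta 0) by rewrite !sqB !e1.
have -> : eta v - eta 0 = - (xi (u + v) - eta v) + (xi (u + v) - xi u) + (xi (u + 0) - eta 0).
  by rewrite addr0 opprB !subrKA.
apply: (le_trans (sq3 _ _ _)).
have h1 := e2 v; have h2 := e2 0.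
have h4 : sq (- (xi (u + v) - eta v)) <= kap ^+ 2 by rewrite dotNl dotNr opprK.
have h5 : kap ^+ 2 <= kap by rewrite expr2 ler_piMr// ltW.
lra.
Qed.

Let EEle l l' := @EE_le R E dot dotC dotDl dotZl dot_ge0 xi xi1 l l'.
Let EEgram := @EE_gram R E dot dotC dotDl dotZl dot_ge0 xi kap kap0 xi1.

Let EEcst (c : R) : EE (tcst c) = c * K 0.
Proof. by rewrite /EE big_seq1. Qed.

Let K0_itv : 0 <= K 0 <= 1.
Proof.
have := @K_le1 R E dot dotC dotDl dotZl dot_ge0 xi xi1 0; rewrite ler_norml => /andP[_ ->].
have := @EE_ge0 R E dot dotC dotDl dotZl dot_ge0 xi xi1 (tcst 1); rewrite EEcst mul1r => -> //.
by move=> th; rewrite eval_cst.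
Qed.

(* The test function (X1 + e) / (X1 + X2 + 2 e) approximates the indicator of a sector around the
   first axis; it is complementary to its rotation, while its average over the two shears exceeds
   its own value away from the origin. Hence the spectral measure concentrates at the origin. *)
Lemma relT (v : int * int) : sq (xi v - xi 0) <= 100 * (500 * kap).
Proof.
have k0 : 0 < kap := kap0; have k1 : kap <= 1 := kap1.
pose L : R := v.1%:~R ^+ 2 + v.2%:~R ^+ 2.
have L0 : 0 <= L by rewrite addr_ge0// sqr_ge0.
(* The choice e L <= 1 turns x <= min(4, L s), valid for x = 2 - 2 cos (ang v th) and s = X1 + X2,
   into x <= 6 s / (s + 2 e). This is how the bound becomes independent of [v]. *)
pose e : R := (L + 1)^-1.
have e0 : 0 < e by rewrite invr_gt0; lra.
have eL : e * L <= 1 by rewrite mulrC ler_pdivrMr; lra.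
have e1 : e <= 1 by rewrite invf_le1; lra.
(* X1 + e and X1 + X2 are at most 9, so this precision for the resolvent leaves an error at most
   [kap] in [P] and [Q]. *)
have eta0 : 0 < kap / 9 by exact: divr_gt0.
have [J hJ] := resolvent_approx e0 eta0.
pose r th : R := geo (4 + 2 * e) J (4 - (X1 th + X2 th)).
have rE th : `|r th - (X1 th + X2 th + 2 * e)^-1| <= kap / 9.
  by apply: hJ; have := X1_itv th; have := X2_itv th; lra.
pose f (th : R * R) : R := (X1 th + e) / (X1 th + X2 th + 2 * e).
pose P th : R := (X1 th + e) * r th.
pose Q th : R := (X1 th + X2 th) * r th.
have PE th : `|P th - f th| <= kap.
  have [/andP[a1 a2] /andP[a3 a4]] := (X1_itv th, X2_itv th).
  rewrite /P /f -mulrBr normrM ger0_norm; last by lra.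
  apply: (@le_trans _ _ (9 * (kap / 9))); last by lra.
  by apply: ler_pM => //; lra.
have QE th : `|Q th - (X1 th + X2 th) / (X1 th + X2 th + 2 * e)| <= kap.
  have [/andP[a1 a2] /andP[a3 a4]] := (X1_itv th, X2_itv th).
  rewrite /Q -mulrBr normrM ger0_norm; last by lra.
  apply: (@le_trans _ _ (9 * (kap / 9))); last by lra.
  by apply: ler_pM => //; lra.
have f01 th : 0 <= f th <= 1.
  have [/andP[a1 a2] /andP[a3 a4]] := (X1_itv th, X2_itv th).
  by rewrite /f divr_ge0 ?ler_pdivrMr; lra.
have [p hp] : istp P.
  apply: istpM; last exact: istp_geo.
  by apply: istpD; [exact: istp_X1|exact: istp_cst].
have [q hq] : istp Q.
  apply: istpM; last exact: istp_geo.
  by apply: istpD; [exact: istp_X1|exact: istp_X2].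
pose ls : tpoly (R := R) := [:: (2, 0); (-2, (1, 0)); (2, 0); (-2, (0, 1))].
have hls th : eval ls th = X1 th + X2 th.
  rewrite /eval !big_cons big_nil /ang/= !mul0r !mul1r !addr0 !add0r cos0 /X1 /X2; ring.
have EEs : EE ls <= 18 * kap.
  rewrite /EE !big_cons big_nil/=.
  by have := Kle xi_e1; have := Kle xi_e2; lra.
have psup th : `|eval p th| <= 2.
  rewrite hp; have := PE th; have := f01 th; rewrite !ler_norml => /andP[a1 a2] /andP[a3 a4].
  by apply/andP; split; lra.
have Ew := EEgram wmapB gid gw psup.
have Es := EEgram (smapB 2) gid gs psup.
have EsN := EEgram (smapB (-2)) gid gsN psup.
have [/andP[K00 K01]] := K0_itv.
(* [f] and its rotation add up to 1, so near-invariance bounds the integral of [p] by K 0 / 2 + 6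
   kap. *)
have up : EE (p ++ lcomp wmap p) <= EE (tcst (1 + 2 * kap)).
  apply: EEle => th; rewrite eval_cat eval_cst eval_lcomp_w !hp.
  have h1 := PE th; have h2 := PE (th.2, - th.1).
  have : f th + f (th.2, - th.1) = 1.
    have -> : f (th.2, - th.1) = (X2 th + e) / (X2 th + X1 th + 2 * e).
      by rewrite /f /X1 /X2 /= cosN.
    have [/andP[a1 a2] /andP[a3 a4]] := (X1_itv th, X2_itv th).
    rewrite /f; field; rewrite gt_eqF//; lra.
  by move: h1 h2; rewrite !ler_norml => /andP[b1 b2] /andP[b3 b4]; lra.
(* Integrated form of [torus_ineq]: the first three terms on the right have integral at most about K
   0 / 2 each, so 3/2 cancels and the integral of [q], which measures the mass away from the origin,
   is at most 2280 kap. *)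
have dn : EE (scl (1 / 20) q ++ tcst (3 / 2)) <=
    EE (p ++ lcomp (smap 2) p ++ lcomp (smap (-2)) p ++ scl 4 ls ++ tcst (4 * kap)).
  apply: EEle => th; rewrite !eval_cat !eval_cst !eval_scl !eval_lcomp_s !hp hq hls.
  have [/andP[a1 a2] /andP[a3 a4]] := (X1_itv th, X2_itv th).
  pose tp := (th.1 + 2%:~R * th.2, th.2); pose tm := (th.1 + (-2)%:~R * th.2, th.2).
  have /andP[c1 _] := X1_itv tp; have /andP[c2 _] := X1_itv tm.
  have := @torus_ineq R (X1 th) (X2 th) e (X1 tp) (X1 tm) a1 a3 a2 a4 e0 c1 c2.
  have tmE : tm.1 = th.1 - 2 * th.2 by rewrite /tm/= mulrNz mulNr.
  have -> : X1 tp + X1 tm = 2 * X1 th + 2 * (X2 th * (4 - X2 th)) - X1 th * (X2 th * (4 - X2 th)).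
    by rewrite /X1 tmE /X2; exact: shear_sum.
  have -> : X1 tp * X1 tm = (X1 th - X2 th * (4 - X2 th)) ^+ 2.
    by rewrite /X1 tmE /X2; exact: shear_prod.
  move=> /(_ erefl erefl).
  have h1 := PE th; have h2 := PE tp; have h3 := PE tm; have h4 := QE th.
  move: h1 h2 h3 h4; rewrite !ler_norml => /andP[d1 d2] /andP[d3 d4] /andP[d5 d6] /andP[d7 d8].
  rewrite -/tp -/tm; move: d1 d3 d5 d7 d8; rewrite /f.
  rewrite -[X2 tp]/(X2 th) -[X2 tm]/(X2 th).
  move: ((X1 th + e) / _) ((X1 tp + e) / _) ((X1 tm + e) / _) ((X1 th + X2 th) / _).
  move: (P th) (P tp) (P tm) (Q th) => p1 p2 p3 q1 f1 f2 f3 s1 d1 d3 d5 d7 d8.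
  by lra.
have fin : EE [:: (2, 0); (-2, v)] <= EE (scl 6 q ++ tcst (6 * kap)).
  apply: EEle => th; rewrite eval_cat eval_cst eval_scl hq.
  rewrite [leLHS](_ : _ = 2 - 2 * cos (ang v th)); last first.
    by rewrite /eval !big_cons big_nil /ang/= !mul0r addr0 cos0; ring.
  have [/andP[a1 a2] /andP[a3 a4]] := (X1_itv th, X2_itv th).
  have := QE th; rewrite ler_norml => /andP[d1 _].
  have x4 : 2 - 2 * cos (ang v th) <= 4 by have := cos_geN1 (ang v th); lra.
  have xL := wave_bound v th; rewrite -/L in xL.
  suff : 2 - 2 * cos (ang v th) <= 6 * ((X1 th + X2 th) / (X1 th + X2 th + 2 * e)) by lra.
  move: x4 xL; set x := 2 - 2 * cos _; set s := X1 th + X2 th => x4 xL.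
  have s0 : 0 <= s by rewrite /s; lra.
  rewrite mulrA ler_pdivlMr; last by lra.
  have h1 : s * x <= s * 4 by apply: ler_wpM2l.
  have h2 : e * x <= e * (L * s) by apply: ler_wpM2l => //; exact: ltW.
  have h3 : e * L * s <= 1 * s by apply: ler_wpM2r.
  lra.
move: up dn fin; rewrite !EE_cat !EE_scl !EEcst => up dn fin.
have Ev : EE [:: (2, 0); (-2, v)] = 2 * K 0 - 2 * K v.
  by rewrite /EE !big_cons big_nil/=; ring.
(* Final count: 2 K 0 - 2 K v is at most 13686 kap, and three times this plus 6 kap remains below
   50000 kap. *)
have := Kge v; rewrite -Ev.
move: Ew Es EsN; rewrite !ler_norml => /andP[w1 w2] /andP[s1 s2] /andP[n1 n2].
have kK : kap * K 0 <= kap by rewrite ler_piMr// ltW.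
have kK0 : 0 <= kap * K 0 by rewrite mulr_ge0// ltW.
lra.
Qed.
End RelativeT.

(** * The induced quasi-representation *)

Section Frobenius.
Context {R : realType} {m : nat}.
Implicit Types X Y Z : 'M[R]_m.

Definition fdot X Y : R := \sum_i \sum_j X i j * Y i j.

Lemma fdotC X Y : fdot X Y = fdot Y X.
Proof. by apply: eq_bigr => i _; apply: eq_bigr => j _; rewrite mulrC. Qed.
Lemma fdotDl X Y Z : fdot (X + Y) Z = fdot X Z + fdot Y Z.
Proof.
rewrite /fdot -big_split; apply: eq_bigr => i _; rewrite -big_split; apply: eq_bigr => j _.
by rewrite mxE mulrDl.
Qed.
Lemma fdotZl c X Y : fdot (c *: X) Y = c * fdot X Y.
Proof.
rewrite /fdot mulr_sumr; apply: eq_bigr => i _; rewrite mulr_sumr; apply: eq_bigr => j _.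
by rewrite mxE mulrA.
Qed.
Lemma fdot_ge0 X : 0 <= fdot X X.
Proof. by apply: sumr_ge0 => i _; apply: sumr_ge0 => j _; rewrite -expr2 sqr_ge0. Qed.
Lemma fdotDr X Y Z : fdot X (Y + Z) = fdot X Y + fdot X Z.
Proof. by rewrite fdotC fdotDl fdotC [fdot Z X]fdotC. Qed.
Lemma fdotZr c X Y : fdot X (c *: Y) = c * fdot X Y.
Proof. by rewrite fdotC fdotZl fdotC. Qed.
Lemma fdotNl X Y : fdot (- X) Y = - fdot X Y.
Proof. by rewrite -scaleN1r fdotZl mulN1r. Qed.
Lemma fdotNr X Y : fdot X (- Y) = - fdot X Y.
Proof. by rewrite fdotC fdotNl fdotC. Qed.

Definition fsq X := fdot X X.

Lemma fsqN X : fsq (- X) = fsq X.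
Proof. by rewrite /fsq fdotNl fdotNr opprK. Qed.
Lemma fsqC X Y : fsq (X - Y) = fsq (Y - X).
Proof. by rewrite -fsqN opprB. Qed.
Lemma fsqD X Y : fsq (X + Y) <= 2 * fsq X + 2 * fsq Y.
Proof. exact: sq_dotD fdotC fdotDl fdotZl fdot_ge0 X Y. Qed.
Lemma fsq_tri X Y Z : fsq (X - Z) <= 2 * fsq (X - Y) + 2 * fsq (Y - Z).
Proof. by rewrite -[X - Z](subrKA Y) fsqD. Qed.
Lemma fsq_entry X i j : X i j ^+ 2 <= fsq X.
Proof.
rewrite /fsq /fdot (bigD1 i)//= (bigD1 j)//= -expr2 -addrA lerDl addr_ge0//.
  by apply: sumr_ge0 => k _; rewrite -expr2 sqr_ge0.
by apply: sumr_ge0 => k _; apply: sumr_ge0 => l _; rewrite -expr2 sqr_ge0.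
Qed.

Definition fnorm X : R := Num.sqrt (fsq X).
Lemma fnorm_ge0 X : 0 <= fnorm X. Proof. exact: sqrtr_ge0. Qed.
Lemma fnorm_sq X : fnorm X ^+ 2 = fsq X. Proof. by rewrite sqr_sqrtr// fdot_ge0. Qed.
Lemma fnormN X : fnorm (- X) = fnorm X. Proof. by rewrite /fnorm fsqN. Qed.
Lemma fnormC X Y : fnorm (X - Y) = fnorm (Y - X). Proof. by rewrite /fnorm fsqC. Qed.

Lemma fdot_CS X Y : fdot X Y ^+ 2 <= fsq X * fsq Y.
Proof.
have h := fdot_ge0 (fsq Y *: X - fdot X Y *: Y).
have [Y0|Y0] := eqVneq (fsq Y) 0.
  have h1 := fdot_ge0 (X - (fdot X Y) *: Y); have h2 := fdot_ge0 (X + Y).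
  suff -> : fdot X Y = 0 by rewrite expr0n mulr_ge0 ?fdot_ge0.
  have YN0 i j : Y i j = 0.
    have := fsq_entry Y i j; rewrite Y0 => hy.
    by apply/eqP; rewrite -sqrf_eq0 eq_le hy sqr_ge0.
  by apply: big1 => i _; apply: big1 => j _; rewrite YN0 mulr0.
have Yp : 0 < fsq Y by rewrite lt_def Y0 fdot_ge0.
move: h; rewrite !(fdotDl, fdotDr, fdotNl, fdotNr, fdotZl, fdotZr) (fdotC Y X) -!/(fsq _).
set a := fsq X; set b := fsq Y; set c := fdot X Y => h.
have : 0 <= b * (a * b - c ^+ 2) by move: h; rewrite expr2; lra.
by rewrite pmulr_rge0// subr_ge0.
Qed.

Lemma fnormD X Y : fnorm (X + Y) <= fnorm X + fnorm Y.
Proof.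
have h : fdot X Y <= fnorm X * fnorm Y.
  rewrite (le_trans (ler_norm _))// -sqrtr_sqr /fnorm -sqrtrM ?fdot_ge0//.
  by rewrite ler_wsqrtr// fdot_CS.
rewrite -(@ler_pXn2r _ 2) ?nnegrE ?addr_ge0 ?fnorm_ge0// sqrrD !fnorm_sq.
rewrite /fsq !(fdotDl, fdotDr) (fdotC Y X) -mulr_natl; lra.
Qed.

Lemma fnormB X Y Z : fnorm (X - Z) <= fnorm (X - Y) + fnorm (Y - Z).
Proof. by rewrite -[X - Z](subrKA Y) fnormD. Qed.

Lemma fnormZ c X : fnorm (c *: X) = `|c| * fnorm X.
Proof.
rewrite /fnorm /fsq fdotZl fdotZr mulrA -expr2 sqrtrM ?sqr_ge0// sqrtr_sqr//.
Qed.

Lemma fnorm_leP X c : 0 <= c -> (fnorm X <= c) = (fsq X <= c ^+ 2).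
Proof. by move=> c0; rewrite -fnorm_sq ler_pXn2r// ?nnegrE ?fnorm_ge0. Qed.
End Frobenius.

Section HilbertSpace.
Context (R : realType) (d : measure_display) (T : measurableType d) (m : nat).

Definition mbm (f : T -> 'M[R]_m) := forall i j, bm (fun y => f y i j).

Lemma mbmD (f g : T -> 'M[R]_m) : mbm f -> mbm g -> mbm (fun y => f y + g y).
Proof. by move=> hf hg i j; under eq_fun do rewrite mxE; exact: bmD. Qed.
Lemma mbmZ c (f : T -> 'M[R]_m) : mbm f -> mbm (fun y => c *: f y).
Proof. by move=> hf i j; under eq_fun do rewrite mxE; exact: bmZ. Qed.
Lemma mbmN (f : T -> 'M[R]_m) : mbm f -> mbm (fun y => - f y).
Proof. by move=> hf i j; under eq_fun do rewrite mxE; exact: bmN. Qed.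
Lemma mbmB (f g : T -> 'M[R]_m) : mbm f -> mbm g -> mbm (fun y => f y - g y).
Proof. by move=> hf hg; apply: mbmD => //; exact: mbmN. Qed.
Lemma mbm_cst c : mbm (fun _ : T => c).
Proof. by move=> i j; exact: bm_cst. Qed.
Lemma mbm_fdot (f g : T -> 'M[R]_m) : mbm f -> mbm g -> bm (fun y => fdot (f y) (g y)).
Proof. by move=> hf hg; apply: bm_sum => i; apply: bm_sum => j; exact: bmM. Qed.

Lemma mbm_fnorm (f : T -> 'M[R]_m) : mbm f -> bm (fun y => fnorm (f y)).
Proof.
move=> hf; have [mq [M hM]] := mbm_fdot hf hf; split.
  apply: (measurableT_comp _ mq); apply: continuous_measurable_fun; exact: sqrt_continuous.
exists (Num.sqrt M) => y; rewrite ger0_norm ?fnorm_ge0// ler_wsqrtr//.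
by apply: le_trans (hM y); exact: ler_norm.
Qed.

Lemma mbm_comp d' (T' : measurableType d') (f : T -> 'M[R]_m) (g : T' -> T) :
  mbm f -> measurable_fun setT g -> forall i j, bm (fun y => f (g y) i j).
Proof.
move=> hf mg i j; have [mf [M hM]] := hf i j; split; last by exists M.
exact: (measurableT_comp mf mg).
Qed.

Definition hpred : {pred T -> 'M[R]_m} := fun f => `[< mbm f >].

Lemma hpred_submod : submod_closed hpred.
Proof.
split; first by apply/asboolP; exact: (mbm_cst 0).
by move=> c f g /asboolP hf /asboolP hg; apply/asboolP; exact: mbmD (mbmZ c hf) hg.
Qed.
HB.instance Definition _ := GRing.isSubmodClosed.Build R (T -> 'M[R]_m) hpred hpred_submod.

(** Bounded measurable functions, without quotient or completion: the Toeplitz argument works with a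
    symmetric nonnegative bilinear form. *)
Record hsp := Hsp {hfun :> T -> 'M[R]_m; _ : hfun \in hpred}.
HB.instance Definition _ := [isSub for hfun].
HB.instance Definition _ := [Choice of hsp by <:].
HB.instance Definition _ := [SubChoice_isSubLmodule of hsp by <:].

Lemma hspP (f : hsp) : mbm f. Proof. by case: f => f hf; apply/asboolP; exact: hf. Qed.
Definition mkh (f : T -> 'M[R]_m) (h : mbm f) : hsp := Hsp (introT (asboolP (mbm f)) h).
End HilbertSpace.

(* The quasi-representation that matters is [A g X = mu g *m X *m (nu g)^T]. *)
Record qrep (R : realType) (n m : nat) (Gam : 'M[R]_n -> Prop)
  (A : 'M[R]_n -> 'M[R]_m -> 'M[R]_m) (del : R) : Prop := QRep {
  qrep_D : forall g X Y, A g (X + Y) = A g X + A g Y;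
  qrep_Z : forall g c X, A g (c *: X) = c *: A g X;
  qrep_iso : forall g X Y, Gam g -> fdot (A g X) (A g Y) = fdot X Y;
  qrep_1 : forall X, A 1%:M X = X;
  qrep_M : forall g h X, Gam g -> Gam h -> fnorm (A (g *m h) X - A g (A h X)) <= del * fnorm X }.

Section Induced.
Variables (R : realType) (n m : nat) (Gam : 'M[R]_n -> Prop).
Hypothesis n0 : (0 < n)%N.
Hypothesis Gsub : is_subgroup_SL Gam.
Hypothesis Gdisc : discrete_set Gam.
Hypothesis Gfin : finite_covolume Gam.
Variables (A : 'M[R]_n -> 'M[R]_m -> 'M[R]_m) (del : R) (e : 'M[R]_m).
Hypothesis qA : qrep Gam A del.
Hypothesis del0 : 0 <= del.
Hypothesis e1 : fsq e = 1.

Notation Ex := (Ex n0 Gsub Gdisc).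
Notation pr := (pr n0 Gsub Gdisc).
Notation alpha := (alpha Gam).
Let aG y h : Gam (alpha y h) := alphaG Gsub y h.

Let AB g X Y : A g (X - Y) = A g X - A g Y.
Proof. by rewrite (qrep_D qA) -scaleN1r (qrep_Z qA) scaleN1r. Qed.

Lemma qrep_fsq g X : Gam g -> fsq (A g X) = fsq X.
Proof. by move=> Gg; rewrite /fsq (qrep_iso qA). Qed.

Lemma qrep_fnorm g X : Gam g -> fnorm (A g X) = fnorm X.
Proof. by move=> Gg; rewrite /fnorm qrep_fsq. Qed.

Lemma qrep_sum g (I : Type) (s : seq I) (F : I -> 'M[R]_m) :
  A g (\sum_(i <- s) F i) = \sum_(i <- s) A g (F i).
Proof.
elim: s => [|i s IH]; last by rewrite !big_cons (qrep_D qA) IH.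
by rewrite !big_nil -(scale0r 0) (qrep_Z qA) !scale0r.
Qed.

Lemma bm_Gfun (a : 'M[R]_n -> 'M[R]_n) X i j : (forall y, Gam (a y)) ->
  (forall g, measurable [set y | a y = g]) -> bm (fun y => A (a y) X i j).
Proof.
move=> Ga ma; split.
  exact: (@measurable_Gfun _ _ _ Gdisc _ _ a (fun g => A g X i j) Ga ma).
exists (fnorm X) => y.
rewrite -(@ler_pXn2r _ 2) ?nnegrE ?fnorm_ge0// real_normK ?num_real// fnorm_sq.
by rewrite -(qrep_fsq X (Ga y)) fsq_entry.
Qed.

(** By linearity of [A g], expansion of [f] in matrix units reduces to functions that depend on [y]
    through the countably valued [a] alone. *)
Lemma mbm_act (a : 'M[R]_n -> 'M[R]_n) (f : 'M[R]_n -> 'M[R]_m) : (forall y, Gam (a y)) ->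
  (forall g, measurable [set y | a y = g]) -> mbm f -> mbm (fun y => A (a y) (f y)).
Proof.
move=> Ga ma hf i j.
have -> : (fun y => A (a y) (f y) i j) =
   (fun y => \sum_k \sum_l f y k l * A (a y) (delta_mx k l) i j).
  apply/funext => y; rewrite {1}(matrix_sum_delta (f y)) qrep_sum summxE.
  apply: eq_bigr => k _; rewrite qrep_sum summxE; apply: eq_bigr => l _.
  by rewrite (qrep_Z qA) mxE.
by apply: bm_sum => k; apply: bm_sum => l; apply: bmM => //; exact: bm_Gfun.
Qed.

Lemma bm_mulr (f : 'M[R]_n -> R) h : bm f -> bm (fun y => f (y *m h)).
Proof.
move=> [mf [M hM]]; split; last by exists M.
apply: (measurableT_comp mf); apply: measurable_mulmx; [exact: measurable_id|exact: measurable_cst].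
Qed.

(* [Ux h x] is the image of [fx x] under the operator [f |-> A (alpha y h) (f (y *m h))] of the
   induced quasi-representation of SL_n; it is an exact isometry for each [h]. *)
Definition fx h (y : 'M[R]_n) : 'M[R]_m := A (alpha y h) e.
Definition Ux h x (y : 'M[R]_n) : 'M[R]_m := A (alpha y h) (fx x (y *m h)).

Lemma mbm_fx h : mbm (fx h).
Proof. by apply: mbm_act => // [g|]; [exact: measurable_alpha_eq|exact: mbm_cst]. Qed.

Lemma mbm_Ux h x : mbm (Ux h x).
Proof.
apply: mbm_act => // [g|i j]; first exact: measurable_alpha_eq.
by apply: (bm_mulr h (f := fun y => fx x y i j)); exact: mbm_fx.
Qed.

Lemma fsq_fx h y : fsq (fx h y) = 1.
Proof. by rewrite /fx qrep_fsq. Qed.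

Lemma fsq_fxe h y : fsq (fx h y - e) <= 4.
Proof. by have := fsqD (fx h y) (- e); rewrite fsqN fsq_fx e1; lra. Qed.

Lemma fx1 y : fx 1%:M y = e.
Proof. by rewrite /fx alpha1// (qrep_1 qA). Qed.

Lemma Ux_close h x y : fsq (fx (h *m x) y - Ux h x y) <= del ^+ 2.
Proof.
rewrite -fnorm_leP// /Ux /fx (alphaM Gsub).
apply: (le_trans (qrep_M qA _ (aG _ _) (aG _ _))).
by rewrite /fnorm e1 sqrtr1 mulr1.
Qed.

(** [A] is isometric at each point, and the function of y h that remains is Gam-invariant, so the
    translation disappears in the mean. The absence of any error is what provides the exact copies
    in [gramclose]. *)
Lemma Ux_gram h x x' : \det h = 1 -> \det x = 1 -> \det x' = 1 ->
  Ex (fun y => fdot (Ux h x y) (Ux h x' y)) = Ex (fun y => fdot (fx x y) (fx x' y)).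
Proof.
move=> dh dx dx'.
rewrite -(Ex_inv n0 Gsub Gdisc Gfin dh (f := fun y => fdot (fx x y) (fx x' y))).
- by congr (Ex _); apply/funext => y; rewrite (qrep_iso qA).
- by apply: mbm_fdot; exact: mbm_fx.
- move=> g y Gg dy; rewrite /fx.
  by rewrite (alpha_inv n0 Gsub Gdisc dx Gg dy) (alpha_inv n0 Gsub Gdisc dx' Gg dy).
Qed.

Definition dist h := Ex (fun y => fsq (fx h y - e)).

Let bfx h : bm (fun y => fsq (fx h y - e)).
Proof. by apply: mbm_fdot; apply: mbmB; (exact: mbm_fx || exact: mbm_cst). Qed.

Lemma fx_mulr h q : \det h = 1 -> \det q = 1 ->
  Ex (fun y => fsq (fx (h *m q) y - fx h y)) <= 2 * del ^+ 2 + 2 * dist q.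
Proof.
move=> dh dq.
have dqi : dist q = Ex (fun y => fsq (fx q (y *m h) - e)).
  have iv : Ginv Gam (fun y => fsq (fx q y - e)).
    by move=> g y Gg dy; rewrite /fx (alpha_inv n0 Gsub Gdisc dq Gg dy).
  exact: (esym (Ex_inv n0 Gsub Gdisc Gfin dh (bfx q) iv)).
rewrite dqi -(ExZ n0 Gsub Gdisc Gfin); last exact: (bm_mulr h (bfx q)).
rewrite -{1}(Ex_cst n0 Gsub Gdisc Gfin (2 * del ^+ 2)) -(ExD n0 Gsub Gdisc Gfin); last 2 first.
- exact: bm_cst.
- by apply: bmZ; exact: (bm_mulr h (bfx q)).
apply: (Ex_le n0 Gsub Gdisc Gfin).
- by apply: mbm_fdot; apply: mbmB; exact: mbm_fx.
- by apply: bmD; [exact: bm_cst|apply: bmZ; exact: (bm_mulr h (bfx q))].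
move=> y _; apply: (le_trans (fsq_tri _ (Ux h q y) _)).
have a3 : fsq (Ux h q y - fx h y) = fsq (fx q (y *m h) - e).
  by rewrite -(qrep_fsq (fx q (y *m h) - e) (aG y h)) AB.
rewrite a3; apply: lerD; last exact: lexx.
by rewrite (ler_pM2l (ltr0n _ 2)); exact: Ux_close.
Qed.

(** The right factor [q] is absorbed because it almost fixes [e], the left factor [h] because it
    acts isometrically up to [del]. *)
Lemma fx_conj h x q : \det h = 1 -> \det x = 1 -> \det q = 1 ->
  Ex (fun y => fsq (fx (h *m x *m q) y - Ux h x y)) <= 6 * del ^+ 2 + 4 * dist q.
Proof.
move=> dh dx dq.
have b1 : bm (fun y => fsq (fx (h *m x *m q) y - fx (h *m x) y)).
  by apply: mbm_fdot; apply: mbmB; exact: mbm_fx.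
have h1 := @fx_mulr (h *m x) q _ dq; rewrite det_mulmx dh dx mulr1 in h1.
apply: (@le_trans _ _ (2 * Ex (fun y => fsq (fx (h *m x *m q) y - fx (h *m x) y)) + 2 * del ^+ 2)); last first.
  by have := h1 erefl; lra.
rewrite -(ExZ n0 Gsub Gdisc Gfin)// -(Ex_cst n0 Gsub Gdisc Gfin (2 * del ^+ 2)).
rewrite -(ExD n0 Gsub Gdisc Gfin); [|exact: bmZ|exact: bm_cst].
apply: (Ex_le n0 Gsub Gdisc Gfin).
- by apply: mbm_fdot; apply: mbmB; (exact: mbm_fx || exact: mbm_Ux).
- by apply: bmD; [exact: bmZ|exact: bm_cst].
move=> y _; apply: (le_trans (fsq_tri _ (fx (h *m x) y) _)).
apply: lerD; first exact: lexx.
by rewrite (ler_pM2l (ltr0n _ 2)); exact: Ux_close.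
Qed.

Lemma dist_mul h q : \det h = 1 -> \det q = 1 ->
  dist (h *m q) <= 4 * del ^+ 2 + 4 * dist q + 2 * dist h.
Proof.
move=> dh dq; have h1 := fx_mulr dh dq.
have b1 : bm (fun y => fsq (fx (h *m q) y - fx h y)).
  by apply: mbm_fdot; apply: mbmB; exact: mbm_fx.
have ar (P a b c : R) : P <= 2 * c + 2 * a -> 2 * P + 2 * b <= 4 * c + 4 * a + 2 * b by lra.
apply: (@le_trans _ _ (2 * Ex (fun y => fsq (fx (h *m q) y - fx h y)) + 2 * dist h)); last exact: ar.
rewrite /dist -!(ExZ n0 Gsub Gdisc Gfin)// -(ExD n0 Gsub Gdisc Gfin); try exact: bmZ.
apply: (Ex_le n0 Gsub Gdisc Gfin) => //; first by apply: bmD; exact: bmZ.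
by move=> y _; exact: fsq_tri.
Qed.

Lemma dist_ge0 h : 0 <= dist h.
Proof. by apply: (Ex_ge0 n0 Gsub Gdisc Gfin) => // y _; exact: fdot_ge0. Qed.

(** On [S] the largest possible squared distance of two unit vectors, 4, is used. *)
Lemma dist_le h (S : set 'M[R]_n) k : 0 <= k -> measurable S ->
  (forall y, ~ S y -> fsq (fx h y - e) <= k) -> dist h <= k + 4 * pr S.
Proof.
move=> k0 mS hS.
have bS : bm (\1_S : 'M[R]_n -> R) by exact: bm_indic.
rewrite -{1}(Ex_cst n0 Gsub Gdisc Gfin k) /pr -(ExZ n0 Gsub Gdisc Gfin 4 bS).
rewrite -(ExD n0 Gsub Gdisc Gfin); [|exact: bm_cst|exact: bmZ].
apply: (Ex_le n0 Gsub Gdisc Gfin) => //; first by apply: bmD; [exact: bm_cst|exact: bmZ].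
move=> y _; rewrite indicE; have [Sy|Sy] := pselect (S y).
  by rewrite mem_set//= mulr1; have := fsq_fxe h y; lra.
by rewrite memNset//= mulr0 addr0 hS.
Qed.
End Induced.

(** * The subgroups R^2 and the matrices normalising them *)

Section Translations.
Variables (R : realType) (n : nat) (i j k : 'I_n).
Hypotheses (ij : i != j) (ik : i != k) (jk : j != k).
Implicit Types (v w : int * int) (t : R).

Definition cvec v : 'cV[R]_n := v.1%:~R *: delta_mx i 0 + v.2%:~R *: delta_mx j 0.
Definition rvec : 'rV[R]_n := delta_mx 0 k.
(** The unipotent matrix with the vector t v in rows [i], [j] of column [k]; for fixed [t] these
    matrices form the lattice t Z^2 in an elementary R^2. *)
Definition Tr t v : 'M[R]_n := 1%:M + t *: (cvec v *m rvec).

Lemma cvecD v w : cvec (v + w) = cvec v + cvec w.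
Proof. by rewrite /cvec /= !intrD !scalerDl addrACA. Qed.

Lemma rvec_cvec v : rvec *m cvec v = 0.
Proof.
rewrite /rvec /cvec mulmxDr -!scalemxAr !mul_delta_mx_cond ![k == _]eq_sym.
by rewrite (negbTE ik) (negbTE jk) !mulr0n !scaler0 addr0.
Qed.

Lemma TrD t v w : Tr t (v + w) = Tr t v *m Tr t w.
Proof.
rewrite /Tr mulmxDl mul1mx mulmxDr mulmx1 -!scalemxAl -!scalemxAr.
rewrite -mulmxA (mulmxA rvec) rvec_cvec mul0mx mulmx0 !scaler0 addr0.
by rewrite cvecD mulmxDl scalerDr addrA addrAC.
Qed.

Lemma Tr_conj t (ga : 'M[R]_n) (g : int * int -> int * int) v :
  ga *m cvec v = cvec (g v) -> rvec *m ga = rvec -> Tr t (g v) *m ga = ga *m Tr t v.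
Proof.
move=> h1 h2; rewrite /Tr mulmxDl mulmxDr mul1mx mulmx1 -scalemxAl -scalemxAr.
by rewrite -mulmxA h2 mulmxA h1.
Qed.

Lemma TrE t v : Tr t v = elmx i k (t * v.1%:~R) *m elmx j k (t * v.2%:~R).
Proof.
rewrite /Tr /elmx mulmxDl mul1mx mulmxDr mulmx1 -scalemxAl -scalemxAr.
rewrite mul_delta_mx_cond eq_sym (negbTE jk) mulr0n !scaler0 addr0.
rewrite /cvec mulmxDl -!scalemxAl !mul_delta_mx scalerDr !scalerA.
by rewrite -addrA [_ *: delta_mx j k + _]addrC.
Qed.

Lemma det_Tr t v : \det (Tr t v) = 1.
Proof. by rewrite TrE det_mulmx !det_elmx// mulr1. Qed.

Lemma Tr0 t : Tr t 0 = 1%:M.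
Proof. by rewrite TrE !mulr0 !elmx0 mulmx1. Qed.

Lemma elmx_ji (c : int) v : elmx j i c%:~R *m cvec v = cvec (smap c v).
Proof.
rewrite /elmx mulmxDl mul1mx -scalemxAl {2}/cvec mulmxDr -!scalemxAr !mul_delta_mx_cond.
rewrite eqxx (negbTE ij) mulr0n scaler0 addr0 mulr1n /cvec /smap/= intrD intrM.
by rewrite scalerDl scalerA addrA.
Qed.

Lemma elmx_ij (c : int) v : elmx i j c%:~R *m cvec v = cvec (v.1 + c * v.2, v.2).
Proof.
rewrite /elmx mulmxDl mul1mx -scalemxAl {2}/cvec mulmxDr -!scalemxAr !mul_delta_mx_cond.
rewrite eqxx [j == i]eq_sym (negbTE ij) mulr0n scaler0 add0r mulr1n /cvec /= intrD intrM.
by rewrite scalerDl scalerA addrAC.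
Qed.

Lemma rvec_elmx (a b : 'I_n) (c : R) : k != a -> rvec *m elmx a b c = rvec.
Proof.
by move=> ka; rewrite /elmx mulmxDr mulmx1 -scalemxAr mul_delta_mx_cond (negbTE ka) mulr0n scaler0 addr0.
Qed.

(** Rotation by a right angle in the plane of the indices [i] and [j]. *)
Definition weyl : 'M[R]_n := elmx i j (-1) *m elmx j i 1 *m elmx i j (-1).

Lemma weyl_cvec v : weyl *m cvec v = cvec (wmap v).
Proof.
have h1 w : elmx i j (- 1) *m cvec w = cvec (w.1 + - 1 * w.2, w.2).
  by have := elmx_ij (-1) w; rewrite mulrNz mulr1z.
have h2 w : elmx j i 1 *m cvec w = cvec (smap 1 w) by have := elmx_ji 1 w; rewrite mulr1z.
rewrite /weyl -!mulmxA h1 h2 h1.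
by rewrite /smap /wmap /=; congr cvec; congr pair; ring.
Qed.

Lemma det_weyl : \det weyl = 1.
Proof. by rewrite /weyl !det_mulmx !det_elmx ?mulr1// eq_sym. Qed.

Lemma rvec_weyl : rvec *m weyl = rvec.
Proof. by rewrite /weyl !mulmxA !rvec_elmx// eq_sym. Qed.
End Translations.

Section ElementaryClose.
Variables (R : realType) (n m : nat) (Gam : 'M[R]_n -> Prop).
Hypothesis n0 : (0 < n)%N.
Hypothesis Gsub : is_subgroup_SL Gam.
Hypothesis Gdisc : discrete_set Gam.
Hypothesis Gfin : finite_covolume Gam.
Variables (A : 'M[R]_n -> 'M[R]_m -> 'M[R]_m) (del : R) (e : 'M[R]_m).
Hypothesis qA : qrep Gam A del.
Hypothesis del0 : 0 <= del.
Hypothesis e1 : fsq e = 1.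

Notation T := 'M[R]_n.
Notation Ex := (Ex n0 Gsub Gdisc).
Notation pr := (pr n0 Gsub Gdisc).
Notation dist := (dist n0 Gsub Gdisc A e).
Notation fx := (fx Gam A e).
Notation Ux := (Ux Gam A e).
Notation sp := (hsp R T m).

Definition hdot (f g : sp) : R := Ex (fun y => fdot (f y) (g y)).

Let bdot (f g : sp) : bm (fun y => fdot (f y) (g y)).
Proof. by apply: mbm_fdot; exact: hspP. Qed.

Lemma hdotC f g : hdot f g = hdot g f.
Proof. by congr (Ex _); apply/funext => y; rewrite fdotC. Qed.
Lemma hdotDl f g h : hdot (f + g) h = hdot f h + hdot g h.
Proof.
rewrite /hdot -(ExD n0 Gsub Gdisc Gfin)//; congr (Ex _); apply/funext => y.
exact: fdotDl.
Qed.
Lemma hdotZl c f g : hdot (c *: f) g = c * hdot f g.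
Proof.
rewrite /hdot -(ExZ n0 Gsub Gdisc Gfin)//; congr (Ex _); apply/funext => y.
exact: fdotZl.
Qed.
Lemma hdot_ge0 f : 0 <= hdot f f.
Proof. by apply: (Ex_ge0 n0 Gsub Gdisc Gfin) => // y _; exact: fdot_ge0. Qed.

Let hfx h : sp := mkh (mbm_fx n0 Gsub Gdisc e qA h).
Let hUx h x : sp := mkh (mbm_Ux n0 Gsub Gdisc e qA h x).

Variables (i j k : 'I_n).
Hypotheses (ij : i != j) (ik : i != k) (jk : j != k).
Variable kap : R.
Hypothesis kap0 : 0 < kap.
Hypothesis kap1 : kap <= 1.
Hypothesis dk : del <= kap / 10.
Notation Tr := (Tr i j k).

Let small (x : R) : 0 <= x -> x <= kap ^+ 2 / 10 -> 6 * del ^+ 2 + 4 * x <= kap ^+ 2.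
Proof.
move=> x0 hx; have : del ^+ 2 <= (kap / 10) ^+ 2 by rewrite lerXn2r// nnegrE divr_ge0// ltW.
by have := sqr_ge0 kap; rewrite !expr2; lra.
Qed.

(** Tr (x + g v) is the product of Tr x, ga, Tr v and ga^-1. The isometric copy is the image of the
    family under the operator of Tr x ga, and the last factor is harmless because it almost fixes
    [e]. *)
Let gram t (g : int * int -> int * int) (ga : 'M[R]_n) : \det ga = 1 ->
  (forall v, ga *m cvec R i j v = cvec R i j (g v)) -> rvec R k *m ga = rvec R k ->
  dist (invmx ga) <= kap ^+ 2 / 10 ->
  gramclose hdot (fun v => hfx (Tr t v)) kap g.
Proof.
move=> dga h1 h2 h3 x.
have uga : ga \in unitmx by rewrite unitmxE dga unitr1.
have dxg : \det (Tr t x *m ga) = 1 by rewrite det_mulmx det_Tr// dga mulr1.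
exists (fun v => hUx (Tr t x *m ga) (Tr t v)); split => [v w|v].
  by apply: (Ux_gram n0 Gsub Gdisc Gfin e qA dxg); rewrite det_Tr.
have dgi : \det (invmx ga) = 1 by rewrite det_inv dga invr1.
have := @fx_conj _ _ _ _ n0 Gsub Gdisc Gfin A del e qA del0 e1 (Tr t x *m ga) (Tr t v) (invmx ga) dxg.
rewrite det_Tr// => /(_ erefl dgi).
have -> : Tr t x *m ga *m Tr t v *m invmx ga = Tr t (x + g v).
  by rewrite TrD// -!mulmxA (mulmxA ga) -(Tr_conj t (h1 v) h2) mulmxK.
move=> h4; apply: (@le_trans _ _ (6 * del ^+ 2 + 4 * dist (invmx ga))); first exact: h4.
apply: small => //; exact: (dist_ge0 n0 Gsub Gdisc Gfin e qA).
Qed.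

Hypothesis q1 : dist (invmx (elmx j i 2)) <= kap ^+ 2 / 10.
Hypothesis q2 : dist (invmx (elmx j i (- 2))) <= kap ^+ 2 / 10.
Hypothesis q3 : dist (invmx (weyl R i j)) <= kap ^+ 2 / 10.

(** Where [sfun] does not change, the cocycle is 1 and [e] is fixed exactly; continuity of [sfun] in
    measure thus gives continuity at the identity, whatever [A] is. *)
Lemma dist_small_elmx (a b : 'I_n) (c eta : R) : a != b -> 0 < eta ->
  \forall N \near \oo, dist (elmx a b (c / N.+1%:R)) <= eta.
Proof.
move=> ab eta0.
have dq N : \det (elmx a b (c / N.+1%:R)) = 1 by rewrite det_elmx.
have q1' : mcvg (fun N => elmx a b (c / N.+1%:R)) 1%:M.
  move=> p q.
  have h : ((1%:M : 'M[R]_n) p q + c * (delta_mx a b : 'M[R]_n) p q * N.+1%:R^-1) @[N --> \oo]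
      --> ((1%:M : 'M[R]_n) p q + c * (delta_mx a b : 'M[R]_n) p q * 0 : R).
    apply: cvgD; first exact: cvg_cst.
    by apply: cvgM; [exact: cvg_cst|exact: cvg_harmonic].
  rewrite mulr0 addr0 in h.
  have -> : (fun N => elmx a b (c / N.+1%:R) p q) =
      (fun N => (1%:M : 'M[R]_n) p q + c * (delta_mx a b : 'M[R]_n) p q * N.+1%:R^-1).
    by apply/funext => N; rewrite /elmx mxE [X in _ + X]mxE mulrAC.
  exact: h.
have := sfun_continuity n0 Gsub Gdisc Gfin dq q1'.
have eta4 : 0 < eta / 4 by rewrite divr_gt0.
move=> /cvgr0Pnorm_lt /(_ _ eta4); apply: filterS => N hN.
have mS := measurable_sfun_neq n0 Gsub Gdisc (elmx a b (c / N.+1%:R)).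
have hd := dist_le n0 Gsub Gdisc Gfin qA e1 (lexx 0) mS (h := elmx a b (c / N.+1%:R)).
apply: (@le_trans _ _ (0 + 4 * pr [set y | sfun Gam (y *m elmx a b (c / N.+1%:R)) <> sfun Gam y])).
  apply: hd => y /= /contrapT hy.
  rewrite /fx /alpha hy mulVmx; last exact: (Gam_unit Gsub (sfunG Gsub y)).
  by rewrite (qrep_1 qA) subrr /fsq -(scale0r 0) fdotZl mul0r.
rewrite ger0_norm in hN; last exact: (pr_ge0 n0 Gsub Gdisc Gfin mS).
by move: hN; move: (pr _) => x; lra.
Qed.

Lemma dist_elmx (c : R) : dist (elmx i k c) <= 100 * (500 * kap).
Proof.
have eta0 : 0 < kap ^+ 2 by rewrite exprn_gt0.
have [N [hN1 hN2]] : exists N : nat, dist (elmx i k (c / N.+1%:R)) <= kap ^+ 2 /\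
    dist (elmx j k (c / N.+1%:R)) <= kap ^+ 2.
  have h1 := @dist_small_elmx i k c _ ik eta0.
  have h2 := @dist_small_elmx j k c _ jk eta0.
  have [N _ hN] := filterI h1 h2.
  by exists N; exact: (hN N (leqnn N)).
(* For this [t] the generators Tr t (1, 0) and Tr t (0, 1) almost fix [e], while Tr t (N + 1, 0) is
   the given elementary matrix. The bound of [relT] does not depend on the vector, hence not on
   N. *)
pose t := c / N.+1%:R.
pose xi v := hfx (Tr t v).
have d1 : dist 1%:M = 0.
  rewrite /dist -[RHS](Ex_cst n0 Gsub Gdisc Gfin); congr (Ex _); apply/funext => y.
  by rewrite (fx1 Gsub e qA) subrr /fsq -(scale0r 0) fdotZl mul0r.
have sub v : hdot (xi v - xi 0) (xi v - xi 0) = dist (Tr t v).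
  rewrite /hdot /dist; congr (Ex _); apply/funext => y.
  by rewrite -[(xi v - xi 0) y]/(fx (Tr t v) y - fx (Tr t 0) y) Tr0// (fx1 Gsub e qA).
have -> : elmx i k c = Tr t (Posz N.+1, 0).
  by rewrite TrE// mulr0 elmx0 mulmx1 /= -pmulrn /t divfK// pnatr_eq0.
rewrite -sub; apply: (@relT R sp hdot hdotC hdotDl hdotZl hdot_ge0 xi kap kap0 kap1).
- move=> v; rewrite /hdot.
  rewrite (_ : (fun y => _) = fun _ => 1) ?(Ex_cst n0 Gsub Gdisc Gfin)//.
  by apply/funext => y; exact: (fsq_fx Gsub qA e1).
- apply: (@gram t id 1%:M); rewrite ?det1 ?mulmx1 ?invmx1 ?d1 ?divr_ge0 ?ltW//.
  by move=> v; rewrite mul1mx.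
- by apply: (@gram t wmap (weyl R i j)); [exact: det_weyl|exact: weyl_cvec|exact: rvec_weyl|].
- apply: (@gram t (smap 2) (elmx j i 2) _ _ _ q1); first by rewrite det_elmx// eq_sym.
    by move=> v; have := @elmx_ji R _ _ _ ij 2 v.
  by rewrite rvec_elmx// eq_sym.
- apply: (@gram t (smap (-2)) (elmx j i (-2)) _ _ _ q2); first by rewrite det_elmx// eq_sym.
    by move=> v; have := @elmx_ji R _ _ _ ij (-2) v; rewrite mulrNz.
  by rewrite rvec_elmx// eq_sym.
- rewrite sub.
  have -> : Tr t (1, 0) = elmx i k t by rewrite TrE// mulr1 mulr0 elmx0 mulmx1.
  exact: hN1.
- rewrite sub.
  have -> : Tr t (0, 1) = elmx j k t by rewrite TrE// mulr1 mulr0 elmx0 mul1mx.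
  exact: hN2.
Qed.
End ElementaryClose.

(** This is where n >= 3 enters: the elementary matrix at (i, k) lies in a group R^2 on which an
    SL_2 in the indices [i], [j] acts. *)
Lemma third_index (n : nat) (i k : 'I_n) : (3 <= n)%N -> exists j : 'I_n, (i != j) && (j != k).
Proof.
move=> n3; apply/existsP; rewrite -[[exists _, _]]negbK negb_exists; apply/negP => /forallP h.
have : (#|'I_n| <= #|pred2 i k|)%N.
  apply/subset_leq_card/fintype.subsetP => j _; have := h j.
  by rewrite negb_and !negbK !inE (eq_sym i).
by rewrite card_ord card2 leqNgt (leq_trans _ n3)// !ltnS; case: (i != k).
Qed.

(** * From elementary matrices to all of SL_n *)

Section AllClose.
Variables (R : realType) (n : nat) (Gam : 'M[R]_n -> Prop).
Hypothesis n3 : (3 <= n)%N.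
Hypothesis n0 : (0 < n)%N.
Hypothesis Gsub : is_subgroup_SL Gam.
Hypothesis Gdisc : discrete_set Gam.
Hypothesis Gfin : finite_covolume Gam.
Notation pr := (pr n0 Gsub Gdisc).

Lemma dist_SL (tau : R) : 0 < tau -> exists (B : seq 'M[R]_n) (k0 : R),
  [/\ forall g, g \in B -> Gam g, 0 < k0 &
   forall m (A : 'M[R]_n -> 'M[R]_m -> 'M[R]_m) del e, qrep Gam A del -> 0 <= del -> del <= k0 ->
     fsq e = 1 -> (forall g, g \in B -> fsq (A g e - e) <= k0 ^+ 2) ->
     forall h, \det h = 1 -> dist n0 Gsub Gdisc A e h <= tau].
Proof.
move=> tau0.
have t10 : 0 < 10 ^+ ellen n :> R by rewrite exprn_gt0.
(* By [dist_mul] each elementary factor multiplies the bound by at most 10, and [ellen n] factors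
   are enough. *)
pose b := tau / 10 ^+ ellen n.
have b0 : 0 < b by rewrite divr_gt0.
pose kap := Num.min 1 (b / 100 / 500).
have kap0 : 0 < kap by rewrite lt_min ltr01/= (divr_gt0 (divr_gt0 b0 (ltr0n _ 100)) (ltr0n _ 500)).
have kap1 : kap <= 1 by rewrite ge_min lexx.
have kapb : 100 * (500 * kap) <= b.
  have : kap <= b / 100 / 500 by rewrite ge_min lexx orbT.
  by move: (b) (kap) => x y; lra.
(* An exceptional mass kap^2 / 80 contributes kap^2 / 20 to the squared distance and the finite set
   contributes at most as much, which makes up the kap^2 / 10 required by [dist_elmx]. *)
have k2 : 0 < kap ^+ 2 / 80 by rewrite divr_gt0// exprn_gt0.
have hB (q : 'M[R]_n) : exists B : seq 'M[R]_n, (forall g, g \in B -> Gam g) /\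
   (\det q = 1 -> measurable [set y | alpha Gam y q \notin B] /\
      pr [set y | alpha Gam y q \notin B] <= kap ^+ 2 / 80).
  have [dq|dq] := pselect (\det q = 1); last by exists [::].
  have [B [h1 h2]] := tight n0 Gsub Gdisc Gfin dq k2.
  by exists B.
have {hB} [Bf hBf] := choice hB.
(* The finitely many elements of the various SL_2 that occur in the conjugations; the finite set
   consists of the main values of the cocycle at them. *)
pose Q := flatten [seq [:: invmx (elmx ij.2 ij.1 2); invmx (elmx ij.2 ij.1 (-2));
   invmx (weyl R ij.1 ij.2)] | ij <- enum {: 'I_n * 'I_n}].
exists (flatten [seq Bf q | q <- Q]), (kap / 10); split.
- by move=> g /flatten_mapP[q _]; exact: (hBf q).1.
- by rewrite divr_gt0.
move=> m A del e qA del0 dk e1 hA.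
have dinv ga : invmx ga \in Q -> \det ga = 1 ->
    dist n0 Gsub Gdisc A e (invmx ga) <= kap ^+ 2 / 10.
  move=> gQ dga; have dgi : \det (invmx ga) = 1 by rewrite det_inv dga invr1.
  have [mS prS] := (hBf (invmx ga)).2 dgi.
  have kk : 0 <= kap ^+ 2 / 20 by rewrite divr_ge0// sqr_ge0.
  apply: (@le_trans _ _ (kap ^+ 2 / 20 + 4 * pr [set y | alpha Gam y (invmx ga) \notin Bf (invmx ga)])).
    apply: (dist_le n0 Gsub Gdisc Gfin qA e1 kk mS) => y /= /negP; rewrite negbK => hy.
    apply: (@le_trans _ _ ((kap / 10) ^+ 2)).
      by apply: hA; apply/flatten_mapP; exists (invmx ga).
    by have := sqr_ge0 kap; rewrite !expr2; lra.
  by move: prS; move: (pr _) (kap ^+ 2) => x y; lra.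
have del2 : del ^+ 2 <= b.
  have h1 : del ^+ 2 <= (kap / 10) ^+ 2 by rewrite lerXn2r// nnegrE divr_ge0// ltW.
  have h2 : kap ^+ 2 <= kap by rewrite expr2 ler_piMr// ltW.
  move: h1 h2 kapb kap0; rewrite !expr2; move: (del * del) (b) (kap) => x y z; lra.
have elem i k c : i != k -> dist n0 Gsub Gdisc A e (elmx i k c) <= b.
  move=> ik; have [j /andP[ij jk]] := third_index i k n3.
  apply: (@le_trans _ _ (100 * (500 * kap))); last exact: kapb.
  have ji : j != i by rewrite eq_sym.
  have inQ q : q \in [:: invmx (elmx j i 2); invmx (elmx j i (-2)); invmx (weyl R i j)] -> q \in Q.
    by move=> hq; apply/flatten_mapP; exists (i, j); rewrite ?mem_enum.
  apply: (@dist_elmx R n m Gam n0 Gsub Gdisc Gfin A del e qA del0 e1 i j k ij ik jk kap kap0 kap1 dk).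
  - by apply: dinv; [apply: inQ; rewrite !inE eqxx|rewrite det_elmx].
  - by apply: dinv; [apply: inQ; rewrite !inE eqxx orbT|rewrite det_elmx].
  - by apply: dinv; [apply: inQ; rewrite !inE eqxx !orbT|exact: det_weyl].
have ar (x y z P : R) : 1 <= P -> x <= b -> y <= P * b -> z <= b -> 4 * x + 4 * y + 2 * z <= 10 * P * b.
  by move=> P1 h1 h2 h3; have h4 := ler_peMl (ltW b0) P1; lra.
have key L h : elprod L h -> \det h = 1 /\ dist n0 Gsub Gdisc A e h <= 10 ^+ L * b.
  elim => {L h} [L|L i j c h ij _ [dh IH]].
    rewrite det1; split => //.
    rewrite /dist (_ : (fun y => _) = fun _ => 0); last first.
      by apply/funext => y; rewrite (fx1 Gsub e qA) subrr /fsq -(scale0r 0) fdotZl mul0r.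
    by rewrite (Ex_cst n0 Gsub Gdisc Gfin) mulr_ge0 ?exprn_ge0// ltW.
  have dE : \det (elmx i j c) = 1 by rewrite det_elmx.
  split; first by rewrite det_mulmx dE dh mulr1.
  apply: (le_trans (dist_mul n0 Gsub Gdisc Gfin qA del0 e1 dE dh)).
  rewrite (exprS 10 L); apply: ar; [by apply: exprn_ege1; rewrite ler1n|exact: del2|exact: IH|].
  exact: elem.
move=> h dh; have [_] := key _ _ (elprod_SL dh).
by rewrite /b mulrC divfK// gt_eqF.
Qed.
End AllClose.

(** * Convex minimisation *)

Section Weighted.
Context {R : realType} {m : nat} {I : Type}.
Implicit Types (s : seq I) (c : I -> R) (Z : I -> 'M[R]_m).

Lemma fdot_wsuml s c Z X : fdot (\sum_(p <- s) c p *: Z p) X = \sum_(p <- s) c p * fdot (Z p) X.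
Proof.
elim: s => [|p s IH]; last by rewrite !big_cons fdotDl fdotZl IH.
by rewrite !big_nil -(scale0r 0) fdotZl mul0r.
Qed.

Lemma fsq_jensen s c Z : (forall p, 0 <= c p) -> \sum_(p <- s) c p = 1 ->
  fsq (\sum_(p <- s) c p *: Z p) <= \sum_(p <- s) c p * fsq (Z p).
Proof.
move=> c0 c1; set X := \sum_(p <- s) _.
have h : 0 <= \sum_(p <- s) c p * fsq (Z p - X).
  by apply: sumr_ge0 => p _; rewrite mulr_ge0// fdot_ge0.
have e p : c p * fsq (Z p - X) = c p * fsq (Z p) - 2 * (c p * fdot (Z p) X) + c p * fsq X.
  by rewrite /fsq !(fdotDl, fdotDr, fdotNl, fdotNr) (fdotC X); ring.
move: h; under eq_bigr do rewrite e.
rewrite big_split/= sumrB -mulr_sumr -fdot_wsuml -/X -mulr_suml c1 mul1r -/(fsq X).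
lra.
Qed.

Lemma fnorm_wsum s c Z (k : R) : (forall p, 0 <= c p) -> \sum_(p <- s) c p = 1 ->
  (forall p, fnorm (Z p) <= k) -> fnorm (\sum_(p <- s) c p *: Z p) <= k.
Proof.
move=> c0 c1 hk; rewrite -[k]mul1r -c1 mulr_suml {c1}.
elim: s => [|p s IH].
  by rewrite !big_nil /fnorm /fsq -(scale0r 0) fdotZl mul0r sqrtr0.
rewrite !big_cons (le_trans (fnormD _ _))// lerD// fnormZ ger0_norm//.
by rewrite ler_wpM2l.
Qed.
End Weighted.

Section Convex.
Variables (R : realType) (n m : nat) (Gam : 'M[R]_n -> Prop).
Hypothesis n0 : (0 < n)%N.
Hypothesis Gsub : is_subgroup_SL Gam.
Hypothesis Gdisc : discrete_set Gam.
Hypothesis Gfin : finite_covolume Gam.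
Variables (A : 'M[R]_n -> 'M[R]_m -> 'M[R]_m) (del : R) (e : 'M[R]_m).
Hypothesis qA : qrep Gam A del.
Hypothesis del0 : 0 <= del.
Hypothesis e1 : fsq e = 1.

Notation Ex := (Ex n0 Gsub Gdisc).
Notation sfun := (sfun Gam).
Notation gam := (gam Gam).
Let sG := sfunG Gsub.
Let GM g h : Gam g -> Gam h -> Gam (g *m h). Proof. by case: Gsub => _ _ h1 _; exact: h1. Qed.

(** The factor [sfun y]^-1 of the cocycle is omitted: the result is Gam-equivariant up to [del]
    rather than invariant, and agrees with [fx] on [D1]. *)
Definition Ph (h y : 'M[R]_n) : 'M[R]_m := A (sfun (y *m h)) e.

Record cvx := Cvx { wgt : seq (R * 'M[R]_n);
  wgt_ge0 : all (fun p => (0 <= p.1) && (\det p.2 == 1)) wgt;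
  wgt_sum : \sum_(p <- wgt) p.1 = 1 }.

(* The absolute value keeps the weights nonnegative for every term of the sum. *)
Definition cmb (s : cvx) (y : 'M[R]_n) : 'M[R]_m := \sum_(p <- wgt s) `|p.1| *: Ph p.2 y.

Let w0 (p : R * 'M[R]_n) : 0 <= `|p.1|. Proof. exact: normr_ge0. Qed.
Let w1 (s : cvx) : \sum_(p <- wgt s) `|p.1| = 1.
Proof.
rewrite -(wgt_sum s) big_seq [RHS]big_seq; apply: eq_bigr => p ps.
by rewrite ger0_norm//; have /allP /(_ p ps) /andP[] := wgt_ge0 s.
Qed.

Lemma mbm_Ph h : mbm (Ph h).
Proof.
apply: (mbm_act Gdisc qA) => [y|g|]; [exact: sG| |exact: mbm_cst].
exact: (measurable_mulr_preimage h (measurable_sfun_eq n0 Gsub Gdisc g)).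
Qed.

Lemma mbm_cmb s : mbm (cmb s).
Proof.
move=> i j; rewrite (_ : (fun y => _) = fun y => \sum_(p <- wgt s) `|p.1| * Ph p.2 y i j).
  by apply: bm_sum => p; apply: bmZ; exact: mbm_Ph.
by apply/funext => y; rewrite summxE; apply: eq_bigr => p _; rewrite mxE.
Qed.

Lemma fnorm_Ph h y : fnorm (Ph h y) = 1.
Proof. by rewrite /Ph (qrep_fnorm qA)// /fnorm e1 sqrtr1. Qed.

Lemma fnorm_cmb s y : fnorm (cmb s y) <= 1.
Proof. by apply: fnorm_wsum => // p; rewrite fnorm_Ph. Qed.

Lemma fsq_cmb s y : fsq (cmb s y) <= 1.
Proof. by rewrite -fnorm_sq -(expr1n _ 2) lerXn2r ?nnegrE ?fnorm_ge0// fnorm_cmb. Qed.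

Lemma cvx_det s p : p \in wgt s -> \det p.2 = 1.
Proof. by move=> ps; have /allP /(_ p ps) /andP[_ /eqP] := wgt_ge0 s. Qed.

Lemma cmb_equiv s g y : Gam g -> 0 < \det y -> fnorm (cmb s (g *m y) - A g (cmb s y)) <= del.
Proof.
move=> Gg dy; rewrite /cmb (qrep_sum qA) -sumrB.
under eq_bigr do rewrite (qrep_Z qA) -scalerBr.
have E : \sum_(p <- wgt s) `|p.1| *: (Ph p.2 (g *m y) - A g (Ph p.2 y)) =
  \sum_(p <- wgt s) `|p.1| *: (if \det p.2 == 1 then Ph p.2 (g *m y) - A g (Ph p.2 y) else 0).
  by rewrite big_seq [RHS]big_seq; apply: eq_bigr => p ps; rewrite (cvx_det ps) eqxx.
rewrite E; apply: fnorm_wsum => // p; case: eqP => [dp|_]; last first.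
  by rewrite /fnorm /fsq -(scale0r 0) fdotZl mul0r sqrtr0.
rewrite /Ph -mulmxA (sfunM n0 Gsub Gdisc Gg); last by rewrite det_mulmx dp mulr1.
apply: (le_trans (qrep_M qA e Gg (sG _))).
by rewrite /fnorm e1 sqrtr1 mulr1.
Qed.

Lemma cmb_scale s c y : 0 < c -> 0 < \det y -> cmb s (c *: y) = cmb s y.
Proof.
move=> c0 dy; apply: eq_big_seq => p ps.
by rewrite /Ph -scalemxAl (sfunZ n0 Gsub Gdisc)// det_mulmx (cvx_det ps) mulr1.
Qed.

Lemma PhM h k y : Ph (h *m k) y = Ph k (y *m h).
Proof. by rewrite /Ph mulmxA. Qed.

Let half (c : R) : `|c / 2| = 2^-1 * `|c|.
Proof. by rewrite normrM (@ger0_norm _ 2^-1) ?invr_ge0 ?ler0n// mulrC. Qed.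

(** Translating [Ph k] on the right by [h] gives [Ph (h *m k)], so the hull is stable under
    translation. *)
Lemma cmb_mid s h : \det h = 1 ->
  exists t, forall y, cmb t y = 2^-1 *: (cmb s y + cmb s (y *m h)).
Proof.
move=> dh.
pose l := [seq (p.1 / 2, p.2) | p <- wgt s] ++ [seq (p.1 / 2, h *m p.2) | p <- wgt s].
have l0 : all (fun p => (0 <= p.1) && (\det p.2 == 1)) l.
  rewrite /l all_cat !all_map; apply/andP; split; apply/allP => p ps /=;
    have /allP /(_ p ps) /andP[p0 /eqP dp] := wgt_ge0 s.
    by rewrite divr_ge0//= dp.
  by rewrite divr_ge0//= det_mulmx dp dh mulr1.
have l1 : \sum_(p <- l) p.1 = 1.
  by rewrite /l big_cat !big_map/= -mulr_suml (wgt_sum s); field.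
exists (Cvx l0 l1) => y; rewrite scalerDr !scaler_sumr.
transitivity (\sum_(p <- wgt s) `|p.1 / 2| *: Ph p.2 y + \sum_(p <- wgt s) `|p.1 / 2| *: Ph (h *m p.2) y).
  by rewrite /cmb/= /l big_cat !big_map.
have E1 : \sum_(p <- wgt s) `|p.1 / 2| *: Ph p.2 y = \sum_(p <- wgt s) 2^-1 *: (`|p.1| *: Ph p.2 y).
  by apply: eq_bigr => p _; rewrite half scalerA.
have E2 : \sum_(p <- wgt s) `|p.1 / 2| *: Ph (h *m p.2) y =
    \sum_(p <- wgt s) 2^-1 *: (`|p.1| *: Ph p.2 (y *m h)).
  by apply: eq_bigr => p _; rewrite half scalerA PhM.
exact: (f_equal2 +%R E1 E2).
Qed.

(** Convexity of the squared norm passes the bound from the translates of [e] to their hull, so the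
    near-minimiser stays close to [e]. *)
Lemma Ex_cmb s tau : (forall h, \det h = 1 -> dist n0 Gsub Gdisc A e h <= tau) ->
  Ex (fun y => fsq (cmb s y - e)) <= tau.
Proof.
move=> ht.
have bP h : bm (fun y => fsq (Ph h y - e)).
  by apply: mbm_fdot; apply: mbmB; (exact: mbm_Ph || exact: mbm_cst).
apply: (@le_trans _ _ (Ex (fun y => \sum_(p <- wgt s) `|p.1| * fsq (Ph p.2 y - e)))).
  apply: (Ex_le n0 Gsub Gdisc Gfin).
  - by apply: mbm_fdot; apply: mbmB; (exact: mbm_cmb || exact: mbm_cst).
  - by apply: bm_sum => p; exact: bmZ.
  move=> y _; have -> : cmb s y - e = \sum_(p <- wgt s) `|p.1| *: (Ph p.2 y - e).
    by under eq_bigr do rewrite scalerBr; rewrite sumrB -scaler_suml w1 scale1r.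
  exact: fsq_jensen.
rewrite (Ex_sum n0 Gsub Gdisc Gfin); last by move=> p; exact: bmZ.
rewrite -[tau]mul1r -(w1 s) mulr_suml big_seq [leRHS]big_seq; apply: ler_sum => p ps.
rewrite (ExZ n0 Gsub Gdisc Gfin)// ler_wpM2l//.
apply: le_trans (ht _ (cvx_det ps)); rewrite /dist; apply: (Ex_le n0 Gsub Gdisc Gfin) => //.
  by apply: mbm_fdot; apply: mbmB; (exact: (mbm_fx n0 Gsub Gdisc e qA) || exact: mbm_cst).
by move=> y Dy; rewrite /fx /Ph alpha_D1.
Qed.

(* Unlike the norm at a point, the supremum over the orbit is Gam-invariant, so that its mean square
   is exactly invariant under right translations. *)
Definition orb (f : 'M[R]_n -> 'M[R]_m) (y : 'M[R]_n) (k : nat) : R := fsq (f (gam k *m y)).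
Definition nn (f : 'M[R]_n -> 'M[R]_m) (y : 'M[R]_n) : R := sups (orb f y) 0.

Lemma nnE f y : nn f y = sup [set fsq (f (g *m y)) | g in Gam].
Proof.
rewrite /nn /sups/=; congr sup; apply/seteqP; split => x /=.
  by move=> [k _ <-]; exists (gam k) => //; exact: gamG.
by move=> [g Gg <-]; exists (idx Gam g) => //; rewrite /orb idxK.
Qed.

Lemma nn_ge s y g : Gam g -> fsq (cmb s (g *m y)) <= nn (cmb s) y.
Proof.
move=> Gg; rewrite nnE; apply: ub_le_sup; last by exists g.
by exists 1 => _ [h Gh <-]; exact: fsq_cmb.
Qed.

Lemma nn_le f y c : (forall g, Gam g -> fsq (f (g *m y)) <= c) -> nn f y <= c.
Proof.
move=> h; rewrite nnE; apply: ge_sup; last by move=> _ [g Gg <-]; exact: h.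
by have [_ G1 _ _] := Gsub; exists (fsq (f (1%:M *m y))); exists 1%:M.
Qed.

Lemma bm_nn s : bm (nn (cmb s)).
Proof.
split; last first.
  exists 1 => y; rewrite ger0_norm; first by apply: nn_le => g _; exact: fsq_cmb.
  have [_ G1 _ _] := Gsub; apply: le_trans (nn_ge s y G1); exact: fdot_ge0.
apply: (@measurable_fun_sups _ _ R setT (fun k y => orb (cmb s) y k) 0).
  by move=> y _; exists 1 => _ [k _ <-]; exact: fsq_cmb.
move=> k; have [mf _] := mbm_fdot (mbm_cmb s) (mbm_cmb s).
apply: (measurableT_comp mf); apply: measurable_mulmx; [exact: measurable_cst|exact: measurable_id].
Qed.

Lemma nn_inv s : Ginv Gam (nn (cmb s)).
Proof.
move=> g y Gg dy; apply/le_anti/andP; split; apply: nn_le => h Gh.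
  by rewrite mulmxA; apply: nn_ge; exact: GM.
have Gg' : Gam (invmx g) by case: Gsub => _ _ _; apply.
have -> : h *m y = h *m invmx g *m (g *m y) by rewrite -mulmxA (mulKmx (Gam_unit Gsub Gg)).
by apply: nn_ge; exact: GM.
Qed.

(** Along an orbit, quasi-equivariance changes the norm of a difference of two values by at most 2
    del; after subtraction of this amount the bound from below holds at every point of the orbit. *)
Definition dd s h y : R := Num.max 0 (fnorm (cmb s (y *m h) - cmb s y) - 2 * del).

Lemma mbm_cmbr s h : mbm (fun y => cmb s (y *m h)).
Proof. by move=> i j; exact: (bm_mulr h (mbm_cmb s i j)). Qed.

Lemma bm_dd s h : bm (dd s h).
Proof.
apply: bm_max0; apply: bmB; last exact: bm_cst.
by apply: mbm_fnorm; apply: mbmB; [exact: mbm_cmbr|exact: mbm_cmb].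
Qed.

Lemma equiv_tri g P Q P' Q' : Gam g -> fnorm (P' - A g P) <= del -> fnorm (Q' - A g Q) <= del ->
  fnorm (P - Q) - 2 * del <= fnorm (P' - Q').
Proof.
move=> Gg h1 h2; have h3 : fnorm (P - Q) = fnorm (A g P - A g Q).
  by rewrite -(qrep_fnorm qA _ Gg) (qrep_D qA) -scaleN1r (qrep_Z qA) scaleN1r.
have h4 := fnormB (A g P) P' (A g Q); have h5 := fnormB P' Q' (A g Q).
rewrite fnormC in h1; rewrite h3; lra.
Qed.

Lemma mid_le (P Q : 'M[R]_m) (a b c : R) : fsq P <= a -> fsq Q <= b -> c <= fsq (Q - P) ->
  fsq (2^-1 *: (P + Q)) <= 2^-1 * a + 2^-1 * b - 4^-1 * c.
Proof.
rewrite /fsq !(fdotDl, fdotDr, fdotNl, fdotNr, fdotZl, fdotZr) (fdotC Q P); lra.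
Qed.

Lemma dd_le s h g y : \det h = 1 -> Gam g -> 0 < \det y ->
  dd s h y ^+ 2 <= fsq (cmb s (g *m (y *m h)) - cmb s (g *m y)).
Proof.
move=> dh Gg dy; rewrite -fnorm_sq; apply: lerXn2r; rewrite ?nnegrE ?fnorm_ge0//.
  by rewrite /dd le_max lexx.
rewrite /dd ge_max fnorm_ge0/=.
have dyh : 0 < \det (y *m h) by rewrite det_mulmx dh mulr1.
exact: (equiv_tri Gg (cmb_equiv s Gg dyh) (cmb_equiv s Gg dy)).
Qed.

(* Parallelogram identity at a near-minimiser of the mean of [nn] over the convex hull. *)
Lemma convex_min (eps : R) : 0 < eps -> exists s : cvx, forall h, \det h = 1 ->
  Ex (fun y => dd s h y ^+ 2) <= 4 * eps.
Proof.
move=> eps0.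
pose S := [set Ex (nn (cmb s)) | s in [set: cvx]].
have c0 : all (fun p : R * 'M[R]_n => (0 <= p.1) && (\det p.2 == 1)) [:: (1, 1%:M)].
  by rewrite /= ler01 det1 eqxx.
have c1 : \sum_(p <- [:: (1, 1%:M : 'M[R]_n)]) p.1 = 1 :> R by rewrite big_seq1.
have nn0 s y : 0 <= nn (cmb s) y.
  have [_ G1 _ _] := Gsub; apply: le_trans (nn_ge s y G1); exact: fdot_ge0.
have lbS : has_lbound S.
  by exists 0 => _ [s _ <-]; apply: (Ex_ge0 n0 Gsub Gdisc Gfin) => //; exact: bm_nn.
have infS : has_inf S by split => //; exists (Ex (nn (cmb (Cvx c0 c1)))); exists (Cvx c0 c1).
have [_ [s _ <-] hs] := inf_adherent eps0 infS.
exists s => h dh; have [t ht] := cmb_mid s dh.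
have It : inf S <= Ex (nn (cmb t)) by apply: (ge_inf lbS); exists t.
have bd2 : bm (fun y => dd s h y ^+ 2).
  by under eq_fun do rewrite expr2; apply: bmM; exact: bm_dd.
have bnh := bm_mulr h (bm_nn s).
have upper : Ex (nn (cmb t)) <= 2^-1 * Ex (nn (cmb s)) + 2^-1 * Ex (nn (cmb s)) - 4^-1 * Ex (fun y => dd s h y ^+ 2).
  have b1 := bmZ 2^-1 (bm_nn s); have b2 := bmZ 2^-1 bnh; have b3 := bmZ 4^-1 bd2.
  have x1 := ExB n0 Gsub Gdisc Gfin (bmD b1 b2) b3; have x2 := ExD n0 Gsub Gdisc Gfin b1 b2.
  have x3 := ExZ n0 Gsub Gdisc Gfin 2^-1 (bm_nn s); have x4 := ExZ n0 Gsub Gdisc Gfin 2^-1 bnh.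
  have x5 := ExZ n0 Gsub Gdisc Gfin 4^-1 bd2; have x6 := Ex_inv n0 Gsub Gdisc Gfin dh (bm_nn s) (@nn_inv s).
  have ar (T' N N' D a b b' c S' : R) : T' <= S' -> S' = a - c -> a = b + b' -> b = 2^-1 * N ->
      b' = 2^-1 * N' -> N' = N -> c = 4^-1 * D -> T' <= 2^-1 * N + 2^-1 * N - 4^-1 * D.
    by move=> h' E1 E2 E3 E4 E5 E6; move: h'; rewrite E1 E2 E3 E4 E5 E6.
  apply: (ar _ _ _ _ _ _ _ _ _ _ x1 x2 x3 x4 x6 x5).
  apply: (Ex_le n0 Gsub Gdisc Gfin (bm_nn t) (bmB (bmD b1 b2) b3)).
  move=> y [dy _ _]; apply: nn_le => g Gg.
  (* The parallelogram identity is applied at each point of the orbit; as [dd] bounds all the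
     differences from below, the gain survives the supremum. *)
  have a1 := nn_ge s y Gg; have a2 := nn_ge s (y *m h) Gg; have a3 := dd_le s dh Gg dy.
  have E : g *m y *m h = g *m (y *m h) by rewrite mulmxA.
  by rewrite ht E; exact: mid_le a1 a2 a3.
have ar (I a b c : R) : I <= a -> b < I + eps -> a <= 2^-1 * b + 2^-1 * b - 4^-1 * c -> c <= 4 * eps.
  by lra.
exact: ar It hs upper.
Qed.
End Convex.

(** * From near-invariant functions back to the lattice *)

Lemma fubini_sections (R : realType) d1 d2 (T1 : measurableType d1) (T2 : measurableType d2)
    (m1 : {sigma_finite_measure set T1 -> \bar R}) (m2 : {sigma_finite_measure set T2 -> \bar R})
    (W : set (T1 * T2)) (G : set T1) (Z : set T2) (b c : \bar R) :
  measurable W -> measurable G -> measurable Z -> (0 <= b)%E ->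
  (forall y z, W (y, z) -> Z z) ->
  (forall z, Z z -> m1 (ysection W z) <= c)%E ->
  (forall y, G y -> b <= m2 (xsection W y))%E ->
  (b * m1 G <= c * m2 Z)%E.
Proof.
move=> mW mG mZ b0 WZ hz hy.
have mx := measurable_fun_xsection m2 mW; have my := measurable_fun_ysection m1 mW.
have E : (\int[m1]_y m2 (xsection W y) = \int[m2]_z m1 (ysection W z))%E.
  have := indic_fubini_tonelli m1 m2 mW.
  by rewrite indic_fubini_tonelli_FE// indic_fubini_tonelli_GE.
rewrite -(integral_cst m1 mG b) -(integral_cst m2 mZ c).
apply: (@le_trans _ _ (\int[m1]_(y in G) m2 (xsection W y))%E).
  by apply: ge0_le_integral => //; exact: measurable_funTS.
apply: (@le_trans _ _ (\int[m1]_y m2 (xsection W y))%E).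
  by apply: ge0_subset_integral.
have -> : (\int[m1]_y m2 (xsection W y) = \int[m2]_(z in Z) m1 (ysection W z))%E.
  rewrite E [RHS]integral_mkcond; apply: eq_integral => z _; rewrite patchE.
  case: ifPn => // nZ; rewrite [ysection W z](_ : _ = set0) ?measure0//.
  apply/seteqP; split => // y; rewrite /ysection/= inE => /WZ Zz.
  by move: nZ; rewrite mem_set.
by apply: ge0_le_integral => //; exact: measurable_funTS.
Qed.

Lemma measurable_ltset (R : realType) d (T : measurableType d) (f g : T -> R) :
  measurable_fun setT f -> measurable_fun setT g -> measurable [set y | f y < g y].
Proof.
move=> mf mg; have := measurable_fun_ltr mf mg measurableT (_ : measurable [set true]).
by rewrite setTI; apply.
Qed.

Lemma mulmx_entry_le (R : realType) (n : nat) (X Y : 'M[R]_n) (a b : R) : 0 <= a ->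
  (forall i j, `|X i j| <= a) -> (forall i j, `|Y i j| <= b) ->
  forall i j, `|(X *m Y) i j| <= n%:R * (a * b).
Proof.
move=> a0 hX hY i j; rewrite mxE (le_trans (ler_norm_sum _ _ _))//.
apply: (@le_trans _ _ (\sum_(k < n) (a * b))); last by rewrite sumr_const card_ord mulr_natl.
by apply: ler_sum => k _; rewrite normrM ler_pM.
Qed.

Lemma measurable_adj (R : realType) (n : nat) (i j : 'I_n) :
  measurable_fun setT (fun X : 'M[R]_n => (\adj X) i j).
Proof.
rewrite (_ : (fun X => _) = fun X : 'M[R]_n => (-1) ^+ (j + i) * \det (row' j (col' i X))); last first.
  by apply/funext => X; rewrite mxE.
apply: measurable_funM => //.
apply: (measurableT_comp (@measurable_det R n.-1)).
apply: measurable_mxP => p q.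
rewrite (_ : (fun X => _) = fun X : 'M[R]_n => X (lift j p) (lift i q)); first exact: measurable_entry.
by apply/funext => X; rewrite !mxE.
Qed.

Section InverseBound.
Variables (R : realType) (n m : nat) (Gam : 'M[R]_n -> Prop).
Hypothesis n0 : (0 < n)%N.
Hypothesis Gsub : is_subgroup_SL Gam.
Hypothesis Gdisc : discrete_set Gam.
Hypothesis Gfin : finite_covolume Gam.
Notation lam := (@mxleb R n).
Notation pr := (pr n0 Gsub Gdisc).
Notation Ex := (Ex n0 Gsub Gdisc).
Notation mass := (mass n0 Gsub Gdisc).

(** For det y > 0 these are the matrices whose inverse has an entry of absolute value larger than
    [M]; the adjugate avoids a division. *)
Definition unbnd (M : nat) : set 'M[R]_n :=
  [set y | exists ij : 'I_n * 'I_n, M%:R * \det y < `|(\adj y) ij.1 ij.2|].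

Lemma measurable_unbnd M : measurable (unbnd M).
Proof.
rewrite (_ : unbnd M = \bigcup_(ij in [set: 'I_n * 'I_n]) [set y | M%:R * \det y < `|(\adj y) ij.1 ij.2|]).
  apply: fin_bigcup_measurable; first exact: (@finite_finset _ [set: _]).
  move=> ij _; apply: measurable_ltset.
    by apply: measurable_funM => //; exact: measurable_det.
  by apply: measurableT_comp => //; exact: measurable_adj.
by apply/seteqP; split => y /= [ij]; [exists ij|move=> _ h; exists ij].
Qed.

Lemma pr_unbnd : exists M : nat, pr (unbnd M) <= 4^-1.
Proof.
have : pr (unbnd M) @[M --> \oo] --> (0 : R).
  apply: (pr_cvg0 n0 Gsub Gdisc Gfin measurable_unbnd) => y dy.
  pose s := \sum_(ij : 'I_n * 'I_n) `|(\adj y) ij.1 ij.2|.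
  have s0 : 0 <= s by apply: sumr_ge0.
  near=> M => -[ij]; apply/negP; rewrite -leNgt.
  apply: (@le_trans _ _ s).
    by rewrite /s (bigD1 ij)//= lerDl sumr_ge0.
  rewrite -ler_pdivrMr//; near: M; exact: nbhs_infty_ger.
have h4 : (0 : R) < 4^-1 by rewrite invr_gt0.
move=> /cvgr0Pnorm_lt /(_ _ h4)[M _ /(_ M (leqnn M))] h; exists M.
by apply: ltW; apply: le_lt_trans h; exact: ler_norm.
Unshelve. all: by end_near. Qed.

Lemma inv_bnd M (y : 'M[R]_n) : 0 < \det y -> ~ unbnd M y -> forall i j, `|(invmx y) i j| <= M%:R.
Proof.
move=> dy hy i j; have uy : y \in unitmx by rewrite unitmxE unitfE gt_eqF.
rewrite /invmx uy mxE normrM gtr0_norm ?invr_gt0// ler_pdivrMl// mulrC.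
by rewrite leNgt; apply/negP => h; apply: hy; exists (i, j).
Qed.

(** y^-1 is a dilation by t^-1 >= 1 times a matrix of determinant 1, and taking preimages under
    either does not increase the measure. *)
Lemma lam_invl (y : 'M[R]_n) (S : set 'M[R]_n) : 0 < \det y -> \det y <= 1 -> measurable S ->
  measurable [set x | S (invmx y *m x)] /\ (lam [set x | S (invmx y *m x)] <= lam S)%E.
Proof.
move=> dy dy1 mS; split; first exact: (measurable_mull_preimage _ mS).
have [t t0 [tn dt]] := SL_normalize n0 dy.
pose g := t^-1 *: y; have ug : g \in unitmx by rewrite unitmxE dt unitr1.
have t1 : 1 <= t^-1.
  rewrite invf_ge1//; rewrite leNgt; apply/negP => t1.
  have : 1 < t ^+ n by rewrite exprn_egt1// -lt0n.
  by rewrite tn ltNge dy1.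
have yE : invmx y = t^-1 *: invmx g.
  have uy : y \in unitmx by rewrite unitmxE unitfE gt_eqF.
  have yg : y = t *: g by rewrite /g scalerA divff ?scale1r// lt0r_neq0.
  by rewrite {1}yg invmxZ// -yg.
have dgi : \det (invmx g) = 1 by rewrite det_inv dt invr1.
rewrite (_ : [set x | _] = [set x | [set z | S (t^-1 *: z)] (invmx g *m x)]); last first.
  by apply/seteqP; split => x /=; rewrite yE scalemxAl.
have [mf hf] := @ncr_mxscale R n _ t1.
have mS' : measurable [set z : 'M[R]_n | S (t^-1 *: z)].
  by rewrite -[X in measurable X]setTI; exact: mf.
rewrite (mxleb_SLl dgi mS'); exact: hf.
Qed.
End InverseBound.

Section OrbitComparison.
Variables (R : realType) (n m : nat) (Gam : 'M[R]_n -> Prop).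
Hypothesis n0 : (0 < n)%N.
Hypothesis Gsub : is_subgroup_SL Gam.
Hypothesis Gdisc : discrete_set Gam.
Hypothesis Gfin : finite_covolume Gam.
Variables (A : 'M[R]_n -> 'M[R]_m -> 'M[R]_m) (del : R) (e : 'M[R]_m).
Hypothesis qA : qrep Gam A del.
Hypothesis del0 : 0 < del.
Hypothesis e1 : fsq e = 1.
Notation lam := (@mxleb R n).
Notation pr := (pr n0 Gsub Gdisc).
Notation Ex := (Ex n0 Gsub Gdisc).
Notation Pm := (Pm n0 Gsub Gdisc).
Notation mass := (mass n0 Gsub Gdisc).
Notation cmb := (cmb Gam A e).
Notation D1 := (D1 Gam).

Lemma Pm_pr S : measurable S -> lam (S `&` D1) = (mass * pr S)%:E.
Proof.
move=> mS; have m0 := mass_gt0 n0 Gsub Gdisc Gfin.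
have f : Pm S \is a fin_num.
  rewrite ge0_fin_numE//; apply: (@le_lt_trans _ _ (Pm setT)); last by rewrite (PmT n0 Gsub Gdisc Gfin) ltry.
  by apply: le_measure; rewrite ?inE.
by rewrite (prE n0 Gsub Gdisc mS) mulrA mulfV ?gt_eqF// mul1r fineK.
Qed.

Let mbad s : mbm (fun p : 'M[R]_n * 'M[R]_n => cmb s (p.1 *m p.2) - cmb s p.1).
Proof.
apply: mbmB => i j; apply: (mbm_comp (mbm_cmb n0 Gsub Gdisc e qA s)).
  by apply: measurable_mulmx; [exact: measurable_fst|exact: measurable_snd].
exact: measurable_fst.
Qed.

Let bad s : set ('M[R]_n * 'M[R]_n) := [set p | 3 * del < fnorm (cmb s (p.1 *m p.2) - cmb s p.1)].

Let measurable_bad s : measurable (bad s).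
Proof. by apply: measurable_ltset => //; have [] := mbm_fnorm (mbad s). Qed.

Let badz s z : measurable [set y | bad s (y, z)].
Proof.
have [mf _] := mbm_fnorm (mbad s); apply: measurable_ltset => //.
apply: (@measurableT_comp _ _ _ _ _ _ _ _ (fun y : 'M[R]_n => (y, z)) mf).
exact: measurable_pair2.
Qed.

(** Invariance of [cmb] under scaling reduces [z] to determinant 1. On bad pairs [dd] exceeds [del],
    since only 2 del of the 3 del are subtracted in it, and Chebyshev's inequality applies. *)
Let pr_bad s eps z : 0 < \det z ->
  (forall h, \det h = 1 -> Ex (fun y => dd Gam A del e s h y ^+ 2) <= 4 * eps) ->
  pr [set y | bad s (y, z)] <= 4 * eps / del ^+ 2.
Proof.
move=> dz hs; have [t t0 [_ dt]] := SL_normalize n0 dz.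
set h := t^-1 *: z in dt.
have d2 : 0 < del ^+ 2 by rewrite exprn_gt0.
rewrite ler_pdivlMr// mulrC; apply: le_trans (hs h dt).
have b1 : bm (\1_[set y | bad s (y, z)] : 'M[R]_n -> R) by apply: bm_indic; exact: badz.
have bd := bm_dd n0 Gsub Gdisc e qA s h.
rewrite /pr -(ExZ n0 Gsub Gdisc Gfin _ b1); apply: (Ex_le n0 Gsub Gdisc Gfin).
- exact: bmZ.
- by under eq_fun do rewrite expr2; exact: bmM.
move=> y [dy _ _]; rewrite indicE.
have [By|By] := pselect (bad s (y, z)); last first.
  by rewrite memNset//= mulr0 sqr_ge0.
rewrite mem_set//= mulr1; apply: lerXn2r; rewrite ?nnegrE ?(ltW del0)//.
  by rewrite /dd le_max lexx.
rewrite /dd le_max; apply/orP; right.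
have zE : y *m z = t *: (y *m h) by rewrite /h -scalemxAr scalerA mulfV ?scale1r// lt0r_neq0.
have dyh : 0 < \det (y *m h) by rewrite det_mulmx dt mulr1.
move: By; rewrite /bad/= zE (cmb_scale n0 Gsub Gdisc A e s t0 dyh).
by move: (fnorm _) => x; lra.
Qed.

(** To be used with [P], [Q], [Q'] the values of [cmb s] at y1, x and ga x. The path from A ga e to
    e passes through A ga Q, Q' and P. *)
Lemma fnorm_chain ga (P Q Q' : 'M[R]_m) (t : R) : Gam ga ->
  fnorm (Q - P) <= 3 * del -> fnorm (Q' - P) <= 3 * del ->
  fnorm (Q' - A ga Q) <= del -> fnorm (P - e) <= 2 * t ->
  fnorm (A ga e - e) <= 4 * t + 7 * del.
Proof.
move=> Gga k1 k2 k3 k4.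
have j1 := fnormB (A ga e) (A ga Q) e; have j2 := fnormB (A ga Q) Q' e; have j3 := fnormB Q' P e.
have AB : A ga (e - Q) = A ga e - A ga Q.
  by rewrite (qrep_D qA) -[- Q]scaleN1r (qrep_Z qA) scaleN1r.
rewrite -AB (qrep_fnorm qA _ Gga) in j1.
have j5 := fnormB e P Q.
rewrite fnormC in k3; rewrite (fnormC e P) (fnormC P Q) in j5.
lra.
Qed.

(* A near-invariant [cmb s] is, by Fubini, almost equal to its value at some [y1] at most points [x]
   and [ga *m x]; comparing both through the equivariance [cmb_equiv] moves [e] by little. *)
Lemma extract (ga : 'M[R]_n) (tau : R) : Gam ga -> 0 < tau ->
  (forall h, \det h = 1 -> dist n0 Gsub Gdisc A e h <= tau) ->
  fnorm (A ga e - e) <= 4 * Num.sqrt tau + 7 * del.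
Proof.
move=> Gga tau0 hdist.
have sq4 : (2 * Num.sqrt tau) ^+ 2 = 4 * tau.
  by rewrite exprMn sqr_sqrtr ?(ltW tau0)// expr2 -natrM.
have m0 := mass_gt0 n0 Gsub Gdisc Gfin.
have dga : \det ga = 1 by case: Gsub => h _ _ _; exact: h.
have [M hM] := pr_unbnd n0 Gsub Gdisc Gfin.
have [r [r0 hr]] := @Omega1_box R n n0.
pose lo : 'M[R]_n := (2^-1)%:M - const_mx (r / 2); pose hi : 'M[R]_n := (2^-1)%:M + const_mx (r / 2).
have lohi i j : lo i j <= hi i j by rewrite !mxE; lra.
pose S := [set X : 'M[R]_n | in_box lo hi X].
have mS : measurable S by exact: measurable_in_box.
have lamS : lam S = (box_vol lo hi)%:E by exact: mxleb_box.
pose vS := box_vol lo hi.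
have vS0 : 0 < vS by apply: prodr_gt0 => -[i j] _; rewrite !mxE/=; lra.
have Sin X : S X -> forall i j, `|X i j - (2^-1)%:M i j| <= r / 2.
  move=> hX i j; have := hX i j; rewrite /lo /hi !mxE ler_norml => /andP[h1 h2].
  by apply/andP; split; lra.
have Sdet X : S X -> 0 < \det X.
  move=> /Sin hX; apply: (hr X _).1 => i j; apply: le_lt_trans (hX i j) _; lra.
pose cS := 1 + r.
have Sbnd X : S X -> forall i j, `|X i j| <= cS.
  move=> /Sin hX i j; rewrite -[X i j](subrK ((2^-1)%:M i j)) (le_trans (ler_normD _ _))//.
  have : `|(2^-1)%:M i j| <= 2^-1 :> R.
    by rewrite mxE; case: eqP => _; rewrite ?mulr1n ?mulr0n ?normr0 ?ger0_norm ?invr_ge0.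
  by have := hX i j; rewrite /cS; move: (`|_|) (`|_|) => u v; lra.
pose ag := \sum_i \sum_j `|ga i j|.
have ag0 : 0 <= ag by apply: sumr_ge0 => i _; apply: sumr_ge0.
have agB i j : `|ga i j| <= ag.
  rewrite /ag (bigD1 i)//= (bigD1 j)//= -addrA lerDl addr_ge0 ?sumr_ge0// => k _.
  by rewrite sumr_ge0.
pose cT := cS + n%:R * (ag * cS).
have cS0 : 0 <= cS by rewrite /cS; lra.
have q0 : 0 <= n%:R * (ag * cS) by rewrite !mulr_ge0.
have T1 X : S X -> forall i j, `|X i j| <= cT.
  by move=> /Sbnd hX i j; rewrite (le_trans (hX i j))// /cT lerDl.
have T2 X : S X -> forall i j, `|(ga *m X) i j| <= cT.
  move=> /Sbnd hX i j; rewrite (le_trans (mulmx_entry_le ag0 agB hX i j))// /cT lerDr//.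
have M0 : 0 <= M%:R :> R by rewrite ler0n.
pose cZ := n%:R * (M%:R * cT).
have cZ0 : 0 <= cZ by rewrite !mulr_ge0// /cT addr_ge0.
(* This box contains y1^-1 x and y1^-1 ga x for all x in [S], provided the entries of y1^-1 are
   bounded by [M]. *)
pose bZ := [set z : 'M[R]_n | in_box (const_mx (- cZ)) (const_mx cZ) z].
pose vZ : R := box_vol (const_mx (- cZ) : 'M[R]_n) (const_mx cZ).
have lambZ : lam bZ = vZ%:E by apply: mxleb_box => i j; rewrite !mxE; lra.
have vZ0 : 0 <= vZ by apply: prodr_ge0 => -[i j] _; rewrite !mxE/=; lra.
pose Z := bZ `&` Omega (R:=R) (n:=n).
have mZ : measurable Z by apply: measurableI; [exact: measurable_in_box|exact: measurable_Omega].
have lamZ : (lam Z <= vZ%:E)%E.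
  have mbZ : measurable bZ by exact: measurable_in_box.
  by rewrite -lambZ; apply: le_measure; rewrite ?inE// => z [].
have d2 : 0 < del ^+ 2 by rewrite exprn_gt0.
(* Chosen after [ga], through the volume of [Z]. The factor 48 bounds the measure of bad pairs by
   mass vS / 12, below the mass vS / 6 that would result if all sections over [G] had measure at
   least vS / 3. *)
pose eps := del ^+ 2 * vS / (48 * (vZ + 1)).
have vZ1 : 0 < 48 * (vZ + 1) by apply: mulr_gt0; lra.
have eps0 : 0 < eps by rewrite divr_gt0// mulr_gt0.
have [s hs] := convex_min n0 Gsub Gdisc Gfin qA (ltW del0) e1 eps0.
(* The threshold is four times the bound on the mean, so this set has probability at most 1/4; with
   [unbnd], at most half of the mass is lost. *)
pose N2 := [set y | 4 * tau < fsq (cmb s y - e)].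
have bN : bm (fun y => fsq (cmb s y - e)).
  by apply: mbm_fdot; apply: mbmB; (exact: (mbm_cmb n0 Gsub Gdisc e qA) || exact: mbm_cst).
have mN2 : measurable N2 by apply: measurable_ltset => //; have [] := bN.
have mN1 := @measurable_unbnd R n M.
have prN2 : pr N2 <= 4^-1.
  have := Ex_cmb Gfin qA s hdist.
  have b1 : bm (\1_N2 : 'M[R]_n -> R) by exact: bm_indic.
  have : (4 * tau) * pr N2 <= Ex (fun y => fsq (cmb s y - e)).
    rewrite /pr -(ExZ n0 Gsub Gdisc Gfin _ b1); apply: (Ex_le n0 Gsub Gdisc Gfin) => //.
      exact: bmZ.
    move=> y _; rewrite indicE; have [Ny|Ny] := pselect (N2 y).
      by rewrite mem_set//= mulr1 ltW.
    by rewrite memNset//= mulr0 fdot_ge0.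
  move=> h1 h2; have h3 := le_trans h1 h2; move: h3; move: (pr N2) => x h3.
  by rewrite -(ler_pM2l tau0); lra.
pose G := D1 `&` ~` (unbnd (R:=R) (n:=n) M `|` N2).
have mG0 : measurable (~` (unbnd (R:=R) (n:=n) M `|` N2)) by apply: measurableC; exact: measurableU.
have mD1 : measurable D1 := measurable_D1 n0 Gsub Gdisc.
have mG : measurable G by exact: measurableI.
have lamG : ((mass / 2)%:E <= lam G)%E.
  have pT : pr setT = 1 by rewrite /pr indicT (Ex_cst n0 Gsub Gdisc Gfin).
  rewrite /G setIC Pm_pr// lee_fin ler_wpM2l ?(ltW m0)//.
  have u1 := prU n0 Gsub Gdisc Gfin mN1 mN2.
  have u2 := prU n0 Gsub Gdisc Gfin (measurableU _ _ mN1 mN2) mG0.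
  rewrite setUv pT in u2.
  by move: u1 u2 hM prN2; move: (pr _) (pr _) (pr _) (pr _) => a b c d; lra.
pose W := [set p | G p.1 /\ Z p.2 /\ bad s p].
have mW : measurable W.
  rewrite (_ : W = (fst @^-1` G) `&` ((snd @^-1` Z) `&` bad s)); last by [].
  apply: measurableI; first by rewrite -[X in measurable X]setTI; exact: measurable_fst.
  apply: measurableI => //; by rewrite -[X in measurable X]setTI; exact: measurable_snd.
pose c := mass * (4 * eps / del ^+ 2).
have hz z : Z z -> (lam (ysection W z) <= c%:E)%E.
  move=> [_ dz]; apply: (@le_trans _ _ (lam ([set y | bad s (y, z)] `&` D1))).
    apply: le_measure; rewrite ?inE; first exact: measurable_ysection.
      by apply: measurableI => //; exact: badz.
    by move=> y; rewrite /ysection/= inE => -[[Dy _] [_ By]].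
  rewrite Pm_pr ?lee_fin; last exact: badz.
  by rewrite ler_wpM2l ?(ltW m0)//; apply: pr_bad.
have [y1 [[D1y Ny1] hy1]] : exists y, G y /\ (lam (xsection W y) < (vS / 3)%:E)%E.
  apply: contrapT => H.
  have hy y : G y -> ((vS / 3)%:E <= lam (xsection W y))%E.
    by move=> Gy; rewrite leNgt; apply/negP => h; apply: H; exists y.
  have v3 : (0 <= (vS / 3)%:E)%E by rewrite lee_fin divr_ge0// ltW.
  have WZ y z : W (y, z) -> Z z by move=> [_ []].
  have := fubini_sections (m1 := lam) (m2 := lam) mW mG mZ v3 WZ hz hy.
  apply/negP; rewrite -ltNge.
  have c0 : 0 <= c by rewrite /c mulr_ge0 ?(ltW m0)// divr_ge0 ?(ltW d2)// mulr_ge0// ltW.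
  apply: (@le_lt_trans _ _ (c%:E * vZ%:E)%E); first by apply: lee_pmul.
  apply: (@lt_le_trans _ _ ((vS / 3)%:E * (mass / 2)%:E)%E); last exact: lee_wpmul2l.
  rewrite -!EFinM lte_fin.
  have cE : c * vZ = mass * vS / 12 * (vZ / (vZ + 1)) by rewrite /c /eps; field; rewrite !gt_eqF//; lra.
  have z1 : vZ / (vZ + 1) <= 1 by rewrite ler_pdivrMr; lra.
  have mv : 0 < mass * vS by rewrite mulr_gt0.
  rewrite cE; apply: (@le_lt_trans _ _ (mass * vS / 12 * 1)).
    by rewrite ler_wpM2l// divr_ge0// ltW.
  have -> : vS / 3 * (mass / 2) = mass * vS / 6 by field.
  by move: mv; move: (mass * vS) => x; lra.
have [dy1 dy1' _] := D1y.
pose X := xsection W y1.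
have mX : measurable X by exact: measurable_xsection.
have [mB1 lB1] := lam_invl n0 dy1 dy1' mX.
pose B1 := [set x | X (invmx y1 *m x)]; pose B2 := [set x | B1 (ga *m x)].
have mB2 : measurable B2 by exact: (measurable_mull_preimage _ mB1).
have lB2 : lam B2 = lam B1 by exact: (mxleb_SLl dga mB1).
(* [B1] and [B2] each have less than a third of the measure of [S], so a point of [S] outside both
   remains. *)
have [x [Sx nB1 nB2]] : exists x, [/\ S x, ~ B1 x & ~ B2 x].
  apply: contrapT => H.
  have SB : S `<=` B1 `|` B2.
    move=> x Sx; apply: contrapT => h; apply: H; exists x.
    split; [exact: Sx|move=> h'; apply: h; left; exact: h'|move=> h'; apply: h; right; exact: h'].
  have h1 : (lam S <= lam B1 + lam B2)%E.
    have mB12 : measurable (B1 `|` B2) by exact: (measurableU _ _ mB1 mB2).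
    have k1 := @measureU2 _ _ _ lam B1 B2 mB1 mB2.
    have k2 := @le_measure _ _ _ lam _ _ (mem_set mS) (mem_set mB12) SB.
    exact: le_trans k2 k1.
  have h2 : (lam B1 < (vS / 3)%:E)%E := le_lt_trans lB1 hy1.
  have h3 : (lam B2 < (vS / 3)%:E)%E := eq_ind_r (fun u => u < (vS / 3)%:E)%E h2 lB2.
  have h4 : (lam S < (vS / 3)%:E + (vS / 3)%:E)%E := le_lt_trans h1 (lteD h2 h3).
  by move: h4; rewrite lamS -EFinD lte_fin -/vS; move: vS0; move: (vS) => u; lra.
have uy1 : y1 \in unitmx by rewrite unitmxE unitfE gt_eqF.
have inZ x' : 0 < \det x' -> (forall i j, `|x' i j| <= cT) -> Z (invmx y1 *m x').
  move=> dx' hx'; split; last first.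
    by rewrite /Omega/= det_mulmx det_inv; apply: mulr_gt0; [rewrite invr_gt0|exact: dx'].
  move=> i j; rewrite !mxE -ler_norml; have nu : ~ unbnd M y1 by move=> h; apply: Ny1; left.
  have := mulmx_entry_le M0 (inv_bnd dy1 nu) hx' i j.
  by rewrite mxE.
have good x' : 0 < \det x' -> (forall i j, `|x' i j| <= cT) -> ~ B1 x' ->
    fnorm (cmb s x' - cmb s y1) <= 3 * del.
  move=> dx' hx' nB; rewrite leNgt; apply/negP => h; apply: nB.
  rewrite /B1 /X /xsection/= inE; split; first by split.
  by split; [exact: inZ|rewrite /bad/= mulKVmx].
have g1 := good x (Sdet _ Sx) (T1 _ Sx) nB1.
have g2 : fnorm (cmb s (ga *m x) - cmb s y1) <= 3 * del.
  apply: good; [|exact: (T2 _ Sx)|exact: nB2].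
  by rewrite det_mulmx dga mul1r; exact: (Sdet _ Sx).
have g3 := cmb_equiv n0 Gsub Gdisc qA (ltW del0) e1 s Gga (Sdet _ Sx).
have g4 : fnorm (cmb s y1 - e) <= 2 * Num.sqrt tau.
  rewrite fnorm_leP; last by rewrite mulr_ge0// sqrtr_ge0.
  rewrite sq4.
  by rewrite leNgt; apply/negP => h; apply: Ny1; right; exact: h.
exact: (fnorm_chain Gga g1 g2 g3 g4).
Qed.
End OrbitComparison.

(** * Frobenius norms of products and the case of orthogonal matrices *)

Section FrobeniusMul.
Context {R : realType} {m : nat}.
Implicit Types X Y P : 'M[R]_m.

Lemma fdot_tr X Y : fdot X Y = \tr (X^T *m Y).
Proof.
rewrite /fdot /mxtrace exchange_big/=; apply: eq_bigr => j _; rewrite mxE.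
by apply: eq_bigr => i _; rewrite mxE.
Qed.

Lemma fdot_mull P X Y : P^T *m P = 1%:M -> fdot (P *m X) (P *m Y) = fdot X Y.
Proof. by move=> hP; rewrite !fdot_tr trmx_mul -mulmxA (mulmxA P^T) hP mul1mx. Qed.

Lemma fdot_mulr P X Y : P *m P^T = 1%:M -> fdot (X *m P) (Y *m P) = fdot X Y.
Proof.
move=> hP; rewrite !fdot_tr trmx_mul -mulmxA mxtrace_mulC -!mulmxA hP mulmx1.
by [].
Qed.

Lemma sum_CS (I : finType) (a b : I -> R) :
  (\sum_i a i * b i) ^+ 2 <= (\sum_i a i ^+ 2) * (\sum_i b i ^+ 2).
Proof.
set c := \sum_i a i * b i; set p := \sum_i a i ^+ 2; set q := \sum_i b i ^+ 2.
have h t u : 0 <= t ^+ 2 * p - 2 * (t * u) * c + u ^+ 2 * q.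
  rewrite /p /q /c !mulr_sumr -sumrB -big_split/=; apply: sumr_ge0 => i _.
  by rewrite [leRHS](_ : _ = (t * a i - u * b i) ^+ 2) ?sqr_ge0//; ring.
have p0 : 0 <= p by apply: sumr_ge0 => i _; exact: sqr_ge0.
have [p1|p1] := eqVneq p 0.
  have a0 i : a i = 0.
    have : a i ^+ 2 <= p by rewrite /p (bigD1 i)//= lerDl; apply: sumr_ge0 => k _; exact: sqr_ge0.
    by rewrite p1 => hi; apply/eqP; rewrite -sqrf_eq0 eq_le hi sqr_ge0.
  by rewrite /c big1 ?expr0n ?p1 ?mul0r// => i _; rewrite a0 mul0r.
have := h c p; rewrite [leRHS](_ : _ = p * (p * q - c ^+ 2)); last by ring.
by rewrite pmulr_rge0 ?subr_ge0// lt_def p1.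
Qed.

Lemma fnormM X Y : fnorm (X *m Y) <= fnorm X * fnorm Y.
Proof.
rewrite fnorm_leP ?mulr_ge0 ?fnorm_ge0// exprMn !fnorm_sq /fsq /fdot.
rewrite mulr_suml; apply: ler_sum => i _.
have -> : \sum_i \sum_j Y i j * Y i j = \sum_j \sum_k Y k j ^+ 2.
  by rewrite exchange_big.
rewrite mulr_sumr; apply: ler_sum => j _; rewrite -expr2 mxE.
by apply: (le_trans (sum_CS _ _)).
Qed.

Lemma fnorm_mulr P X : P *m P^T = 1%:M -> fnorm (X *m P) = fnorm X.
Proof. by move=> hP; rewrite /fnorm /fsq fdot_mulr. Qed.

Lemma fsq1 : fsq (1%:M : 'M[R]_m) = m%:R.
Proof. by rewrite /fsq fdot_tr trmx1 mulmx1 mxtrace1. Qed.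

Lemma fnorm_orth P : P^T *m P = 1%:M -> fnorm P = Num.sqrt m%:R.
Proof. by move=> hP; rewrite /fnorm /fsq fdot_tr hP mxtrace1. Qed.
End FrobeniusMul.

Section Core.
Variables (R : realType) (n : nat) (Gam : 'M[R]_n -> Prop).
Hypothesis n3 : (3 <= n)%N.
Hypothesis Gsub : is_subgroup_SL Gam.
Hypothesis Gdisc : discrete_set Gam.
Hypothesis Gfin : finite_covolume Gam.

Lemma real_core (m : nat) (eps : R) : (0 < m)%N -> 0 < eps ->
  exists (B : seq 'M[R]_n) (k0 : R), [/\ forall g, g \in B -> Gam g, 0 < k0 &
   forall mu nu : 'M[R]_n -> 'M[R]_m,
    (forall g, Gam g -> (mu g)^T *m mu g = 1%:M) -> (forall g, Gam g -> (nu g)^T *m nu g = 1%:M) ->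
    mu 1%:M = 1%:M ->
    (forall g h, Gam g -> Gam h -> nu (g *m h) = nu g *m nu h) ->
    (forall g h, Gam g -> Gam h -> fnorm (mu (g *m h) - mu g *m mu h) <= k0) ->
    (forall g, g \in B -> fnorm (mu g - nu g) <= k0) ->
    forall g, Gam g -> fnorm (mu g - nu g) <= eps].
Proof.
move=> m0 eps0; have n0 : (0 < n)%N by exact: leq_trans n3.
have G1 : Gam 1%:M by case: Gsub.
have sm0 : 0 < Num.sqrt m%:R :> R by rewrite sqrtr_gt0 ltr0n.
have sm1 : 1 <= Num.sqrt m%:R :> R by rewrite -{1}(@sqrtr1 R) ler_wsqrtr// ler1n.
set sm := Num.sqrt m%:R in sm0 sm1.
(* After multiplication by sm, the term 4 sqrt tau of [extract] is eps / 2, and the choice of [del]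
   below bounds the term 7 del by eps / 2. *)
pose tau := (eps / (8 * sm)) ^+ 2.
have t0 : 0 < eps / (8 * sm) by rewrite divr_gt0// mulr_gt0.
have tau0 : 0 < tau by rewrite exprn_gt0.
have [B [k0 [BG k00 hk]]] := dist_SL n3 n0 Gsub Gdisc Gfin tau0.
pose del := Num.min k0 (eps / (14 * sm)).
have del0 : 0 < del by rewrite lt_min k00 divr_gt0// mulr_gt0.
have delk : del <= k0 by rewrite ge_min lexx.
have dele : del <= eps / (14 * sm) by rewrite ge_min lexx orbT.
exists B, del; split => // mu nu Omu Onu mu1 nuM mud munu.
have Onu' g : Gam g -> nu g *m (nu g)^T = 1%:M by move=> /Onu /mulmx1C.
have nu1 : nu 1%:M = 1%:M.
  have := nuM _ _ G1 G1; rewrite mulmx1 => h; have := Onu' _ G1; rewrite {1}h => h'.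
  by move: h'; rewrite -mulmxA Onu'// mulmx1.
pose A (g : 'M[R]_n) (X : 'M[R]_m) := mu g *m X *m (nu g)^T.
pose e : 'M[R]_m := sm^-1 *: 1%:M.
have sm2 : sm * sm = m%:R by rewrite -expr2 sqr_sqrtr// ler0n.
have e1 : fsq e = 1.
  rewrite /e /fsq fdotZl fdotZr -/(fsq _) fsq1 -sm2; field; exact: lt0r_neq0.
have Ae g : Gam g -> fnorm (A g e - e) = sm^-1 * fnorm (mu g - nu g).
  move=> Gg; rewrite -(@fnorm_mulr _ _ (nu g) (A g e - e)); last exact: Onu'.
  rewrite mulmxBl /A /e -!scalemxAr mulmx1 -!scalemxAl mul1mx -mulmxA Onu// mulmx1.
  by rewrite -scalerBr fnormZ ger0_norm// invr_ge0 ltW.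
have qA : qrep Gam A del.
  split.
  - by move=> g X Y; rewrite /A mulmxDr mulmxDl.
  - by move=> g c X; rewrite /A -scalemxAr -scalemxAl.
  - move=> g X Y Gg; rewrite /A fdot_mulr ?trmxK; last exact: Onu.
    by rewrite fdot_mull//; exact: Omu.
  - by move=> X; rewrite /A mu1 nu1 trmx1 mul1mx mulmx1.
  - move=> g h X Gg Gh.
    (* Since [nu] is exactly multiplicative, only the defect of [mu] remains. *)
    have -> : A (g *m h) X - A g (A h X) = (mu (g *m h) - mu g *m mu h) *m X *m (nu (g *m h))^T.
      by rewrite /A nuM// trmx_mul !mulmxA !mulmxBl.
    rewrite fnorm_mulr ?trmxK; last first.
      by apply: Onu; case: Gsub => _ _ h1 _; exact: h1.
    by rewrite (le_trans (fnormM _ _))// ler_wpM2r ?fnorm_ge0// mud.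
have hB g : g \in B -> fsq (A g e - e) <= k0 ^+ 2.
  move=> gB; rewrite -fnorm_leP ?(ltW k00)// Ae; last exact: BG.
  rewrite ler_pdivrMl// (le_trans (munu _ gB))// (le_trans delk)//.
  by rewrite ler_peMl// ltW.
have hd := hk m A del e qA (ltW del0) delk e1 hB.
move=> g Gg; have := extract Gfin qA del0 e1 Gg tau0 hd.
rewrite Ae// ler_pdivrMl// => h; apply: (le_trans h).
have -> : Num.sqrt tau = eps / (8 * sm) by rewrite sqrtr_sqr ger0_norm// ltW.
have h1 : sm * (eps / (8 * sm)) = eps / 8 by field; exact: lt0r_neq0.
have h2 : sm * (eps / (14 * sm)) = eps / 14 by field; exact: lt0r_neq0.
have h3 : sm * del <= eps / 14 by rewrite -h2 ler_wpM2l// ltW.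
have -> : sm * (4 * (eps / (8 * sm)) + 7 * del) = 4 * (sm * (eps / (8 * sm))) + 7 * (sm * del) by ring.
by rewrite h1; lra.
Qed.
End Core.

(** * Unitary matrices and compactness *)

Section ComplexReal.
Context {R : realType}.
Notation C := (C R).
Notation cRe := (@complex.Re R).
Notation cIm := (@complex.Im R).
Implicit Types z w : C.

Lemma cReD z w : cRe (z + w) = cRe z + cRe w. Proof. by case: z w => [a b] [c d]. Qed.
Lemma cImD z w : cIm (z + w) = cIm z + cIm w. Proof. by case: z w => [a b] [c d]. Qed.
Lemma cReN z : cRe (- z) = - cRe z. Proof. by case: z. Qed.
Lemma cImN z : cIm (- z) = - cIm z. Proof. by case: z. Qed.
Lemma cReM z w : cRe (z * w) = cRe z * cRe w - cIm z * cIm w.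
Proof. by case: z w => [a b] [c d]. Qed.
Lemma cImM z w : cIm (z * w) = cRe z * cIm w + cIm z * cRe w.
Proof. by case: z w => [a b] [c d]. Qed.
Lemma cReJ z : cRe (z^*) = cRe z. Proof. by case: z. Qed.
Lemma cImJ z : cIm (z^*) = - cIm z. Proof. by case: z. Qed.
Lemma cRe_sum (I : Type) (s : seq I) (F : I -> C) : cRe (\sum_(i <- s) F i) = \sum_(i <- s) cRe (F i).
Proof. exact: (big_morph cRe cReD erefl). Qed.
Lemma cIm_sum (I : Type) (s : seq I) (F : I -> C) : cIm (\sum_(i <- s) F i) = \sum_(i <- s) cIm (F i).
Proof. exact: (big_morph cIm cImD erefl). Qed.
Lemma complex_ext z w : cRe z = cRe w -> cIm z = cIm w -> z = w.
Proof. by case: z w => [a b] [c d] /= -> ->. Qed.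

Section Realification.
Variable d : nat.
Implicit Types U V : 'M[C]_d.

Definition mRe U : 'M[R]_d := map_mx cRe U.
Definition mIm U : 'M[R]_d := map_mx cIm U.
(** C^d is viewed as R^(2d): unitary matrices become orthogonal, and real scalar products can be
    used throughout. *)
Definition rl U : 'M[R]_(d + d) := block_mx (mRe U) (- mIm U) (mIm U) (mRe U).

Lemma mReM U V : mRe (U *m V) = mRe U *m mRe V - mIm U *m mIm V.
Proof.
apply/matrixP => i j; rewrite !mxE cRe_sum -sumrB; apply: eq_bigr => k _.
by rewrite !mxE cReM.
Qed.
Lemma mImM U V : mIm (U *m V) = mRe U *m mIm V + mIm U *m mRe V.
Proof.
apply/matrixP => i j; rewrite !mxE cIm_sum -big_split/=; apply: eq_bigr => k _.
by rewrite !mxE cImM.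
Qed.

Lemma rlM U V : rl (U *m V) = rl U *m rl V.
Proof.
rewrite /rl mulmx_block mReM mImM !(mulmxN, mulNmx).
by congr block_mx; rewrite ?opprD// addrC.
Qed.

Lemma rlB U V : rl (U - V) = rl U - rl V.
Proof.
rewrite /rl opp_block_mx add_block_mx; congr block_mx; apply/matrixP => i j;
  by rewrite !mxE ?(cReD, cImD, cReN, cImN) ?opprD.
Qed.

Lemma rl1 : rl 1%:M = 1%:M.
Proof.
have h1 : mRe 1%:M = 1%:M by apply/matrixP => i j; rewrite !mxE; case: eqP.
have h2 : mIm 1%:M = 0 by apply/matrixP => i j; rewrite !mxE; case: eqP.
by rewrite /rl h1 h2 oppr0 -scalar_mx_block.
Qed.

Lemma rl_adj U : rl (map_mx (fun z : C => z^*) U)^T = (rl U)^T.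
Proof.
rewrite /rl tr_block_mx; congr block_mx; apply/matrixP => i j;
  by rewrite !mxE ?cReJ ?cImJ ?opprK.
Qed.

Lemma rl_orth U : unitary U -> (rl U)^T *m rl U = 1%:M.
Proof. by move=> hU; rewrite -rl_adj -rlM hU rl1. Qed.

Definition csq U : R := \sum_i \sum_j cnormsq (U i j).

Lemma fsq_rl U : fsq (rl U) = 2 * csq U.
Proof.
rewrite /fsq /fdot big_split_ord/= mulr_natl mulr2n; congr (_ + _); apply: eq_bigr => i _;
  rewrite big_split_ord/= -big_split/=; apply: eq_bigr => j _; rewrite /cnormsq !expr2.
  by rewrite block_mxEul block_mxEur !mxE mulrNN.
by rewrite block_mxEdl block_mxEdr !mxE addrC.
Qed.

Lemma cnormsq_ge0 z : 0 <= cnormsq z.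
Proof. by rewrite addr_ge0 ?sqr_ge0. Qed.

Lemma csqM U V : csq (U *m V) <= 2 * csq U * csq V.
Proof.
have := fnormM (rl U) (rl V); rewrite -rlM -(@ler_pXn2r _ 2) ?nnegrE ?mulr_ge0 ?fnorm_ge0//.
by rewrite exprMn !fnorm_sq !fsq_rl; lra.
Qed.

(** The vector is placed in the first column of an otherwise zero matrix, which reduces the estimate
    to [csqM]; the factor 2 there is the one in [fsq_rl]. *)
Lemma vnorm_mul U (v : 'cV[C]_d) : vnorm (U *m v) <= fnorm (rl U) * vnorm v.
Proof.
have [d0|d0] := posnP d.
  have v0 (w : 'cV[C]_d) : vnorm w = 0.
    by rewrite /vnorm big1 ?sqrtr0// => i _; have := ltn_ord i; rewrite [X in (_ < X)%N]d0.
  by rewrite !v0 mulr0.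
pose j0 := Ordinal d0.
pose V : 'M[C]_d := \matrix_(i, j) (if j == j0 then v i 0 else 0).
have c0 : cnormsq (0 : C) = 0 by rewrite /cnormsq /= expr0n addr0.
have col (w : 'cV[C]_d) (W : 'M[C]_d) : (forall i j, W i j = if j == j0 then w i 0 else 0) ->
    csq W = \sum_i cnormsq (w i 0).
  move=> h; apply: eq_bigr => i _; rewrite (bigD1 j0)//= h eqxx big1 ?addr0// => j jj.
  by rewrite h (negbTE jj).
have cV : csq V = \sum_i cnormsq (v i 0) by apply: col => i j; rewrite mxE.
have cUV : csq (U *m V) = \sum_i cnormsq ((U *m v) i 0).
  apply: col => i j; rewrite !mxE; case: eqP => [->|jj].
    by apply: eq_bigr => k _; rewrite !mxE eqxx.
  by apply: big1 => k _; rewrite mxE; case: eqP => // _; rewrite mulr0.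
rewrite /vnorm -cV -cUV /fnorm -sqrtrM ?fdot_ge0// ler_wsqrtr// fsq_rl.
exact: csqM.
Qed.

Lemma opnorm_le U c : 0 <= c -> fnorm (rl U) <= c -> opnorm U <= c.
Proof.
move=> c0 hc; rewrite /opnorm; set S := [set _ | _ in _].
(* For d = 0 there is no unit vector, and the supremum of the empty set is 0 by convention. *)
have [[x Sx]|S0] := pselect (S !=set0); last first.
  by rewrite (_ : S = set0) ?sup0//; apply/seteqP; split => // x Sx; apply: S0; exists x.
apply: ge_sup; first by exists x.
move=> _ [v /= v1 <-]; apply: le_trans (vnorm_mul U v) _.
by rewrite v1 mulr1.
Qed.

Lemma opnorm_ge U v : vnorm v = 1 -> vnorm (U *m v) <= opnorm U.
Proof.
move=> v1; apply: ub_le_sup; last by exists v.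
exists (fnorm (rl U)) => _ [w /= w1 <-]; apply: le_trans (vnorm_mul U w) _.
by rewrite w1 mulr1.
Qed.

Lemma opnorm_ge0 U : 0 <= opnorm U.
Proof.
rewrite /opnorm; set S := [set _ | _ in _].
have [[x [v v1 _]]|S0] := pselect (S !=set0); last first.
  by rewrite (_ : S = set0) ?sup0//; apply/seteqP; split => // x Sx; apply: S0; exists x.
by apply: le_trans (opnorm_ge U v1); exact: sqrtr_ge0.
Qed.

Lemma entry_opnorm U i j : cnormsq (U i j) <= opnorm U ^+ 2.
Proof.
pose v : 'cV[C]_d := delta_mx j 0.
have v1 : vnorm v = 1.
  rewrite /vnorm (bigD1 j)//= big1 ?addr0 => [|k kj].
    by rewrite mxE !eqxx /cnormsq/= expr1n expr0n addr0 sqrtr1.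
  by rewrite mxE (negbTE kj) /cnormsq/= expr0n addr0.
have h := opnorm_ge U v1.
have o0 := opnorm_ge0 U.
apply: (@le_trans _ _ (vnorm (U *m v) ^+ 2)); last first.
  by rewrite lerXn2r ?nnegrE// sqrtr_ge0.
rewrite /vnorm sqr_sqrtr; last by apply: sumr_ge0 => k _; exact: cnormsq_ge0.
rewrite (bigD1 i)//= -[(U *m v) i 0](_ : U i j = _) ?lerDl; last by rewrite -colE mxE.
by apply: sumr_ge0 => k _; exact: cnormsq_ge0.
Qed.

(** Each entry is bounded by the operator norm; the constant is crude, with 2 d^2 replaced by (2
    d)^2, which is harmless for fixed [d]. *)
Lemma fnorm_opnorm U c : 0 <= c -> opnorm U <= c -> fnorm (rl U) <= (2 * d)%:R * c.
Proof.
move=> c0 hc; rewrite fnorm_leP ?mulr_ge0// fsq_rl exprMn.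
have h i j : cnormsq (U i j) <= c ^+ 2.
  apply: le_trans (entry_opnorm U i j) _.
  have o0 := opnorm_ge0 U.
  by rewrite lerXn2r.
have h2 : csq U <= d%:R * (d%:R * c ^+ 2).
  apply: (@le_trans _ _ (\sum_(i < d) \sum_(j < d) c ^+ 2)).
    by apply: ler_sum => i _; apply: ler_sum => j _.
  by rewrite !sumr_const !card_ord !mulr_natl.
have := mulr_ge0 (mulr_ge0 (ler0n R d) (ler0n R d)) (sqr_ge0 c).
by move: h2; rewrite natrM exprMn !expr2; lra.
Qed.

Lemma unitary_entry U i j : unitary U -> cnormsq (U i j) <= 1.
Proof.
move=> hU; have : cRe (((map_mx (fun z : C => z^*) U)^T *m U) j j) = 1 by rewrite hU mxE eqxx.
rewrite mxE cRe_sum (bigD1 i)//= => h.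
have e k : cRe ((map_mx (fun z : C => z^*) U)^T j k * U k j) = cnormsq (U k j).
  by rewrite !mxE cReM cReJ cImJ /cnormsq !expr2; ring.
rewrite -h e lerDl; apply: sumr_ge0 => k _; rewrite e; exact: cnormsq_ge0.
Qed.
End Realification.

Definition clim (u : nat -> C) : C := Complex (LIM (cRe \o u)) (LIM (cIm \o u)).
Definition cbnd (u : nat -> C) := bnd (cRe \o u) /\ bnd (cIm \o u).

Lemma bndN (u : nat -> R) : bnd u -> bnd (fun k => - u k).
Proof. by move=> [M hM]; exists M => k; rewrite normrN. Qed.
Lemma bndM (u v : nat -> R) : bnd u -> bnd v -> bnd (fun k => u k * v k).
Proof. by move=> [M hM] [N hN]; exists (M * N) => k; rewrite normrM ler_pM. Qed.
Lemma LIMN (u : nat -> R) : bnd u -> LIM (fun k => - u k) = - LIM u.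
Proof. by move=> hu; rewrite -mulN1r -LIMZ//; congr LIM; apply/funext => k; rewrite mulN1r. Qed.

Lemma climD u v : cbnd u -> cbnd v ->
  clim (fun k => u k + v k) = clim u + clim v /\ cbnd (fun k => u k + v k).
Proof.
move=> [u1 u2] [v1 v2].
have eR : cRe \o (fun k => u k + v k) = fun k => cRe (u k) + cRe (v k).
  by apply/funext => k; rewrite /= cReD.
have eI : cIm \o (fun k => u k + v k) = fun k => cIm (u k) + cIm (v k).
  by apply/funext => k; rewrite /= cImD.
split; last by split; rewrite ?eR ?eI; exact: bndD.
by apply: complex_ext; rewrite /= ?(eR, eI) LIMD.
Qed.

Lemma climM u v : cbnd u -> cbnd v ->
  clim (fun k => u k * v k) = clim u * clim v /\ cbnd (fun k => u k * v k).
Proof.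
move=> [u1 u2] [v1 v2].
have eR : cRe \o (fun k => u k * v k) = fun k => cRe (u k) * cRe (v k) + - (cIm (u k) * cIm (v k)).
  by apply/funext => k; rewrite /= cReM.
have eI : cIm \o (fun k => u k * v k) = fun k => cRe (u k) * cIm (v k) + cIm (u k) * cRe (v k).
  by apply/funext => k; rewrite /= cImM.
have b1 := bndM u1 v1; have b2 := bndM u2 v2; have b3 := bndM u1 v2; have b4 := bndM u2 v1.
split; last by split; rewrite ?eR ?eI; apply: bndD => //; exact: bndN.
apply: complex_ext; rewrite /= ?cReM ?cImM /= ?(eR, eI).
  by rewrite LIMD ?LIMN ?LIMM//; exact: bndN.
by rewrite LIMD ?LIMM.
Qed.

Lemma climJ u : cbnd u -> clim (fun k => (u k)^*) = (clim u)^* /\ cbnd (fun k => (u k)^*).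
Proof.
move=> [u1 u2].
have eR : cRe \o (fun k => (u k)^*) = cRe \o u by apply/funext => k; rewrite /= cReJ.
have eI : cIm \o (fun k => (u k)^*) = fun k => - cIm (u k) by apply/funext => k; rewrite /= cImJ.
split; last by split; rewrite ?eR ?eI//; exact: bndN.
by apply: complex_ext; rewrite ?cReJ ?cImJ /= ?(eR, eI) ?LIMN.
Qed.

Lemma clim_cst z : clim (fun _ => z) = z /\ cbnd (fun _ => z).
Proof.
split; last by split; exact: bnd_cst.
by apply: complex_ext; rewrite /= LIM_cst.
Qed.

Lemma clim_sum (I : Type) (s : seq I) (F : I -> nat -> C) : (forall i, cbnd (F i)) ->
  clim (fun k => \sum_(i <- s) F i k) = \sum_(i <- s) clim (F i) /\
  cbnd (fun k => \sum_(i <- s) F i k).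
Proof.
move=> hF; elim: s => [|i s [IH1 IH2]].
  have -> : (fun k => \sum_(i <- [::]) F i k) = fun _ => 0 by apply/funext => k; rewrite big_nil.
  by rewrite big_nil; exact: clim_cst.
have -> : (fun k => \sum_(i <- i :: s) F i k) = fun k => F i k + \sum_(i <- s) F i k.
  by apply/funext => k; rewrite big_cons.
rewrite big_cons -IH1; exact: climD.
Qed.
End ComplexReal.

(** * Limits of counterexamples and conclusion *)

Section Compactness.
Context {R : realType}.

(** Boundedness is included because additivity of [LIM] is available for bounded sequences. *)
Definition nul (u : nat -> R) := bnd u /\ LIM u = 0.

Lemma nul_sum (I : eqType) (s : seq I) (F : I -> nat -> R) : (forall i, i \in s -> nul (F i)) ->
  nul (fun k => \sum_(i <- s) F i k).
Proof.
elim: s => [|i s IH] hF.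
  have -> : (fun k => \sum_(i <- [::]) F i k) = fun _ => 0 by apply/funext => k; rewrite big_nil.
  by split; [exact: bnd_cst|exact: LIM_cst].
have -> : (fun k => \sum_(i <- i :: s) F i k) = fun k => F i k + \sum_(i <- s) F i k.
  by apply/funext => k; rewrite big_cons.
have [b1 l1] := hF i (mem_head _ _).
have [b2 l2] := IH (fun j js => hF j (mem_behead (s := i :: s) js)).
by split; [exact: bndD|rewrite LIMD// l1 l2 addr0].
Qed.

Lemma nul_sqr (u : nat -> R) : bnd u -> nul (fun k => (u k - LIM u) ^+ 2).
Proof.
move=> bu.
have b1 : bnd (fun k => u k - LIM u) by apply: bndD => //; exact: bnd_cst.
have l1 : LIM (fun k => u k - LIM u) = 0.
  rewrite (LIMD bu (bnd_cst _ (- LIM u))) LIM_cst subrr//.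
have -> : (fun k => (u k - LIM u) ^+ 2) = fun k => (u k - LIM u) * (u k - LIM u).
  by apply/funext => k; rewrite expr2.
by split; [exact: bndM|rewrite LIMM// l1 mul0r].
Qed.

Lemma LIM_close (u v : nat -> R) : bnd u -> bnd v ->
  (forall k, `|u k - v k| <= k.+1%:R^-1) -> LIM u = LIM v.
Proof.
move=> bu bv huv; apply/eqP; rewrite -subr_eq0 -LIMN// -LIMD//; last exact: bndN.
apply/eqP; apply: LIM_lim; apply/cvgr0Pnorm_lt => e e0.
have /cvgr0Pnorm_lt /(_ _ e0) := @cvg_harmonic R; apply: filterS => k; apply: le_lt_trans.
by rewrite (le_trans (huv k))// ler_norm.
Qed.

Lemma sqr_le_norm (x c : R) : 0 <= c -> x ^+ 2 <= c ^+ 2 -> `|x| <= c.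
Proof.
by move=> c0; rewrite -[x ^+ 2]real_normK ?num_real// ler_pXn2r// nnegrE.
Qed.
End Compactness.

Theorem theorem0p4 (R : realType) (n : nat) (Gam : 'M[R]_n -> Prop) :
  (3 <= n)%N -> lattice_SL Gam ->
  forall (d : nat) (eps : R), 0 < eps ->
  exists2 delta : R, 0 < delta &
    forall mu : 'M[R]_n -> 'M[C R]_d,
      unitary_valued Gam mu -> mu 1%:M = 1%:M -> defect Gam mu <= delta ->
      exists2 rho : 'M[R]_n -> 'M[C R]_d, unitary_rep Gam rho & udist Gam mu rho <= eps.
Proof.
move=> n3 [Gsub Gdisc Gfin] d eps eps0.
have [GSL G1 GM GV] := Gsub.
have entryB (U V : 'M[C R]_d) i j : (U - V) i j = U i j - V i j by rewrite !mxE.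
have udist_le (mu rho : 'M[R]_n -> 'M[C R]_d) :
    (forall g, Gam g -> fnorm (rl (mu g) - rl (rho g)) <= eps) -> udist Gam mu rho <= eps.
  move=> h; apply: ge_sup; first by exists (opnorm (mu 1%:M - rho 1%:M)); exists 1%:M.
  move=> _ [g Gg <-]; apply: opnorm_le; first exact: ltW.
  by rewrite rlB; exact: h.
(* Dimension 0 is treated apart, since [real_core] normalises the identity matrix. *)
have [d0|d0] := posnP d.
  exists 1 => // mu _ _ _; exists (fun _ => 1%:M); last first.
    apply: udist_le => g _; rewrite -rlB /fnorm fsq_rl /csq big1 ?mulr0 ?sqrtr0 ?ltW// => i _.
    by have := ltn_ord i; rewrite [X in (_ < X)%N]d0.
  by split => [g _|x y _ _]; apply/matrixP => i j; have := ltn_ord i; rewrite [X in (_ < X)%N]d0.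
have m0 : (0 < d + d)%N by rewrite addn_gt0 d0.
have [B [k0 [BG k00 core]]] := real_core n3 Gsub Gdisc Gfin m0 eps0.
apply: contrapT => H.
have bad (k : nat) : exists mu : 'M[R]_n -> 'M[C R]_d,
    [/\ unitary_valued Gam mu, mu 1%:M = 1%:M, defect Gam mu <= k.+1%:R^-1 &
     forall rho, unitary_rep Gam rho -> ~ udist Gam mu rho <= eps].
  apply: contrapT => h; apply: H; exists k.+1%:R^-1; first by rewrite invr_gt0 ltr0n.
  move=> mu u1 u2 u3; apply: contrapT => h'; apply: h; exists mu; split => // rho hr hd.
  by apply: h'; exists rho.
have {H bad} [mu hmu] := choice bad.
have muU k : unitary_valued Gam (mu k) by case: (hmu k).
have mud k x y : Gam x -> Gam y -> opnorm (mu k (x *m y) - mu k x *m mu k y) <= k.+1%:R^-1.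
  move=> Gx Gy; have [_ _ hd _] := hmu k; apply: le_trans hd.
  (* [sup] has the default value 0 on sets unbounded above, so the defect controls the individual
     terms only once a bound is exhibited; unitarity provides one. *)
  apply: ub_le_sup; last by exists (x, y).
  pose m : R := (d + d)%:R.
  exists (Num.sqrt m + Num.sqrt m * Num.sqrt m) => _ [[x' y'] /= [Gx' Gy'] <-].
  have on g : Gam g -> fnorm (rl (mu k g)) = Num.sqrt m.
    by move=> Gg; apply: fnorm_orth; apply: rl_orth; exact: muU.
  apply: opnorm_le; first by rewrite addr_ge0 ?mulr_ge0 ?sqrtr_ge0.
  rewrite rlB rlM (le_trans (fnormD _ _))// fnormN on ?lerD2l; last exact: GM.
  by rewrite (le_trans (fnormM _ _))// !on.
have bnd_mu g i j : Gam g -> cbnd (fun k => mu k g i j).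
  move=> Gg; have h k := unitary_entry i j (muU k g Gg).
  split; exists 1 => k /=; apply: sqr_le_norm => //; rewrite expr1n; apply: le_trans (h k);
    by rewrite /cnormsq ?lerDl ?lerDr sqr_ge0.
(* The entrywise ultralimit of the counterexamples: unitary because [LIM] respects sums and
   products, multiplicative because the defects tend to 0. *)
pose rho (g : 'M[R]_n) : 'M[C R]_d := \matrix_(i, j) clim (fun k => mu k g i j).
have prod (F F' : nat -> 'M[C R]_d) : (forall i j, cbnd (fun k => F k i j)) ->
    (forall i j, cbnd (fun k => F' k i j)) -> forall i j,
    clim (fun k => (F k *m F' k) i j) = \sum_l clim (fun k => F k i l) * clim (fun k => F' k l j) /\
    cbnd (fun k => (F k *m F' k) i j).
  move=> bF bF' i j.
  have -> : (fun k => (F k *m F' k) i j) = fun k => \sum_l F k i l * F' k l j.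
    by apply/funext => k; rewrite mxE.
  have [-> b] := clim_sum (index_enum 'I_d) (fun l => (climM (bF i l) (bF' l j)).2).
  by split => //; apply: eq_bigr => l _; have [] := climM (bF i l) (bF' l j).
have rhoU : unitary_valued Gam rho.
  move=> g Gg; apply/matrixP => i j.
  pose F k := (map_mx (fun z : C R => z^*) (mu k g))^T.
  have bF a b : cbnd (fun k => F k a b).
    rewrite (_ : (fun k => _) = fun k => (mu k g b a)^*); last by apply/funext => k; rewrite !mxE.
    by have [] := climJ (bnd_mu g b a Gg).
  have [h _] := prod F (fun k => mu k g) bF (fun a b => bnd_mu g a b Gg) i j.
  rewrite mxE; transitivity (\sum_l clim (fun k => F k i l) * clim (fun k => mu k g l j)).
    apply: eq_bigr => l _; rewrite !mxE; congr (_ * _).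
    rewrite (_ : (fun k => F k i l) = fun k => (mu k g l i)^*); last by apply/funext => k; rewrite !mxE.
    by have [] := climJ (bnd_mu g l i Gg).
  rewrite -h; have -> : (fun k => (F k *m mu k g) i j) = fun _ => (1%:M : 'M[C R]_d) i j.
    by apply/funext => k; rewrite /F (muU k g Gg).
  exact: (clim_cst _).1.
have rhoM x y : Gam x -> Gam y -> rho (x *m y) = rho x *m rho y.
  move=> Gx Gy; apply/matrixP => i j; rewrite !mxE.
  have [h b] := prod (fun k => mu k x) (fun k => mu k y) (fun a b => bnd_mu x a b Gx)
    (fun a b => bnd_mu y a b Gy) i j.
  transitivity (clim (fun k => (mu k x *m mu k y) i j)); last first.
    by rewrite h; apply: eq_bigr => l _; rewrite !mxE.
  have [b1 b2] := bnd_mu _ i j (GM _ _ Gx Gy); have [b3 b4] := b.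
  have hk k : cnormsq ((mu k (x *m y) - mu k x *m mu k y) i j) <= k.+1%:R^-1 ^+ 2.
    apply: (le_trans (entry_opnorm _ i j)).
    have o0 : 0 <= opnorm (mu k (x *m y) - mu k x *m mu k y).
      by apply: opnorm_ge0.
    by apply: lerXn2r; rewrite ?nnegrE ?invr_ge0//; exact: mud.
  apply: complex_ext => /=; apply: LIM_close => // k; apply: sqr_le_norm; rewrite ?invr_ge0//;
    apply: le_trans (hk k); rewrite /cnormsq entryB.
    by rewrite cReD cReN /= lerDl sqr_ge0.
  by rewrite cImD cImN /= lerDr sqr_ge0.
have rhoR : unitary_rep Gam rho by [].
(* One nonnegative sum over [B] with limit 0 lets a single index serve all elements of [B]. *)
have nulB : nul (fun k => \sum_(g <- B) fsq (rl (mu k g - rho g))).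
  apply: nul_sum => g /BG Gg.
  (* The list [:: true; true] only produces the factor 2 of [fsq_rl]; the boolean [c] selects the
     real or the imaginary part. *)
  have -> : (fun k => fsq (rl (mu k g - rho g))) = fun k =>
      \sum_(i <- index_enum 'I_d) \sum_(j <- index_enum 'I_d) \sum_(b <- [:: true; true])
        \sum_(c <- [:: true; false])
        ((if c then complex.Re (mu k g i j) else complex.Im (mu k g i j)) -
         LIM (fun k => if c then complex.Re (mu k g i j) else complex.Im (mu k g i j))) ^+ 2.
    apply/funext => k; rewrite fsq_rl /csq mulr_sumr; apply: eq_bigr => i _.
    rewrite mulr_sumr; apply: eq_bigr => j _.
    rewrite !big_cons !big_nil !addr0 mulr_natl mulr2n /cnormsq entryB.
    by rewrite cReD cImD cReN cImN mxE.
  apply: nul_sum => i _; apply: nul_sum => j _; apply: nul_sum => b _; apply: nul_sum => c _.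
  by apply: nul_sqr; have [b1 b2] := bnd_mu g i j Gg; case: c.
have [N hN] : exists N : nat, forall k, (N <= k)%N -> (2 * d)%:R * k.+1%:R^-1 <= k0.
  have h : ((2 * d)%:R * N.+1%:R^-1) @[N --> \oo] --> ((2 * d)%:R * 0 : R).
    by apply: cvgM; [exact: cvg_cst|exact: cvg_harmonic].
  rewrite mulr0 in h; have /cvgr0Pnorm_lt /(_ _ k00)[N _ hN] := h.
  by exists N => k Nk; apply: ltW; apply: le_lt_trans (hN k Nk); exact: ler_norm.
have k02 : 0 < k0 ^+ 2 by rewrite exprn_gt0.
(* The index is close to the limit on [B] and also beyond N, where the defect is small enough. *)
have [k Nk] := LIM_near N nulB.1 k02; rewrite nulB.2 subr0 => hk.
have [_ mu1 _ nope] := hmu k; apply: (nope _ rhoR); apply: udist_le.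
apply: (core (fun g => rl (mu k g)) (fun g => rl (rho g))).
- by move=> g Gg; apply: rl_orth; exact: muU.
- by move=> g Gg; apply: rl_orth; exact: rhoU.
- by rewrite mu1 rl1.
- by move=> g h Gg Gh; rewrite rhoM// rlM.
- move=> g h Gg Gh; rewrite -rlM -rlB; apply: le_trans (hN k Nk).
  by apply: fnorm_opnorm; [rewrite invr_ge0|exact: mud].
- move=> g gB; rewrite -rlB fnorm_leP ?(ltW k00)//.
  apply: le_trans (ltW hk); rewrite ger0_norm; last by apply: sumr_ge0 => g' _; exact: fdot_ge0.
  by rewrite (big_rem g)//= lerDl; apply: sumr_ge0 => g' _; exact: fdot_ge0.
Qed.
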